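(* Let $M$ be a smooth manifold of dimension at least $4$. Then the complete $C^0$-close $h$-principle holds for bracket-generating distributions of step $2$ in $M$; that is, for every rank $k<\dim M$ it holds for the differential relation $\mathcal{R}^{\mathrm{step2}}\subset J^1(\mathrm{Gr}_k(TM))$.
   Context: A distribution $\xi\subset TM$ of rank $k$ is a section of the Grassmann bundle $\mathrm{Gr}_k(TM)\to M$. Its curvature is the bundle map $\Omega^\xi:\wedge^2\xi\to TM/\xi$ induced by the Lie bracket, $(u,v)\mapsto [u,v] \bmod \xi$. The distribution $\xi\ne TM$ is bracket-generating of step $2$ if sections of $\xi$ together with their Lie brackets span $TM$, equivalently if $\Omega^\xi$ is an epimorphism. Since the curvature depends only on first derivatives, every $F\in J^1(\mathrm{Gr}_k(TM))$ over $p$ has an underlying $k$-plane $j^0F\subset T_pM$ and a curvature $\Omega^F:\wedge^2 j^0F\to T_pM/j^0F$. The relation $\mathcal{R}^{\mathrm{step2}}\subset J^1(\mathrm{Gr}_k(TM))$ consists of those $F$ for which $\Omega^F$ is an epimorphism. A formal solution of a first-order relation $\mathcal{R}\subset J^1(X)$ is a section $F:M\to\mathcal{R}$; it is a solution if it is holonomic, i.e. $F=j^1f$ for a section $f$ of $X$. Complete (= full) $C^0$-close $h$-principle for $\mathcal{R}\subset J^1(X)$: for every compact manifold $K$, every smooth family $(F_k)_{k\in K}$ of formal solutions, all closed $M'\subset M$, $K'\subset K$ such that $F_k$ is a solution near $M'$ for all $k$ and is a solution on $M$ for all $k$ near $K'$, and every (positive, continuous) $\varepsilon$, there is a homotopy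 of families of formal solutions $(F_{k,s})_{s\in[0,1]}$ with $F_{k,0}=F_k$, every $F_{k,1}$ a solution, $F_{k,s}=F_k$ near $M'$ and for $k$ near $K'$, and the underlying sections $j^0F_{k,s}$ of $X$ being $\varepsilon$-close in $C^0$ to $j^0F_k$. *)

(* Defs.v *)
From HB Require Import structures.
From mathcomp Require Import all_boot all_order all_algebra.
From mathcomp Require Import all_classical all_reals all_analysis.

Set Implicit Arguments.
Unset Strict Implicit.
Unset Printing Implicit Defensive.

Import Order.TTheory GRing.Theory Num.Theory numFieldNormedType.Exports.
Local Open Scope classical_set_scope.
Local Open Scope ring_scope.

Section SmoothMaps.
Context {R : realType} {V W : normedModType R}.

(* Class C^r on an open set O, by iterated directional derivatives; for the
   finite-dimensional V used below this is the usual notion. *)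
Fixpoint Cr_on (r : nat) (O : set V) (f : V -> W) : Prop :=
  (forall x, O x -> {for x, continuous f}) /\
  (if r is r'.+1 then
     forall v, (forall x, O x -> derivable f x v) /\
               Cr_on r' O (fun x => 'D_v f x)
   else True).

(* On an arbitrary set A, such as a relatively open subset of a half-space or
   of a product with [0, 1], smooth means: locally the restriction of a smooth
   map defined on an open set of V. *)
Definition smooth_on (A : set V) (f : V -> W) : Prop :=
  forall x, A x -> exists O g,
    [/\ open_nbhs x O, forall r, Cr_on r O g & forall y, O y -> A y -> f y = g y].

End SmoothMaps.

(* Smooth manifolds modelled on the relatively open subsets of H, given by an
   atlas. [chart_inv i] is only meaningful on the image of [dom i]. *)
Record smooth_manifold_on (R : realType) (n : nat) (H : set 'rV[R]_n) :=
  SmoothManifold {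
    carrier :> topologicalType;
    chart_index : Type;
    dom : chart_index -> set carrier;
    chart : chart_index -> carrier -> 'rV[R]_n;
    chart_inv : chart_index -> 'rV[R]_n -> carrier;
    manifold_hausdorff : hausdorff_space carrier;
    manifold_second_countable : @second_countable carrier;
    dom_open : forall i, open (dom i);
    dom_cover : forall p, exists i, dom i p;
    chartK : forall i p, dom i p -> chart_inv i (chart i p) = p;
    chart_image_open : forall i,
      exists2 O : set 'rV[R]_n, open O & chart i @` dom i = O `&` H;
    chart_continuous : forall i, {within dom i, continuous (chart i)};
    chart_inv_continuous : forall i,
      {within chart i @` dom i, continuous (chart_inv i)};
    transition_smooth : forall i j,
      smooth_on (chart i @` (dom i `&` dom j))
                (fun x => chart j (chart_inv i x)) }.

Definition manifold (R : realType) (n : nat) :=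
  @smooth_manifold_on R n [set: 'rV[R]_n].

Definition halfspace (R : realType) (d : nat) : set 'rV[R]_d :=
  [set x | forall j : 'I_d, val j = 0%N -> 0 <= x ord0 j].

(* The boundary may be empty. *)
Definition manifold_with_boundary (R : realType) (d : nat) :=
  smooth_manifold_on (@halfspace R d).

Section Distributions.
Context {R : realType} {n : nat} (M : manifold R n).

Definition chart_image (i : chart_index M) : set 'rV[R]_n := chart i @` dom i.

(* A tangent vector at p is the family of its coordinates in all the charts
   around p; the junk value 0 in the other charts makes it unique. *)
Definition tvec := chart_index M -> 'rV[R]_n.

Definition tangent (p : M) : set tvec := [set w |
  (forall i, ~ dom i p -> w i = 0) /\
  (forall i j, dom i p -> dom j p ->
     w j = 'D_(w i) (fun x => chart j (chart_inv i x)) (chart i p))].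

Definition vector_field := M -> tvec.

Definition smooth_vector_field_on (O : set M) (X : vector_field) : Prop :=
  (forall p, O p -> tangent p (X p)) /\
  (forall i, smooth_on (chart i @` (dom i `&` O))
                       (fun x => X (chart_inv i x) i)).

Definition lie_bracket (X Y : vector_field) : vector_field := fun p i =>
  let Xi x := X (chart_inv i x) i in
  let Yi x := Y (chart_inv i x) i in
  let x := chart i p in
  if `[< dom i p >] then 'D_(Xi x) Yi x - 'D_(Yi x) Xi x else 0.

(* Gr_k(T_p M) *)
Definition grassmann (k : nat) (p : M) : set (set tvec) := [set V |
  exists w : 'I_k -> tvec,
    [/\ forall j, tangent p (w j),
        forall c : 'I_k -> R, \sum_j c j *: w j = 0 -> forall j, c j = 0 &
        V = [set u | exists c : 'I_k -> R, u = \sum_j c j *: w j]]].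

Definition plane_field := M -> set tvec.

(* The orthogonal projection matrix (acting on row vectors) onto a linear
   subspace V of R^n. It embeds Gr_k(R^n) as a smooth submanifold of the space
   of matrices, and it is through this embedding that smoothness and first
   derivatives of maps to Gr_k(R^n) are expressed. *)
Definition orth_proj (V : set 'rV[R]_n) : 'M[R]_n :=
  get [set P : 'M[R]_n | [/\ P^T = P, P *m P = P & V = [set v | (v <= P)%MS]]].

(* A plane field read in the chart i, as a map from R^n to Gr_k(R^n). *)
Definition plane_coord (i : chart_index M) (xi : plane_field) (x : 'rV[R]_n) :
    'M[R]_n :=
  orth_proj [set w i | w in xi (chart_inv i x)].

Definition distribution_on (k : nat) (O : set M) (xi : plane_field) : Prop :=
  (forall p, O p -> grassmann k p (xi p)) /\
  (forall i, smooth_on (chart i @` (dom i `&` O)) (plane_coord i xi)).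

(* Local sections of Gr_k(TM) near p, with junk values away from p. *)
Definition local_section (k : nat) (p : M) (xi : plane_field) : Prop :=
  exists2 O, open_nbhs p O & distribution_on k O xi.

Definition same_jet1 (p : M) (xi eta : plane_field) : Prop :=
  forall i, dom i p ->
    plane_coord i xi (chart i p) = plane_coord i eta (chart i p) /\
    forall v, 'D_v (plane_coord i xi) (chart i p) =
              'D_v (plane_coord i eta) (chart i p).

(* A 1-jet at p is a set of local sections near p: an equivalence class for
   [same_jet1 p]. *)
Definition jet := set plane_field.

(* j^1_p xi *)
Definition jet1 (k : nat) (xi : plane_field) (p : M) : jet :=
  [set eta | local_section k p eta /\ same_jet1 p xi eta].

(* The fibre over p of J^1(Gr_k(TM)) *)
Definition J1 (k : nat) (p : M) : set jet :=
  [set F | exists2 xi, local_section k p xi & F = jet1 k xi p].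

(* The plane j^0 F of a jet F over p, on which all representatives agree. *)
Definition jet0 (p : M) (F : jet) : set tvec :=
  [set w | exists2 xi, F xi & xi p w].

(* Omega^F(u, v), as an element of T_p M / j^0 F: the coset of [X, Y](p) for
   X, Y sections of a representative of F extending u and v. *)
Definition curvature (p : M) (F : jet) (u v : tvec) : set tvec := [set w |
  exists xi O X Y,
    [/\ F xi, open_nbhs p O,
        smooth_vector_field_on O X /\ smooth_vector_field_on O Y,
        forall q, O q -> xi q (X q) /\ xi q (Y q) &
        [/\ X p = u, Y p = v & jet0 p F (w - lie_bracket X Y p)]]].

(* Surjectivity of the linear map from the second exterior power of j^0 F to
   T_p M / j^0 F induced by Omega^F; elements of the former are finite sums of
   decomposable bivectors u_l /\ v_l. *)
Definition curvature_epi (p : M) (F : jet) : Prop :=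
  forall w, tangent p w ->
    exists m (u v om : 'I_m -> tvec),
      (forall l, [/\ jet0 p F (u l), jet0 p F (v l) &
                     curvature p F (u l) (v l) (om l)]) /\
      jet0 p F (w - \sum_l om l).

Definition step2_relation (k : nat) (p : M) : set jet :=
  [set F | J1 k p F /\ curvature_epi p F].

(* Canonical coordinates on J^1(Gr_k(TM)) over the chart i: the value and the
   directional derivatives of any representative. *)
Definition jet_coord0 (i : chart_index M) (F : jet) (x : 'rV[R]_n) : 'M[R]_n :=
  plane_coord i (xget (fun=> set0) F) x.

Definition jet_coord1 (i : chart_index M) (F : jet) (x v : 'rV[R]_n) :
    'M[R]_n :=
  'D_v (plane_coord i (xget (fun=> set0) F)) x.

(* Smoothness of a family of sections of J^1(Gr_k(TM)), jointly in the base
   point and in a parameter ranging over a subset A of R^d or R^d x R. *)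
Definition smooth_jet_family (T : normedModType R) (A : set T)
    (F : T -> M -> jet) : Prop :=
  forall i,
    smooth_on (A `*` chart_image i)
      (fun z => jet_coord0 i (F z.1 (chart_inv i z.2)) z.2) /\
    forall v, smooth_on (A `*` chart_image i)
      (fun z => jet_coord1 i (F z.1 (chart_inv i z.2)) z.2 v).

(* Being a solution over an open set O, for a section of the relation. *)
Definition holonomic_on (k : nat) (O : set M) (F : M -> jet) : Prop :=
  exists2 xi, distribution_on k O xi & forall p, O p -> F p = jet1 k xi p.

Definition riemannian_metric (g : M -> tvec -> tvec -> R) : Prop :=
  (forall i, exists G : 'rV[R]_n -> 'M[R]_n,
     smooth_on (chart_image i) G /\
     forall p, dom i p ->
       (G (chart i p))^T = G (chart i p) /\
       forall u v, tangent p u -> tangent p v ->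
         g p u v = (u i *m G (chart i p) *m (v i)^T) ord0 ord0) /\
  (forall p u, tangent p u -> u <> 0 -> 0 < g p u u).

(* Gap distance less than e between two planes in T_p M; for each metric g it
   induces the topology of the fibre Gr_k(T_p M). *)
Definition planes_close (g : M -> tvec -> tvec -> R) (p : M) (e : R)
    (V W : set tvec) : Prop :=
  let norm u := Num.sqrt (g p u u) in
  (forall v, V v -> v <> 0 -> exists2 w, W w & norm (v - w) < e * norm v) /\
  (forall w, W w -> w <> 0 -> exists2 v, V v & norm (w - v) < e * norm w).

Section Families.
Context {d : nat} (K : manifold_with_boundary R d).

(* Smooth families (F_q), q in K, of formal solutions. *)
Definition formal_family (Rel : M -> set jet) (F : K -> M -> jet) : Prop :=
  (forall q p, Rel p (F q p)) /\
  (forall a, smooth_jet_family (chart a @` dom a)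
               (fun y => F (chart_inv a y))).

(* Homotopies (G_{q,s}), 0 <= s <= 1, of such families, smooth jointly in
   (q, s, p); the values for s outside [0, 1] are irrelevant. *)
Definition formal_homotopy (Rel : M -> set jet) (G : K -> R -> M -> jet) :
    Prop :=
  (forall q s p, 0 <= s <= 1 -> Rel p (G q s p)) /\
  (forall a, smooth_jet_family
      ((chart a @` dom a) `*` [set s : R | 0 <= s <= 1])
      (fun y => G (chart_inv a y.1) y.2)).

End Families.

Definition complete_C0_close_h_principle (k : nat) (Rel : M -> set jet) :
    Prop :=
  forall (d : nat) (K : manifold_with_boundary R d)
    (F : K -> M -> jet) (M' : set M) (K' : set K)
    (g : M -> tvec -> tvec -> R) (eps : M -> R),
  compact [set: K] -> formal_family Rel F -> closed M' -> closed K' ->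
  (exists U, [/\ open U, M' `<=` U & forall q, holonomic_on k U (F q)]) ->
  (exists Q, [/\ open Q, K' `<=` Q &
     forall q, Q q -> holonomic_on k [set: M] (F q)]) ->
  riemannian_metric g -> continuous eps -> (forall p, 0 < eps p) ->
  exists G : K -> R -> M -> jet,
    [/\ formal_homotopy Rel G,
        forall q p, G q 0 p = F q p,
        forall q, holonomic_on k [set: M] (G q 1),
        (exists U, [/\ open U, M' `<=` U &
           forall q s p, 0 <= s <= 1 -> U p -> G q s p = F q p]) /\
        (exists Q, [/\ open Q, K' `<=` Q &
           forall q s p, 0 <= s <= 1 -> Q q -> G q s p = F q p]) &
        forall q s p, 0 <= s <= 1 ->
          planes_close g p (eps p) (jet0 p (G q s p)) (jet0 p (F q p))].

End Distributions.

(* Main.v *)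
Require Import Defs.
From mathcomp Require Import all_boot all_order all_algebra.
From mathcomp Require Import all_classical all_reals all_analysis.
From mathcomp Require Import ring lra.

(* Convex integration in charts. Write a formal solution over a chart as a frame W,
   normalised to be the identity in k of the columns, with formal derivatives E;
   it is holonomic where e := E - dW vanishes. Since k >= 3 (the relation is
   empty for k <= 2 and dim M >= 4), there are distinct indices a, b, c. Adding to
   the rows b and c of W a rapid oscillation of small amplitude in the coordinate
   of a, in the directions of the curvatures Omega_ab and Omega_ac, multiplies the
   complex combination of Omega_ab and Omega_ac by 1 + r (u + i h), where u + i h
   is a loop of mean zero missing the half-line of nonpositive reals. For large r
   the curvature therefore stays surjective even if one component of e is removed
   from E at the same time. After finitely many steps e = 0 on the support of a
   bump function. Everything depends smoothly on parameters, among which the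
   homotopy time s, and e = 0 is preserved, so a locally finite sequence of such
   stages gives the homotopy. *)

Set Implicit Arguments.
Unset Strict Implicit.
Unset Printing Implicit Defensive.
Import Order.TTheory GRing.Theory Num.Theory numFieldNormedType.Exports.
Local Open Scope classical_set_scope.
Local Open Scope ring_scope.

(** * Differential calculus *)

Section DirectionalCalculus.
Context {R : realType}.

(** Three indices are used because a single curvature component could only be multiplied by a real
    function 1 + r u with u nonzero of mean zero, and such a function vanishes somewhere once r is
    large. With two components the factor is complex, and a closed curve of mean zero can miss the
    half-line on which 1 + r z would vanish. Mean zero makes the loop the derivative of a bounded
    periodic function, hence of a change of W as small as desired. The cutoff sigma scales the
    removed part of e and the loop alike, so the estimate does not degenerate as sigma tends to 0,
    and all intermediate times are formal solutions. Only one entry e(W_a)_b is removed per step: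
    this disturbs a single curvature component, one that the loop amplifies. Parts of e that vanish
    on the plane never enter the curvature and are removed for free. Normalised frames exist only
    over an affine chart of the Grassmannian, so a stage runs through all these charts, with cutoffs
    in their minors. Surjectivity is used in dual form, as positivity of a quadratic form on the
    unit sphere, where compactness gives uniform constants. *)

Lemma cvg_sumr (T : Type) (F : set_system T) {FF : Filter F} (W : normedModType R)
    (J : Type) (r : seq J) (f : J -> T -> W) (l : J -> W) :
  (forall j, f j t @[t --> F] --> l j) ->
  (\sum_(j <- r) f j t) @[t --> F] --> \sum_(j <- r) l j.
Proof.
move=> fl; elim: r => [|j r IH].
  rewrite big_nil; under eq_fun do rewrite big_nil; exact: cvg_cst.
rewrite big_cons; under eq_fun do rewrite big_cons; exact: cvgD.
Qed.

Lemma growth_shift (V W : normedModType R) (f : V -> W) (y e : V) (t : R) :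
  (fun h : R => h^-1 *: (((fun s : R => f (y + s *: e)) \o shift t) (h *: (1 : R))
                - f (y + t *: e))) =
  (fun h : R => h^-1 *: ((f \o shift (y + t *: e)) (h *: e) - f (y + t *: e))).
Proof.
apply/funext => h /=; congr (_ *: (f _ - _)).
have -> : h%:A = h :> R by exact: mulr1.
by rewrite scalerDl addrCA.
Qed.

Lemma is_derive_line (V W : normedModType R) (f : V -> W) (y e : V) (t : R) :
  derivable f (y + t *: e) e ->
  is_derive t (1 : R) (fun s : R => f (y + s *: e)) ('D_e f (y + t *: e)).
Proof.
move=> df; split.
  by rewrite /derivable growth_shift.
by rewrite /derive growth_shift.
Qed.

Lemma MVT_line (V : normedModType R) (f : V -> R) (y e : V) (a b : R) :
  a <= b ->
  (forall t, a <= t <= b -> derivable f (y + t *: e) e) ->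
  exists2 c, a <= c <= b &
    f (y + b *: e) - f (y + a *: e) = 'D_e f (y + c *: e) * (b - a).
Proof.
move=> ab df.
have [||c] := @MVT_segment R (fun s => f (y + s *: e))
  (fun s => 'D_e f (y + s *: e)) a b ab.
- move=> x; rewrite in_itv /= => /andP[ax xb]; apply: is_derive_line.
  by apply: df; rewrite !ltW.
- apply: derivable_within_continuous => x; rewrite in_itv /= => xab.
  by have [] := is_derive_line (df _ xab).
by rewrite in_itv /= => cab ->; exists c.
Qed.

Lemma MVT_line0 (V : normedModType R) (f : V -> R) (y e : V) (t : R) :
  (forall s, `|s| <= `|t| -> derivable f (y + s *: e) e) ->
  exists2 c, `|c| <= `|t| & f (y + t *: e) - f y = 'D_e f (y + c *: e) * t.
Proof.
move=> df; have [t0|t0] := leP 0 t.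
- have [s /andP[s0 st]|c /andP[c0 ct]] := @MVT_line V f y e 0 t t0.
    by apply: df; rewrite !ger0_norm.
  rewrite scale0r addr0 subr0 => ->; exists c => //.
  by rewrite !ger0_norm.
- have [s /andP[s0 st]|c /andP[c0 ct]] := @MVT_line V f y e t 0 (ltW t0).
    by apply: df; rewrite !ler0_norm ?lerN2 // ltW.
  rewrite scale0r addr0 sub0r => h; exists c.
    by rewrite !ler0_norm ?lerN2 // ltW.
  by rewrite -opprB h; ring.
Qed.

(** The bound is uniform over base points [z] near [y]. [C1_frechet] needs this: it moves along one
    coordinate after another, and only the first segment starts at [y]. *)
Lemma strict_derivative (W : normedModType R) (g : W -> R) (O : set W) (y e : W) :
  open O -> O y -> (forall x, O x -> derivable g x e) ->
  {for y, continuous (fun x => 'D_e g x)} ->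
  forall eps : R, 0 < eps -> exists2 d : R, 0 < d &
    forall z t, `|z - y| < d -> `|t| < d ->
      `|g (z + t *: e) - g z - t * 'D_e g y| <= eps * `|t|.
Proof.
move=> oO Oy dg cg eps eps0.
have : \forall x \near y, O x /\ `|'D_e g y - 'D_e g x| < eps.
  apply: filterI; first exact: open_nbhs_nbhs.
  by move/cvgrPdist_lt: cg; apply.
move=> /nbhs_normP[/= r r0 hr].
have e1 : 0 < 1 + `|e| by rewrite ltr_pwDl.
exists (r / 2 / (1 + `|e|)); first by rewrite !divr_gt0.
move=> z t; rewrite !ltr_pdivlMr // => hz ht.
have inb s : `|s| <= `|t| -> ball_ Num.Def.normr y r (z + s *: e).
  move=> st; rewrite /ball_ /= distrC -addrA [_ *: e - y]addrC addrA.
  apply: (le_lt_trans (ler_normD _ _)); rewrite normrZ.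
  have h1 : `|s| * `|e| <= `|t| * `|e| by rewrite ler_wpM2r.
  have h2 := normr_ge0 (z - y); have h3 := normr_ge0 e; have h4 := normr_ge0 t.
  have h5 := mulr_ge0 h2 h3; have h6 := mulr_ge0 h4 h3.
  nra.
have [s st|c ct ->] := @MVT_line0 W g z e t.
  by apply: dg; have [] := hr _ (inb _ st).
have [_ hc] := hr _ (inb _ ct).
rewrite mulrC -mulrBr normrM mulrC ler_wpM2r // distrC; exact: ltW.
Qed.

Definition fin_coords (W : normedModType R) (I : finType) (b : I -> W)
    (c : I -> W -> R) : Prop :=
  [/\ forall j, linear (c j), forall j, continuous (c j),
      exists C, forall j w, `|c j w| <= C * `|w| &
      forall w, w = \sum_j c j w *: b j].

Lemma fin_coords_linear (W : normedModType R) (I : finType) (b : I -> W)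
    (c : I -> W -> R) j k u v : fin_coords b c -> c j (k *: u + v) = k * c j u + c j v.
Proof. by case=> linc _ _ _; exact: linc. Qed.

Lemma fin_coordsZ (W : normedModType R) (I : finType) (b : I -> W)
    (c : I -> W -> R) j k u : fin_coords b c -> c j (k *: u) = k * c j u.
Proof.
move=> fc; have := fin_coords_linear j 1 0 0 fc.
rewrite scale1r addr0 mul1r => /(congr1 (+%R^~ (- c j 0))).
rewrite addrK subrr => c0.
by have := fin_coords_linear j k u 0 fc; rewrite !addr0 -c0 addr0.
Qed.

(** [Cr_on] speaks only of directional derivatives. Continuous partial derivatives give a Frechet
    expansion, by telescoping along the coordinates with [strict_derivative]. *)
Lemma C1_frechet (W : normedModType R) (I : finType) (b : I -> W) (c : I -> W -> R)
    (g : W -> R) (O : set W) (y : W) :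
  fin_coords b c -> open O -> O y -> (forall j x, O x -> derivable g x (b j)) ->
  (forall j, {for y, continuous (fun x => 'D_(b j) g x)}) ->
  forall eps : R, 0 < eps -> exists2 d : R, 0 < d &
    forall w, `|w| < d ->
      `|g (y + w) - g y - \sum_j c j w * 'D_(b j) g y| <= eps * `|w|.
Proof.
move=> [_ _ [C hC] sumW] oO Oy dg cg.
have {}hC : exists2 C, 0 < C & forall j w, `|c j w| <= C * `|w|.
  exists (1 + `|C|); first by rewrite ltr_pwDl.
  move=> j w; apply: (le_trans (hC j w)); rewrite ler_wpM2r //.
  by rewrite (le_trans (ler_norm _)) // lerDr.
case: hC => {}C C0 hC.
suff H (r : seq I) : forall eps : R, 0 < eps -> exists2 d : R, 0 < d &
    forall w, `|w| < d ->
      `|g (y + \sum_(j <- r) c j w *: b j) - g y - \sum_(j <- r) c j w * 'D_(b j) g y|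
        <= eps * `|w|.
  move=> eps eps0; have [d d0 hd] := H (index_enum I) eps eps0.
  by exists d => // w wd; rewrite {1}(sumW w); exact: hd.
elim: r => [|i r IH] eps eps0.
  by exists 1 => // w _; rewrite !big_nil addr0 subrr subr0 normr0 mulr_ge0 // ltW.
have [d1 d10 h1] := IH (eps / 2) (divr_gt0 eps0 (ltr0Sn _ 1)).
have e2 : 0 < eps / 2 / C by rewrite !divr_gt0.
have [d2 d20 h2] := @strict_derivative W g O y (b i) oO Oy (dg i) (cg i) _ e2.
pose S := \sum_(j <- r) C * `|b j|.
have S0 : 0 <= S by apply: sumr_ge0 => j _; rewrite mulr_ge0 // ltW.
have SC : 0 < S + C by rewrite ltr_wpDl.
exists (Num.min d1 (d2 / (S + C))); first by rewrite lt_min d10 divr_gt0.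
move=> w; rewrite lt_min => /andP[wd1]; rewrite ltr_pdivlMr // => wd2.
rewrite !big_cons.
set z := \sum_(j <- r) c j w *: b j; set D := \sum_(j <- r) _.
have zS : `|z| <= S * `|w|.
  rewrite /S mulr_suml (le_trans (ler_norm_sum _ _ _)) //; apply: ler_sum => j _.
  by rewrite normrZ mulrAC ler_wpM2r.
have w0 := normr_ge0 w; have ciw := hC i w.
have hz : `|g (y + z + c i w *: b i) - g (y + z) - c i w * 'D_(b i) g y|
     <= eps / 2 / C * `|c i w|.
  apply: h2.
    rewrite addrAC subrr add0r; apply: le_lt_trans zS _.
    apply: le_lt_trans wd2; rewrite mulrC ler_wpM2l // lerDl; exact: ltW.
  apply: le_lt_trans ciw _; apply: le_lt_trans wd2; rewrite mulrC ler_wpM2l //.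
  by rewrite lerDr.
have hz' : eps / 2 / C * `|c i w| <= eps / 2 * `|w|.
  by rewrite -mulrA ler_wpM2l ?divr_ge0 ?(ltW eps0) // mulrC ler_pdivrMr // mulrC.
have := h1 w wd1; rewrite -/z -/D => h.
rewrite [_ *: b i + z]addrC addrA.
rewrite (_ : _ - _ - _ = (g (y + z + c i w *: b i) - g (y + z) - c i w * 'D_(b i) g y)
   + (g (y + z) - g y - D)); last by ring.
apply: le_trans (ler_normD _ _) _; rewrite (splitr eps) mulrDl lerD //.
exact: le_trans hz'.
Qed.

Lemma derivable_quotient (V W : normedModType R) (f : V -> W) (x v : V) :
  derivable f x v ->
  (h^-1 *: (f (h *: v + x) - f x)) @[h --> (0 : R)^'] --> 'D_v f x.
Proof. by []. Qed.

Lemma derivable_cont_line (V W : normedModType R) (f : V -> W) (x v : V) :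
  derivable f x v -> (f (h *: v + x) - f x) @[h --> (0 : R)^'] --> (0 : W).
Proof.
move=> /derivable_quotient df.
have h0 : (h : R) @[h --> (0 : R)^'] --> (0 : R) by exact: cvg_within.
have h1 := cvgZ h0 df; rewrite scale0r in h1.
apply: (cvg_trans _ (h1 _)); apply: near_eq_cvg.
near=> h; rewrite scalerA divff ?scale1r //.
by near: h; exact: nbhs_dnbhs_neq.
Unshelve. all: by end_near. Qed.

(** It is enough that [f] is derivable in the direction [v]: its difference quotients stay bounded,
    so the Frechet remainder of [g], divided by [h], tends to zero. *)
Lemma chain_C1 (V W : normedModType R) (I : finType) (b : I -> W) (c : I -> W -> R)
    (g : W -> R) (O : set W) (f : V -> W) (x v : V) :
  fin_coords b c -> open O -> O (f x) -> (forall j y, O y -> derivable g y (b j)) ->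
  (forall j, {for f x, continuous (fun y => 'D_(b j) g y)}) ->
  derivable f x v ->
  is_derive x v (fun z => g (f z)) (\sum_j c j ('D_v f x) * 'D_(b j) g (f x)).
Proof.
move=> fc oO Of dg cg df.
have [linc contc _ _] := fc.
set L := fun w => \sum_j c j w * 'D_(b j) g (f x).
have LZ k w : L (k *: w) = k * L w.
  rewrite /L mulr_sumr; apply: eq_bigr => j _.
  by rewrite (fin_coordsZ _ _ _ fc) mulrA.
have Lc : continuous L.
  move=> w; apply: cvg_sumr => j; apply: cvgM; [exact: contc|exact: cvg_cst].
suff H : (h^-1 *: (g (f (h *: v + x)) - g (f x))) @[h --> (0 : R)^'] --> L ('D_v f x).
  by split; [apply/cvg_ex; exists (L ('D_v f x)) | apply: cvg_lim].
have q := derivable_quotient df.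
have Lq : L (h^-1 *: (f (h *: v + x) - f x)) @[h --> (0 : R)^'] --> L ('D_v f x).
  first [exact: (cvg_comp _ _ q (Lc _)) | by apply: (continuous_cvg _ _ q); exact: Lc].
have bq : \forall h \near (0 : R)^', `|h^-1 *: (f (h *: v + x) - f x)| <= `|'D_v f x| + 1.
  have /cvgrPdist_lt /(_ 1 ltr01) := q; apply: filterS => h hh.
  rewrite -[X in `|X|](subrK ('D_v f x)) addrC (le_trans (ler_normD _ _)) // lerD2l.
  by rewrite distrC ltW.
apply/cvgrPdist_le => eps eps0.
have M0 : 0 < `|'D_v f x| + 1 by rewrite ltr_wpDl.
have e2 : 0 < eps / 2 / (`|'D_v f x| + 1) by rewrite !divr_gt0.
have [d d0 hd] := C1_frechet fc oO Of dg cg e2.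
have hd' : \forall h \near (0 : R)^', `|f (h *: v + x) - f x| < d.
  have /cvgrPdist_lt /(_ d d0) := derivable_cont_line df.
  by apply: filterS => h; rewrite sub0r normrN.
have Lq' : \forall h \near (0 : R)^',
   `|L ('D_v f x) - L (h^-1 *: (f (h *: v + x) - f x))| <= eps / 2.
  by move/cvgrPdist_le: Lq; apply; rewrite divr_gt0.
near=> h.
have hn0 : h != 0 by near: h; exact: nbhs_dnbhs_neq.
have hLq : `|L ('D_v f x) - L (h^-1 *: (f (h *: v + x) - f x))| <= eps / 2 by near: h.
have hwd : `|f (h *: v + x) - f x| < d by near: h.
have hwb : `|h^-1 *: (f (h *: v + x) - f x)| <= `|'D_v f x| + 1 by near: h.
move: hLq hwd hwb; set w := f (h *: v + x) - f x => hLq hwd hw.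
rewrite -(subrK (L (h^-1 *: w)) (L ('D_v f x))) -addrA (le_trans (ler_normD _ _)) //.
rewrite (splitr eps) lerD //.
have := hd w hwd; rewrite [f x + w]addrC subrK => hh.
rewrite normrZ in hw.
rewrite LZ /GRing.scale /= -mulrBr normrM distrC.
have hi : 0 <= `|h^-1| by [].
apply: (@le_trans _ _ (`|h^-1| * (eps / 2 / (`|'D_v f x| + 1) * `|w|))).
  by rewrite ler_wpM2l.
rewrite mulrCA (le_trans (ler_wpM2l (ltW e2) hw)) //.
by rewrite divfK // gt_eqF.
Unshelve. all: by end_near. Qed.

End DirectionalCalculus.

(** * Closure properties of the classes C^r, the chain rule and the symmetry of second
    derivatives *)

Section CrTheory.
Context {R : realType}.

Lemma Cr_on_cont (V W : normedModType R) r (O : set V) (f : V -> W) x :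
  Cr_on r O f -> O x -> {for x, continuous f}.
Proof. by case: r => [|r] [h _]; exact: h. Qed.

Lemma Cr_on_derivable (V W : normedModType R) r (O : set V) (f : V -> W) x v :
  Cr_on r.+1 O f -> O x -> derivable f x v.
Proof. by case=> _ h; exact: (h v).1. Qed.

Lemma Cr_on_derive (V W : normedModType R) r (O : set V) (f : V -> W) v :
  Cr_on r.+1 O f -> Cr_on r O (fun x => 'D_v f x).
Proof. by case=> _ h; exact: (h v).2. Qed.

Lemma near_derivable (V W : normedModType R) (f g : V -> W) x v :
  (\forall y \near x, f y = g y) -> derivable f x v -> derivable g x v.
Proof.
have [->|v0] := eqVneq v 0; first by move=> _ _; exact: derivable0.
by move=> h df; exact: (near_eq_derivable h df).
Qed.

Lemma near_derive (V W : normedModType R) (f g : V -> W) x v :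
  (\forall y \near x, f y = g y) -> 'D_v f x = 'D_v g x.
Proof. exact: near_eq_derive. Qed.

Lemma near_continuous (V W : topologicalType) (f g : V -> W) x :
  (\forall y \near x, f y = g y) -> {for x, continuous f} -> {for x, continuous g}.
Proof.
move=> h cf; have e : f x = g x by exact: nbhs_singleton h.
change (g y @[y --> x] --> g x); rewrite -e; apply: cvg_trans cf.
exact: near_eq_cvg.
Qed.

Lemma Cr_on_eq (V W : normedModType R) r (O : set V) (f g : V -> W) :
  open O -> (forall x, O x -> f x = g x) -> Cr_on r O f -> Cr_on r O g.
Proof.
move=> oO; elim: r f g => [|r IH] f g fg /= [cf df].
  split=> // x Ox; apply: near_continuous (cf x Ox).
  by apply: filterS (open_nbhs_nbhs (conj oO Ox)) => y /fg.
have fgx x : O x -> \forall y \near x, f y = g y.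
  by move=> Ox; apply: filterS (open_nbhs_nbhs (conj oO Ox)) => y /fg.
split.
  by move=> x Ox; apply: near_continuous (cf x Ox); exact: fgx.
move=> v; split=> [x Ox|].
  exact: near_derivable (fgx x Ox) ((df v).1 x Ox).
by apply: IH (df v).2 => x Ox; apply: near_derive; exact: fgx.
Qed.

Lemma Cr_on_sub (V W : normedModType R) r (O O' : set V) (f : V -> W) :
  O' `<=` O -> Cr_on r O f -> Cr_on r O' f.
Proof.
move=> sO; elim: r f => [|r IH] f /= [cf df].
  by split=> // x /sO; exact: cf.
split=> [x /sO|v]; first exact: cf.
by split=> [x /sO|]; [exact: (df v).1|apply: IH; exact: (df v).2].
Qed.

Lemma Cr_onW (V W : normedModType R) r (O : set V) (f : V -> W) :
  Cr_on r.+1 O f -> Cr_on r O f.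
Proof.
elim: r f => [|r IH] f; first by case=> cf _; split.
move=> [cf df]; split=> // v; split; first exact: (df v).1.
by apply: IH; exact: (df v).2.
Qed.

Lemma Cr_on_cst (V W : normedModType R) r (O : set V) (k : W) :
  Cr_on r O (fun _ : V => k).
Proof.
elim: r k => [|r IH] k; first by split=> // x _; exact: cst_continuous.
split=> [x _|v]; first exact: cst_continuous.
split=> [x _|]; first exact: derivable_cst.
have -> : 'D_v (fun _ : V => k) = (fun=> 0); last exact: IH.
by apply/funext => x; exact: derive_cst.
Qed.

Lemma Cr_onD (V W : normedModType R) r (O : set V) (f g : V -> W) : open O ->
  Cr_on r O f -> Cr_on r O g -> Cr_on r O (fun x => f x + g x).
Proof.
move=> oO; elim: r f g => [|r IH] f g [cf df] [cg dg].
  by split=> // x Ox; apply: continuousD; [exact: cf|exact: cg].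
split=> [x Ox|v]; first by apply: continuousD; [exact: cf|exact: cg].
split=> [x Ox|]; first by apply: derivableD; [exact: (df v).1|exact: (dg v).1].
apply: (Cr_on_eq oO _ (IH _ _ (df v).2 (dg v).2)) => x Ox.
by rewrite -deriveD //; [exact: (df v).1|exact: (dg v).1].
Qed.

Lemma Cr_onM (V : normedModType R) r (O : set V) (f g : V -> R) : open O ->
  Cr_on r O f -> Cr_on r O g -> Cr_on r O (fun x => f x * g x).
Proof.
move=> oO; elim: r f g => [|r IH] f g [cf df] [cg dg].
  by split=> // x Ox; apply: cvgM; [exact: cf|exact: cg].
split=> [x Ox|v]; first by apply: cvgM; [exact: cf|exact: cg].
split=> [x Ox|]; first by apply: derivableM; [exact: (df v).1|exact: (dg v).1].
have h1 := IH f _ (Cr_onW (conj cf df)) (dg v).2.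
have h2 := IH g _ (Cr_onW (conj cg dg)) (df v).2.
apply: (Cr_on_eq oO _ (Cr_onD oO h1 h2)) => x Ox.
by rewrite -deriveM //; [exact: (df v).1|exact: (dg v).1].
Qed.

Lemma Cr_on_sum (V W : normedModType R) r (O : set V) (J : Type) (s : seq J)
    (P : pred J) (f : J -> V -> W) : open O ->
  (forall j, P j -> Cr_on r O (f j)) -> Cr_on r O (fun x => \sum_(j <- s | P j) f j x).
Proof.
move=> oO hf; elim: s => [|j s IH].
  by apply: (Cr_on_eq oO _ (Cr_on_cst r O (0 : W))) => x _; rewrite big_nil.
case Pj : (P j).
  by apply: (Cr_on_eq oO _ (Cr_onD oO (hf j Pj) IH)) => x _; rewrite big_cons Pj.
by apply: (Cr_on_eq oO _ IH) => x _; rewrite big_cons Pj.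
Qed.

Lemma is_derive_lin (V W W' : normedModType R) (l : W -> W') (f : V -> W) x v :
  linear l -> continuous l -> derivable f x v ->
  is_derive x v (fun y => l (f y)) (l ('D_v f x)).
Proof.
move=> lin cl /derivable_quotient df.
have l0 : l 0 = 0.
  have := lin 1 0 0; rewrite !scale1r addr0 => /(congr1 (+%R^~ (- l 0))).
  by rewrite addrK subrr.
have lB a b : l (a - b) = l a - l b.
  by have := lin (-1) b a; rewrite !scaleN1r (addrC (- b)) (addrC (- l b)).
have lZ k a : l (k *: a) = k *: l a by have := lin k a 0; rewrite l0 !addr0.
have H : (h^-1 *: (l (f (h *: v + x)) - l (f x))) @[h --> (0 : R)^'] --> l ('D_v f x).
  have := cvg_comp _ _ df (cl _); apply: cvg_trans; apply: near_eq_cvg.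
  by near=> h; rewrite /= -lB -lZ.
by split; [apply/cvg_ex; exists (l ('D_v f x)) | apply: cvg_lim].
Unshelve. all: by end_near. Qed.

Lemma Cr_on_lin (V W W' : normedModType R) r (O : set V) (l : W -> W') (f : V -> W) :
  open O -> linear l -> continuous l -> Cr_on r O f -> Cr_on r O (fun x => l (f x)).
Proof.
move=> oO lin cl; elim: r f => [|r IH] f [cf df].
  by split=> // x Ox; apply: (cvg_comp _ _ (cf x Ox)); exact: cl.
split=> [x Ox|v]; first by apply: (cvg_comp _ _ (cf x Ox)); exact: cl.
split=> [x Ox|]; first by case: (is_derive_lin lin cl ((df v).1 x Ox)).
apply: (Cr_on_eq oO _ (IH _ (df v).2)) => x Ox.
by case: (is_derive_lin lin cl ((df v).1 x Ox)).
Qed.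

Lemma Cr_on_id (V : normedModType R) r (O : set V) : Cr_on r O (@id V).
Proof.
have ci : forall x, O x -> {for x, continuous (@id V)} by move=> x _; exact: cvg_id.
case: r => [|r]; first by split.
split=> // v; split=> [x Ox|]; first exact: derivable_id.
have -> : 'D_v (@id V) = (fun=> v); last exact: Cr_on_cst.
by apply/funext => x; exact: derive_id.
Qed.

Lemma is_derive_pair (V W1 W2 : normedModType R) (f : V -> W1) (g : V -> W2) x v :
  derivable f x v -> derivable g x v ->
  is_derive x v (fun y => (f y, g y)) ('D_v f x, 'D_v g x).
Proof.
move=> /derivable_quotient df /derivable_quotient dg.
have H : (h^-1 *: ((f (h *: v + x), g (h *: v + x)) - (f x, g x)))
    @[h --> (0 : R)^'] --> ('D_v f x, 'D_v g x).
  exact: (cvg_pair df dg).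
by split; [apply/cvg_ex; exists ('D_v f x, 'D_v g x) | apply: cvg_lim].
Qed.

Lemma Cr_on_pair (V W1 W2 : normedModType R) r (O : set V) (f : V -> W1) (g : V -> W2) :
  open O -> Cr_on r O f -> Cr_on r O g -> Cr_on r O (fun x => (f x, g x)).
Proof.
move=> oO; elim: r f g => [|r IH] f g [cf df] [cg dg].
  by split=> // x Ox; apply: cvg_pair; [exact: cf|exact: cg].
split=> [x Ox|v]; first by apply: cvg_pair; [exact: cf|exact: cg].
split=> [x Ox|]; first by case: (is_derive_pair ((df v).1 x Ox) ((dg v).1 x Ox)).
apply: (Cr_on_eq oO _ (IH _ _ (df v).2 (dg v).2)) => x Ox.
by case: (is_derive_pair ((df v).1 x Ox) ((dg v).1 x Ox)).
Qed.

Lemma cvg_mx_entries (T : Type) (F : set_system T) {FF : Filter F} m n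
    (f : T -> 'M[R]_(m, n)) (l : 'M[R]_(m, n)) :
  (forall i j, f t i j @[t --> F] --> l i j) -> f t @[t --> F] --> l.
Proof.
move=> h; apply/cvg_mx_entourageP => A entA.
have H i j : \forall t \near F, (l i j, f t i j) \in A.
  have /(_ _)/wrap[] := h i j (xsection A (l i j)).
    exact: nbhs_entourage.
  move=> hh; have {}hh : F [set t | xsection A (l i j) (f t i j)] := hh.
  by apply: filterS hh => t ht; rewrite inE; exact/xsectionP.
have : \forall t \near F, forall i, forall j, (l i j, f t i j) \in A.
  apply: filter_forall => i; apply: filter_forall => j; exact: H.
by [].
Qed.

(** By [chain_C1] the derivative is a sum of products of a derivative of [f] with a composite of one
    order less, which the induction hypothesis covers because [f] and [g] are generalised. *)
Lemma Cr_on_comp (V W : normedModType R) (I : finType) (b : I -> W) (c : I -> W -> R)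
    r (O : set V) (O' : set W) (g : W -> R) (f : V -> W) :
  fin_coords b c -> open O -> open O' -> (forall x, O x -> O' (f x)) ->
  Cr_on r O f -> Cr_on r O' g -> Cr_on r O (fun x => g (f x)).
Proof.
move=> fc oO oO' ff; elim: r f g ff => [|r IH] f g ff hf hg.
  split=> // x Ox; apply: (cvg_comp _ _ (Cr_on_cont hf Ox)).
  exact: Cr_on_cont hg (ff _ Ox).
have chain v x : O x -> is_derive x v (fun z => g (f z))
    (\sum_j c j ('D_v f x) * 'D_(b j) g (f x)).
  move=> Ox; apply: (chain_C1 fc oO' (ff _ Ox)).
  - by move=> j y O'y; exact: Cr_on_derivable hg O'y.
  - by move=> j; apply: (Cr_on_cont (Cr_on_derive (b j) hg)); exact: ff.
  - exact: Cr_on_derivable hf Ox.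
split=> [x Ox|v].
  apply: (cvg_comp _ _ (Cr_on_cont hf Ox)); exact: Cr_on_cont hg (ff _ Ox).
split=> [x Ox|]; first by case: (chain v x Ox).
have S : Cr_on r O (fun x => \sum_j c j ('D_v f x) * 'D_(b j) g (f x)).
  apply: Cr_on_sum => // j _; apply: Cr_onM => //.
    case: fc => lc cc _ _; apply: Cr_on_lin => //; exact: Cr_on_derive.
  by apply: (IH f (fun y => 'D_(b j) g y)) => //; [exact: Cr_onW|exact: Cr_on_derive].
by apply: (Cr_on_eq oO _ S) => x Ox; case: (chain v x Ox).
Qed.

(** The second difference of [f] along [t a] and [t b] is symmetric in [a] and [b]. Two applications
    of the mean value theorem write it as [t ^+ 2] times a second derivative at a nearby point, and
    continuity gives both orders the same limit. *)
Lemma clairaut (V : normedModType R) (O : set V) (f : V -> R) x u v :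
  open O -> O x -> Cr_on 2 O f ->
  'D_u (fun y => 'D_v f y) x = 'D_v (fun y => 'D_u f y) x.
Proof.
move=> oO Ox hf.
suff H a b (e : R) : 0 < e -> exists2 d, 0 < d & forall t, 0 < t < d ->
   `|f (x + t *: a + t *: b) - f (x + t *: a) - f (x + t *: b) + f x
     - t ^+ 2 * 'D_b (fun y => 'D_a f y) x| <= e * t ^+ 2.
  apply/eqP; rewrite -subr_eq0 -normr_le0; apply/ler_addgt0Pl => e e0; rewrite addr0.
  have e2 : 0 < e / 2 by rewrite divr_gt0.
  have [d1 d10 h1] := H u v (e / 2) e2; have [d2 d20 h2] := H v u (e / 2) e2.
  set t := Num.min d1 d2 / 2.
  have t0 : 0 < t by rewrite divr_gt0 // lt_min d10.
  have tm : t < Num.min d1 d2 by rewrite ltr_pdivrMr // mulrDr mulr1 ltrDl lt_min d10.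
  move: tm; rewrite lt_min => /andP[td1 td2].
  have := h1 t; have := h2 t; rewrite t0 td1 td2 => /(_ isT) {}h2 /(_ isT) {}h1.
  have t2 : 0 < t ^+ 2 by rewrite exprn_gt0.
  rewrite -(ler_pM2l t2) -[X in X * `|_|]gtr0_norm // -normrM.
  set A := 'D_u _ x in h2 *; set B := 'D_v _ x in h1 *.
  rewrite (_ : t ^+ 2 * (A - B) =
    (f (x + t *: u + t *: v) - f (x + t *: u) - f (x + t *: v) + f x - t ^+ 2 * B)
    - (f (x + t *: v + t *: u) - f (x + t *: v) - f (x + t *: u) + f x - t ^+ 2 * A));
    last by rewrite [x + _ + t *: v]addrAC; ring.
  apply: le_trans (ler_normB _ _) _.
  by apply: le_trans (lerD h1 h2) _; rewrite -mulrDl -splitr mulrC.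
move=> e0.
have : \forall y \near x, O y /\ `|'D_b (fun y => 'D_a f y) x - 'D_b (fun y => 'D_a f y) y| < e.
  apply: filterI; first exact: open_nbhs_nbhs.
  have c2 : {for x, continuous (fun y => 'D_b (fun z => 'D_a f z) y)}.
    exact: (Cr_on_cont (Cr_on_derive b (Cr_on_derive a hf)) Ox).
  by move/cvgrPdist_lt: c2; apply.
move=> /nbhs_normP[/= d d0 hd].
have ab0 : 0 < 1 + (`|a| + `|b|) by rewrite ltr_pwDl // addr_ge0.
exists (d / (1 + (`|a| + `|b|))); first by rewrite divr_gt0.
move=> t /andP[t0]; rewrite ltr_pdivlMr // => td.
have inb p q : 0 <= p <= t -> 0 <= q <= t ->
    ball_ Num.Def.normr x d (x + p *: a + q *: b).
  move=> /andP[p0 pt] /andP[q0 qt]; rewrite /ball_ /= -addrA opprD addrA subrr add0r normrN.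
  apply: (le_lt_trans (ler_normD _ _)); rewrite !normrZ !ger0_norm //.
  apply: le_lt_trans td; rewrite mulrDr mulr1 mulrDr; apply: ler_wpDl; first exact: ltW.
  by apply: lerD; rewrite ler_wpM2r.
pose F y := f (y + t *: b) - f y.
have df y w : O y -> derivable f y w by move=> Oy; exact: Cr_on_derivable hf Oy.
have t0' := ltW t0.
have dF s : 0 <= s <= t -> is_derive (x + s *: a) a F
    ('D_a f (x + s *: a + t *: b) - 'D_a f (x + s *: a)).
  move=> hs; apply: is_deriveB.
    have O1 : O (x + s *: a + t *: b) by apply: (hd _ (inb s t hs _)).1; rewrite t0' lexx.
    have := df _ a O1 => dd; split.
      by move: dd; rewrite /derivable /= => dd; under eq_fun do rewrite -addrA; exact: dd.
    by rewrite /derive /=; under eq_fun do rewrite -addrA.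
  apply/derivableP/df; have := (hd _ (inb s 0 hs _)).1; rewrite scale0r addr0; apply.
  by rewrite lexx t0'.
have [|c1 c1t e1] := @MVT_line R V F x a 0 t t0'.
  by move=> s /dF[].
have [|c2 c2t e2] := @MVT_line R V (fun y => 'D_a f y) (x + c1 *: a) b 0 t t0'.
  move=> s hs; apply: (Cr_on_derivable (Cr_on_derive a hf)).
  exact: (hd _ (inb c1 s c1t hs)).1.
have [_ e3] := dF _ c1t.
have e4 : f (x + t *: a + t *: b) - f (x + t *: a) - f (x + t *: b) + f x
    = t ^+ 2 * 'D_b (fun y => 'D_a f y) (x + c1 *: a + c2 *: b).
  move: e1 e2; rewrite e3 /F !scale0r !addr0 !subr0 => e1 e2.
  by rewrite expr2 -mulrA [t * (t * _)]mulrC [t * 'D_b _ _]mulrC -e2 -e1; ring.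
rewrite e4 -mulrBr normrM [e * _]mulrC ger0_norm ?sqr_ge0 // ler_wpM2l ?sqr_ge0 //.
by rewrite distrC ltW //; exact: (hd _ (inb c1 c2 c1t c2t)).2.
Qed.
End CrTheory.

(** * Finite-dimensional spaces, elementary smooth functions and a smooth step *)

Section Coordinates.
Context {R : realType}.

Definition finite_dim (W : normedModType R) : Prop :=
  exists (I : finType) (b : I -> W) (c : I -> W -> R), fin_coords b c.

Lemma entry_linear m n (i : 'I_m) (j : 'I_n) : linear (fun A : 'M[R]_(m, n) => A i j).
Proof. by move=> k u v; rewrite !mxE. Qed.

Lemma entry_le_norm m n (A : 'M[R]_(m, n)) i j : `|A i j| <= `|A|.
Proof.
rewrite /Num.norm /= mx_normrE.
exact: (le_bigmax_cond _ (fun ij : 'I_m * 'I_n => `|A ij.1 ij.2|) (_ : xpredT (i, j))).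
Qed.

Lemma finite_dim_mx m n : finite_dim 'M[R]_(m, n).
Proof.
exists ('I_m * 'I_n)%type, (fun ij => delta_mx ij.1 ij.2), (fun ij (A : 'M[R]_(m, n)) => A ij.1 ij.2).
split.
- by move=> j; exact: entry_linear.
- by move=> j; exact: coord_continuous.
- by exists 1 => j w; rewrite mul1r entry_le_norm.
- move=> w; rewrite {1}(matrix_sum_delta w) pair_big.
  by apply: eq_bigr.
Qed.

Lemma finite_dim_R : finite_dim R.
Proof.
exists unit, (fun=> 1), (fun _ x => x); split.
- by move=> _ k u v.
- by move=> _ x; exact: cvg_id.
- by exists 1 => _ w; rewrite mul1r.
- by move=> w; rewrite (big_pred1 tt) /GRing.scale /= ?mulr1 // => -[].
Qed.

Lemma finite_dim_pair (W1 W2 : normedModType R) :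
  finite_dim W1 -> finite_dim W2 -> finite_dim (W1 * W2)%type.
Proof.
move=> [I1 [b1 [c1 [l1 k1 [C1 h1] s1]]]] [I2 [b2 [c2 [l2 k2 [C2 h2] s2]]]].
exists (I1 + I2)%type,
  (fun j => match j with inl i => (b1 i, 0) | inr i => (0, b2 i) end),
  (fun j w => match j with inl i => c1 i w.1 | inr i => c2 i w.2 end).
split.
- by move=> [i|i] k u v /=; [exact: l1|exact: l2].
- move=> [i|i] w; first by apply: (cvg_comp _ _ (cvg_fst (G := nbhs w.2))); exact: k1.
  by apply: (cvg_comp _ _ (cvg_snd (F := nbhs w.1))); exact: k2.
- exists (`|C1| + `|C2|) => -[i|i] w /=.
    apply: (le_trans (h1 _ _)); rewrite (le_trans (ler_wpM2r _ (ler_norm _))) //.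
    apply: ler_pM => //; first by rewrite lerDl.
    by rewrite prod_normE le_max lexx.
  apply: (le_trans (h2 _ _)); rewrite (le_trans (ler_wpM2r _ (ler_norm _))) //.
  apply: ler_pM => //; first by rewrite lerDr.
  by rewrite prod_normE le_max lexx orbT.
- move=> [w1 w2]; rewrite big_sumType /=.
  have -> : \sum_i c1 i w1 *: (b1 i, 0 : W2) = (w1, 0).
    rewrite [in RHS](s1 w1); apply: (big_ind2 (fun x y => x = (y, 0))) => //.
      by move=> _ x _ y -> ->; congr pair; rewrite /= addr0.
    by move=> i _; congr pair; rewrite /= scaler0.
  have -> : \sum_i c2 i w2 *: (0 : W1, b2 i) = (0, w2).
    rewrite [in RHS](s2 w2); apply: (big_ind2 (fun x y => x = (0, y))) => //.
      by move=> _ x _ y -> ->; congr pair; rewrite /= addr0.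
    by move=> i _; congr pair; rewrite /= scaler0.
  by congr pair; rewrite /= ?addr0 ?add0r.
Qed.

Lemma continuous_mx (T : topologicalType) m n (F : T -> 'M[R]_(m, n)) :
  (forall i j, continuous (fun x => F x i j)) -> continuous F.
Proof. by move=> h x; apply: cvg_mx_entries => i j; exact: h. Qed.

Lemma Cr_on_mx (V : normedModType R) m n r (O : set V) (F : V -> 'M[R]_(m, n)) :
  open O -> (forall i j, Cr_on r O (fun x => F x i j)) -> Cr_on r O F.
Proof.
move=> oO; elim: r F => [|r IH] F h.
  split=> // x Ox; apply: cvg_mx_entries => i j; exact: Cr_on_cont (h i j) Ox.
have dF x v : O x -> derivable F x v.
  by move=> Ox; apply/derivable_mxP => i j; exact: Cr_on_derivable (h i j) Ox.
split=> [x Ox|v].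
  apply: cvg_mx_entries => i j; exact: Cr_on_cont (h i j) Ox.
split=> [x Ox|]; first exact: dF.
apply: IH => i j.
apply: (Cr_on_eq oO _ (Cr_on_derive v (h i j))) => x Ox.
by rewrite derive_mx ?mxE //; exact: dF.
Qed.

Lemma Cr_on_entry (V : normedModType R) m n r (O : set V) (F : V -> 'M[R]_(m, n)) i j :
  open O -> Cr_on r O F -> Cr_on r O (fun x => F x i j).
Proof.
move=> oO h; apply: (Cr_on_lin oO (@entry_linear m n i j) _ h).
exact: coord_continuous.
Qed.

Lemma Cr_onV (V : normedModType R) r (O : set V) (f : V -> R) : open O ->
  (forall x, O x -> f x != 0) -> Cr_on r O f -> Cr_on r O (fun x => (f x)^-1).
Proof.
move=> oO f0; elim: r => [|r IH] h.
  by split=> // x Ox; apply: cvgV; [exact: f0|exact: Cr_on_cont h Ox].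
split=> [x Ox|v].
  by apply: cvgV; [exact: f0|exact: Cr_on_cont h Ox].
split=> [x Ox|].
  by apply: derivableV; [exact: f0|exact: Cr_on_derivable h Ox].
have hi := IH (Cr_onW h).
have := Cr_onM oO (Cr_onM oO (Cr_on_cst r O (-1 : R)) (Cr_onM oO hi hi)) (Cr_on_derive v h).
apply: Cr_on_eq => // x Ox.
rewrite deriveV; [|exact: f0|exact: Cr_on_derivable h Ox].
by rewrite /GRing.scale /= expr2 invfM mulN1r.
Qed.

Lemma is_derive_dir (f : R -> R) (x d v : R) :
  is_derive x (1 : R) f d -> is_derive x v f (v * d).
Proof.
move=> [df <-]; have dif : differentiable f x by exact/derivable1_diffP.
split; first exact: diff_derivable.
rewrite deriveE // deriveE // -[v in LHS]mulr1.
by rewrite -[v * 1]/(v *: (1 : R)) linearZ.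
Qed.

Lemma Cr_on_real r (O : set R) (f df : R -> R) : open O ->
  (forall x, O x -> is_derive x (1 : R) f (df x)) -> Cr_on r O df -> Cr_on r.+1 O f.
Proof.
move=> oO h hd; split=> [x Ox|v].
  have [/derivable1_diffP dif _] := h x Ox.
  exact: differentiable_continuous.
split=> [x Ox|]; first by case: (is_derive_dir v (h x Ox)).
apply: (Cr_on_eq oO _ (Cr_onM oO (Cr_on_cst r O v) hd)) => x Ox.
by case: (is_derive_dir v (h x Ox)).
Qed.

Lemma Cr_on_sincos r : Cr_on r [set: R] (@sin R) /\ Cr_on r [set: R] (@cos R).
Proof.
have oT := @openT R.
elim: r => [|r [IHs IHc]].
  by split; split=> // x _; [exact: continuous_sin|exact: continuous_cos].
split; first by apply: (Cr_on_real oT _ IHc) => x _; exact: is_derive_sin.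
apply: (@Cr_on_real _ _ _ (fun x => (-1) * sin x) oT).
  by move=> x _; rewrite mulN1r; exact: is_derive_cos.
by apply: Cr_onM => //; exact: Cr_on_cst.
Qed.

(* The functions x^-m exp(-1/x), extended by 0 to x <= 0; this class is closed
   under differentiation up to linear combinations. *)
Definition flat (m : nat) (x : R) : R :=
  if x <= 0 then 0 else x^-1 ^+ m * expR (- x^-1).

Lemma flat_ge0 m x : 0 <= flat m x.
Proof.
rewrite /flat; case: (leP x 0) => // x0.
by rewrite mulr_ge0 ?expR_ge0 // exprn_ge0 // invr_ge0 ltW.
Qed.

(** With [y = 1 / x], raising [y / (m + 1) <= exp (y / (m + 1))] to the power [m + 1] bounds
    [y ^+ m.+1] by a constant times [exp y]. The linear bound settles differentiability at [0]. *)
Lemma flat_le m x : `|flat m x| <= (m.+1%:R) ^+ m.+1 * `|x|.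
Proof.
rewrite ger0_norm ?flat_ge0 // /flat; case: (leP x 0) => [_|x0].
  by rewrite mulr_ge0 // exprn_ge0.
rewrite gtr0_norm //.
have y0 : 0 < x^-1 by rewrite invr_gt0.
set y := x^-1 in y0 *.
have m0 : (0 : R) < m.+1%:R by rewrite ltr0n.
have h : y ^+ m.+1 <= m.+1%:R ^+ m.+1 * expR y.
  have -> : expR y = expR (y / m.+1%:R) ^+ m.+1.
    by rewrite -expRM_natl mulrC divfK // gt_eqF.
  rewrite -exprMn; apply: lerXn2r; rewrite ?nnegrE ?(ltW y0) ?mulr_ge0 ?expR_ge0 //.
  rewrite mulrC -ler_pdivrMr //; apply: le_trans (expR_ge1Dx _).
  by rewrite lerDr.
rewrite expRN -ler_pdivlMr ?invr_gt0 ?expR_gt0 // invrK.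
rewrite -[X in _ <= _ * X * _]invrK -/y.
have -> : y ^+ m = y ^+ m.+1 / y by rewrite exprSr mulfK // gt_eqF.
by rewrite ler_pdivrMr // mulrAC divfK ?gt_eqF // mulrAC.
Qed.

Lemma is_derive_flat m x :
  is_derive x (1 : R) (flat m) (- m%:R * flat m.+1 x + flat m.+2 x).
Proof.
have [x0|x0|x0] := ltgtP x 0.
- have h : \forall y \near x, 0 = flat m y.
    near=> y; rewrite /flat ifT //; apply: ltW; near: y; exact: lt_nbhsl.
  rewrite /flat (ltW x0) mulr0 addr0; split.
    by apply: (near_derivable h); exact: derivable_cst.
  by rewrite -(near_derive _ h) derive_cst.
- have h : \forall y \near x, y^-1 ^+ m * expR (- y^-1) = flat m y.
    near=> y; rewrite /flat ifF //; apply/negbTE; rewrite -ltNge; near: y.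
    exact: lt_nbhsr.
  have xn0 : x != 0 by rewrite gt_eqF.
  have d1 : is_derive x (1 : R) (fun y : R => y^-1) (- x ^- 2).
    by apply: (is_derive_eq (is_deriveV xn0 (is_derive_id x 1))); rewrite /GRing.scale /= mulr1.
  have d2 : is_derive x (1 : R) (fun y : R => expR (- y^-1)) (x ^- 2 * expR (- x^-1)).
    have d0 : is_derive x (1 : R) (fun y : R => - y^-1) (x ^- 2).
      by have := is_deriveN d1; rewrite opprK.
    by rewrite mulrC; exact: (@is_derive1_comp R (@expR R) (fun y => - y^-1) x _ _ (is_derive_expR _) d0).
  have d3 : is_derive x (1 : R) (fun y : R => y^-1 ^+ m) (m%:R * x^-1 ^+ m.-1 * (- x ^- 2)).
    have -> : (fun y : R => y^-1 ^+ m) = (fun y : R => y^-1) ^+ m.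
      by apply/funext => y; rewrite exprfctE.
    exact: is_deriveX.
  have d4 := is_deriveM d3 d2.
  have e : x^-1 ^+ m * (x ^- 2 * expR (- x^-1)) + expR (- x^-1) * (m%:R * x^-1 ^+ m.-1 * (- x ^- 2))
     = - m%:R * flat m.+1 x + flat m.+2 x.
    rewrite /flat leNgt x0 /= -exprVn; case: (m) => [|k] /=; rewrite ?exprS ?expr0; ring.
  rewrite -e; case: d4 => d5 d6; split; first exact: (near_derivable h d5).
  by rewrite -(near_derive _ h) d6.
(* At [0] the difference quotient of [flat m] is [flat m.+1], which tends to [0] by [flat_le]. *)
- have -> : - m%:R * flat m.+1 x + flat m.+2 x = 0.
    by rewrite x0 /flat lexx mulr0 addr0.
  have H : (h^-1 *: (flat m (h *: (1 : R) + x) - flat m x)) @[h --> (0 : R)^'] --> (0 : R).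
    have b h : `|h^-1 *: (flat m (h *: (1 : R) + x) - flat m x)| <= m.+2%:R ^+ m.+2 * `|h|.
      have -> : h *: (1 : R) + x = h by rewrite x0 addr0; exact: mulr1.
      have -> : flat m x = 0 by rewrite x0 /flat lexx.
      rewrite subr0 (_ : h^-1 *: flat m h = flat m.+1 h) ?flat_le //.
      rewrite /flat; case: (leP h 0) => h0; first by rewrite scaler0.
      by rewrite /GRing.scale /= mulrA -exprS.
    apply/cvgrPdist_le => e e0; have C0 : 0 < m.+2%:R ^+ m.+2 :> R by rewrite exprn_gt0 // ltr0n.
    have : \forall h \near (0 : R)^', `|h| <= e / m.+2%:R ^+ m.+2.
      by apply: dnbhs0_le; rewrite divr_gt0.
    apply: filterS => h hh; rewrite sub0r normrN (le_trans (b h)) //.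
    by rewrite mulrC -ler_pdivlMr.
  by split; [apply/cvg_ex; exists 0 | apply: cvg_lim].
Unshelve. all: by end_near. Qed.

Lemma Cr_on_flat r m : Cr_on r [set: R] (flat m).
Proof.
elim: r m => [|r IH] m.
  split=> // x _; have [/derivable1_diffP dif _] := is_derive_flat m x.
  exact: differentiable_continuous.
apply: (Cr_on_real openT (fun x _ => is_derive_flat m x)).
apply: (Cr_onD openT); last exact: IH.
by apply: (Cr_onM openT); [exact: Cr_on_cst|exact: IH].
Qed.

Definition smooth_step (x : R) : R := flat 0 x / (flat 0 x + flat 0 (1 - x)).

Lemma flat_gt0 x : 0 < x -> 0 < flat 0 x.
Proof. by move=> x0; rewrite /flat leNgt x0 /= expr0 mul1r expR_gt0. Qed.

Lemma smooth_step_den x : 0 < flat 0 x + flat 0 (1 - x).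
Proof.
have [x0|x0] := ltP 0 x; first by rewrite ltr_pwDl ?flat_gt0 ?flat_ge0.
by rewrite ltr_wpDl ?flat_ge0 // flat_gt0 // subr_gt0 (le_lt_trans x0).
Qed.

Lemma smooth_step_bounds x : 0 <= smooth_step x <= 1.
Proof.
rewrite /smooth_step divr_ge0 ?flat_ge0 ?(ltW (smooth_step_den x)) //=.
by rewrite ler_pdivrMr ?smooth_step_den // mul1r lerDl flat_ge0.
Qed.

Lemma smooth_step0 x : x <= 0 -> smooth_step x = 0.
Proof. by move=> x0; rewrite /smooth_step {1}/flat x0 mul0r. Qed.

Lemma smooth_step1 x : 1 <= x -> smooth_step x = 1.
Proof.
move=> x1; have h := smooth_step_den x; move: h; rewrite /smooth_step.
have -> : flat 0 (1 - x) = 0 by rewrite /flat ifT // subr_le0.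
by rewrite addr0 => h; rewrite divff // gt_eqF.
Qed.

Lemma Cr_on_smooth_step r : Cr_on r [set: R] smooth_step.
Proof.
have h1 := Cr_on_flat r 0.
have h2 : Cr_on r [set: R] (fun x => flat 0 (1 - x)).
  have [I [b [c fc]]] := finite_dim_R.
  apply: (Cr_on_comp fc openT openT _ _ h1) => //.
  have h : Cr_on r [set: R] (fun x : R => -1 * x).
    by apply: (Cr_onM openT); [exact: Cr_on_cst|exact: Cr_on_id].
  apply: (Cr_on_eq openT _ (Cr_onD openT (Cr_on_cst r [set: R] (1 : R)) h)) => x _.
  by rewrite mulN1r.
apply: (Cr_onM openT h1); apply: (Cr_onV openT); last exact: (Cr_onD openT h1 h2).
by move=> x _; rewrite gt_eqF // smooth_step_den.
Qed.
End Coordinates.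

(** * Germs of smooth maps *)

(** The condition of [smooth_on] at a single point, so that closure properties can be combined under
    hypotheses that hold only at or near [z]. *)
Definition smooth_at (R : realType) (V W : normedModType R) (A : set V) (z : V)
    (f : V -> W) : Prop :=
  exists O g, [/\ open_nbhs z O, forall r, Cr_on r O g & forall y, O y -> A y -> f y = g y].

Section SmoothGerms.
Context {R : realType} {V : normedModType R} (A : set V) (z : V).

Lemma smooth_at_eq (W : normedModType R) (f g : V -> W) :
  (\forall y \near z, A y -> f y = g y) -> smooth_at A z f -> smooth_at A z g.
Proof.
rewrite -nbhs_nearE nbhsE => -[Q1 [oO1 O1z] h1] [Q [f' [[oO Oz] hO hf]]].
exists (Q1 `&` Q), f'; split.
- by split; [exact: openI|].
- by move=> r; apply: Cr_on_sub (hO r) => ? [].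
- by move=> y [/h1 O1y Oy] Ay; rewrite -O1y // hf.
Qed.

Lemma smooth_at_eqA (W : normedModType R) (f g : V -> W) :
  (forall y, A y -> f y = g y) -> smooth_at A z f -> smooth_at A z g.
Proof. by move=> h; apply: smooth_at_eq; exact: nearW. Qed.

Lemma smooth_at_of (W : normedModType R) (O : set V) (f : V -> W) :
  open O -> O z -> (forall r, Cr_on r O f) -> smooth_at A z f.
Proof. by move=> oO Oz h; exists O, f. Qed.

Lemma smooth_at_cst (W : normedModType R) (k : W) : smooth_at A z (fun=> k).
Proof. by apply: (smooth_at_of openT) => // r; exact: Cr_on_cst. Qed.

Lemma smooth_at_lin (W W' : normedModType R) (l : W -> W') (f : V -> W) :
  linear l -> continuous l -> smooth_at A z f -> smooth_at A z (fun y => l (f y)).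
Proof.
move=> lin cl [Q [g [[oO Oz] hg fg]]]; exists Q, (fun y => l (g y)); split=> //.
  by move=> r; exact: Cr_on_lin.
by move=> y Oy Ay; rewrite fg.
Qed.

Lemma smooth_at_id : smooth_at A z id.
Proof. by apply: (smooth_at_of openT) => // r; exact: Cr_on_id. Qed.

Lemma smooth_at_op2 (W1 W2 W : normedModType R) (op : W1 -> W2 -> W) f g :
  (forall r O f1 f2, open O -> Cr_on r O f1 -> Cr_on r O f2 ->
     Cr_on r O (fun y : V => op (f1 y) (f2 y))) ->
  smooth_at A z f -> smooth_at A z g -> smooth_at A z (fun y => op (f y) (g y)).
Proof.
move=> hop [Q [f' [[oO Oz] hf ff]]] [Q' [g' [[oO' O'z] hg gg]]].
have oI := openI oO oO'; exists (Q `&` Q'), (fun y => op (f' y) (g' y)); split=> //.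
  by move=> r; apply: hop => //; [apply: Cr_on_sub (hf r)|apply: Cr_on_sub (hg r)] => ? [].
by move=> y [Oy O'y] Ay; rewrite ff // gg.
Qed.

Lemma smooth_atD (W : normedModType R) (f g : V -> W) :
  smooth_at A z f -> smooth_at A z g -> smooth_at A z (fun y => f y + g y).
Proof. by apply: smooth_at_op2 => r O f1 f2; exact: Cr_onD. Qed.

Lemma smooth_atM (f g : V -> R) :
  smooth_at A z f -> smooth_at A z g -> smooth_at A z (fun y => f y * g y).
Proof. by apply: smooth_at_op2 => r O f1 f2; exact: Cr_onM. Qed.

Lemma smooth_at_pair (W1 W2 : normedModType R) (f : V -> W1) (g : V -> W2) :
  smooth_at A z f -> smooth_at A z g -> smooth_at A z (fun y => (f y, g y)).
Proof. by apply: (smooth_at_op2 (op := pair)) => r O f1 f2; exact: Cr_on_pair. Qed.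

Lemma smooth_atN (f : V -> R) : smooth_at A z f -> smooth_at A z (fun y => - f y).
Proof.
move=> hf; have := smooth_atM (smooth_at_cst (-1 : R)) hf.
by apply: smooth_at_eq; apply: nearW => y _; rewrite mulN1r.
Qed.

Lemma smooth_atB (f g : V -> R) :
  smooth_at A z f -> smooth_at A z g -> smooth_at A z (fun y => f y - g y).
Proof. by move=> hf hg; apply: smooth_atD => //; exact: smooth_atN. Qed.

Lemma smooth_at_sum (W : normedModType R) (J : Type) (s : seq J) (P : pred J)
    (f : J -> V -> W) : (forall j, P j -> smooth_at A z (f j)) ->
  smooth_at A z (fun y => \sum_(j <- s | P j) f j y).
Proof.
move=> h; elim: s => [|j s IH].
  by apply: smooth_at_eq (smooth_at_cst 0); apply: nearW => y _; rewrite big_nil.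
case Pj : (P j).
  by apply: smooth_at_eq (smooth_atD (h j Pj) IH); apply: nearW => y _; rewrite big_cons Pj.
by apply: smooth_at_eq IH; apply: nearW => y _; rewrite big_cons Pj.
Qed.

Lemma smooth_at_prod (J : Type) (s : seq J) (P : pred J)
    (f : J -> V -> R) : (forall j, P j -> smooth_at A z (f j)) ->
  smooth_at A z (fun y => \prod_(j <- s | P j) f j y).
Proof.
move=> h; elim: s => [|j s IH].
  by apply: smooth_at_eq (smooth_at_cst (1 : R)); apply: nearW => y _; rewrite big_nil.
case Pj : (P j).
  by apply: smooth_at_eq (smooth_atM (h j Pj) IH); apply: nearW => y _; rewrite big_cons Pj.
by apply: smooth_at_eq IH; apply: nearW => y _; rewrite big_cons Pj.
Qed.

Lemma smooth_at_entry m n (F : V -> 'M[R]_(m, n)) i j :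
  smooth_at A z F -> smooth_at A z (fun y => F y i j).
Proof. exact: (smooth_at_lin (@entry_linear R m n i j) (@coord_continuous _ _ _ i j)). Qed.

Lemma smooth_at_mx m n (F : V -> 'M[R]_(m, n)) :
  (forall i j, smooth_at A z (fun y => F y i j)) -> smooth_at A z F.
Proof.
move=> h.
suff H (s : seq ('I_m * 'I_n)) : smooth_at A z
    (fun y => \sum_(ij <- s) F y ij.1 ij.2 *: delta_mx ij.1 ij.2 : 'M[R]_(m, n)).
  apply: smooth_at_eq (H (index_enum _)); apply: nearW => y _.
  by rewrite {2}(matrix_sum_delta (F y)) pair_big.
apply: smooth_at_sum => -[i j] _ /=.
apply: (@smooth_at_lin R 'M[R]_(m, n) (fun c => c *: delta_mx i j)) => //.
  by move=> k u v; rewrite scalerDl scalerA.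
by move=> c; apply: cvgZr_tmp => //; exact: cvg_id.
Qed.

Lemma smooth_at_comp (U : normedModType R) (B : set U) (f : V -> U) (g : U -> R) :
  finite_dim U -> (\forall y \near z, A y -> B (f y)) -> A z ->
  smooth_at A z f -> smooth_at B (f z) g -> smooth_at A z (fun y => g (f y)).
Proof.
move=> [I [b [c fc]]]; rewrite -nbhs_nearE nbhsE => -[Q1 [oQ1 Q1z] h1] Az.
move=> [Q [f' [[oQ Qz] hf ff]]] [Q' [g' [[oQ' Q'z] hg gg]]].
have oI : open (Q `&` f' @^-1` Q').
  move: Q' oQ' {Q'z hg gg}; apply/continuous_inP => // y; rewrite inE => Qy.
  exact: Cr_on_cont (hf 0%N) Qy.
exists (Q1 `&` (Q `&` f' @^-1` Q')), (fun y => g' (f' y)); split.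
- split; first exact: openI.
  by split=> //; split=> //; rewrite /= -ff.
- move=> r; apply: (@Cr_on_sub _ _ _ _ (Q `&` f' @^-1` Q')); first by move=> ? [].
  apply: (Cr_on_comp fc oI oQ' _ _ (hg r)); first by move=> ? [].
  by apply: Cr_on_sub (hf r) => ? [].
- move=> y [/h1 Q1y [Qy Q'y]] Ay; rewrite gg //; first by rewrite ff.
    by rewrite ff.
  exact: Q1y.
Qed.

Lemma smooth_at_fun1 (f : V -> R) (g : R -> R) : A z ->
  (forall r, Cr_on r setT g) -> smooth_at A z f -> smooth_at A z (fun y => g (f y)).
Proof.
move=> Az hg hf; apply: (smooth_at_comp (B := setT) finite_dim_R _ Az hf).
  exact: nearW.
by exists setT, g; split=> //; split=> //; exact: openT.
Qed.

Lemma smooth_atV (f : V -> R) :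
  f z != 0 -> A z -> smooth_at A z f -> smooth_at A z (fun y => (f y)^-1).
Proof.
move=> f0 Az hf.
have oR : open [set x : R | x != 0].
  have -> : [set x : R | x != 0] = ~` [set 0].
    by apply/seteqP; split=> x /=; [move/eqP|move=> /eqP].
  by apply: closed_openC; exact: closed_eq.
have : smooth_at A z (fun y => (f y)^-1).
  apply: (smooth_at_comp (B := setT) (g := fun x : R => x^-1) finite_dim_R _ Az hf).
    exact: nearW.
  exists [set x : R | x != 0], (fun x : R => x^-1); split=> // r.
  by apply: Cr_onV => //; exact: Cr_on_id.
by [].
Qed.

Lemma smooth_at_cvg (W : normedModType R) (f : V -> W) : A z ->
  smooth_at A z f -> f y @[y --> within A (nbhs z)] --> f z.
Proof.
move=> Az [Q [g [[oQ Qz] hg fg]]]; rewrite fg //.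
have cg : g y @[y --> within A (nbhs z)] --> g z.
  by apply: cvg_within_filter; exact: Cr_on_cont (hg 0%N) Qz.
apply: cvg_trans cg; apply: near_eq_cvg.
have : \forall y \near z, Q y by exact: open_nbhs_nbhs.
by apply: filterS => y Qy Ay; rewrite fg.
Qed.

Lemma smooth_at_sub (W : normedModType R) (B : set V) (f : V -> W) :
  (\forall y \near z, B y -> A y) -> smooth_at A z f -> smooth_at B z f.
Proof.
rewrite -nbhs_nearE nbhsE => -[Q1 [oQ1 Q1z] h1] [Q [g [[oQ Qz] hg fg]]].
exists (Q1 `&` Q), g; split.
- by split; [exact: openI|].
- by move=> r; apply: Cr_on_sub (hg r) => ? [].
- by move=> y [/h1 Q1y Qy] By; rewrite fg //; exact: Q1y.
Qed.

End SmoothGerms.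

Section SmoothGerms2.
Context {R : realType}.

Lemma smooth_at_neq0 (V : normedModType R) (A : set V) (z : V) (f : V -> R) :
  A z -> smooth_at A z f -> f z != 0 -> \forall y \near z, A y -> f y != 0.
Proof.
move=> Az hd u; have u' : 0 < `|f z| by rewrite normr_gt0.
have /cvgrPdist_lt /(_ _ u') hn := smooth_at_cvg Az hd.
have {}hn : \forall y \near z, A y -> `|f z - f y| < `|f z| := hn.
apply: filterS hn => y /= h /h.
by apply: contraTneq => ->; rewrite subr0 ltxx.
Qed.

Lemma smooth_at_comp_mx (V U : normedModType R) m n (A : set V) (B : set U) (z : V)
    (f : V -> U) (g : U -> 'M[R]_(m, n)) :
  finite_dim U -> (\forall y \near z, A y -> B (f y)) -> A z ->
  smooth_at A z f -> smooth_at B (f z) g -> smooth_at A z (fun y => g (f y)).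
Proof.
move=> fU AB Az hf hg; apply: smooth_at_mx => i j.
apply: (smooth_at_comp fU AB Az hf (g := fun y => g y i j)).
exact: smooth_at_entry.
Qed.

Lemma smooth_at_compT (V U : normedModType R) m n (A : set V) (z : V)
    (f : V -> U) (g : U -> 'M[R]_(m, n)) :
  finite_dim U -> A z -> smooth_at A z f -> smooth_at setT (f z) g ->
  smooth_at A z (fun y => g (f y)).
Proof. by move=> fU Az hf hg; apply: (smooth_at_comp_mx fU _ Az hf hg); exact: nearW. Qed.

Lemma smooth_at_mulmx (V : normedModType R) m n p (A : set V) (z : V)
    (F : V -> 'M[R]_(m, n)) (G : V -> 'M[R]_(n, p)) :
  smooth_at A z F -> smooth_at A z G -> smooth_at A z (fun y => F y *m G y).
Proof.
move=> hF hG; apply: smooth_at_mx => i j.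
apply: (@smooth_at_eq R V A z R (fun y => \sum_k F y i k * G y k j)).
  by apply: nearW => y _; rewrite mxE.
by apply: smooth_at_sum => k _; apply: smooth_atM; exact: smooth_at_entry.
Qed.

Lemma smooth_at_tr (V : normedModType R) m n (A : set V) (z : V) (F : V -> 'M[R]_(m, n)) :
  smooth_at A z F -> smooth_at A z (fun y => (F y)^T).
Proof.
move=> hF; apply: smooth_at_mx => i j.
apply: (@smooth_at_eq R V A z R (fun y => F y j i)).
  by apply: nearW => y _; rewrite mxE.
exact: smooth_at_entry.
Qed.

Lemma smooth_at_det (V : normedModType R) n (A : set V) (z : V) (F : V -> 'M[R]_n) :
  smooth_at A z F -> smooth_at A z (fun y => \det (F y)).
Proof.
move=> hF; rewrite /determinant; apply: smooth_at_sum => s _.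
apply: smooth_atM; first exact: smooth_at_cst.
by apply: smooth_at_prod => i _; exact: smooth_at_entry.
Qed.

Lemma smooth_at_invmx (V : normedModType R) n (A : set V) (z : V) (F : V -> 'M[R]_n) :
  A z -> F z \in unitmx -> smooth_at A z F -> smooth_at A z (fun y => invmx (F y)).
Proof.
move=> Az; rewrite unitmxE unitfE => u hF; apply: smooth_at_mx => i j.
have hd := smooth_at_det hF.
have nd := smooth_at_neq0 Az hd u.
apply: (@smooth_at_eq R V A z R (fun y => (\det (F y))^-1 *
    ((-1) ^+ (j + i) * \det (row' j (col' i (F y)))))).
  apply: filterS nd => y h Ay; rewrite /invmx unitmxE unitfE (h Ay) !mxE /cofactor.
  by rewrite addnC.
apply: smooth_atM; first exact: smooth_atV.
apply: smooth_atM; first exact: smooth_at_cst.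
apply: smooth_at_det; apply: smooth_at_mx => a b.
apply: (@smooth_at_eq R V A z R (fun y => F y (lift j a) (lift i b))).
  by apply: nearW => y _; rewrite !mxE.
exact: smooth_at_entry.
Qed.

Lemma smooth_at_addmx (V : normedModType R) m n (A : set V) (z : V)
    (F G : V -> 'M[R]_(m, n)) :
  smooth_at A z F -> smooth_at A z G -> smooth_at A z (fun y => F y + G y).
Proof. exact: smooth_atD. Qed.

Lemma smooth_at_scalemx (V : normedModType R) m n (A : set V) (z : V)
    (c : V -> R) (F : V -> 'M[R]_(m, n)) :
  smooth_at A z c -> smooth_at A z F -> smooth_at A z (fun y => c y *: F y).
Proof.
move=> hc hF; apply: smooth_at_mx => i j.
apply: (@smooth_at_eq R V A z R (fun y => c y * F y i j)).
  by apply: nearW => y _; rewrite mxE.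
by apply: smooth_atM => //; exact: smooth_at_entry.
Qed.

(* Along an open factor, derivatives may be computed with any local extension. *)
Lemma smooth_at_dx (P U W : normedModType R) (A : set P) (X : set U) (z : P * U)
    (f : P * U -> W) (v : U) : open X -> A z.1 -> X z.2 ->
  smooth_at (A `*` X) z f ->
  smooth_at (A `*` X) z (fun w => 'D_v (fun x => f (w.1, x)) w.2) /\
  derivable (fun x => f (z.1, x)) z.2 v.
Proof.
move=> oX Az Xz [Q [g [[oQ Qz] hg fg]]].
have key w : Q w -> (A `*` X) w -> \forall x \near w.2, g (w.1, x) = f (w.1, x).
  move=> Qw [Aw Xw].
  have h : \forall x \near w.2, Q (w.1, x).
    have c : (fun x : U => (w.1, x)) x @[x --> w.2] --> (w.1, w.2).
      by apply: cvg_pair; [exact: cvg_cst|exact: cvg_id].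
    by apply: c; apply: open_nbhs_nbhs; split=> //; case: w Qw {Aw Xw}.
  have h2 : \forall x \near w.2, X x by exact: open_nbhs_nbhs.
  near=> x; rewrite fg //; first by near: x.
  by split=> //=; near: x.
have E (w : P * U) : (fun h : R => h^-1 *: (((fun x => g (w.1, x)) \o shift w.2) (h *: v) - g (w.1, w.2)))
   = (fun h : R => h^-1 *: ((g \o shift w) (h *: (0, v)) - g w)).
  apply/funext => h /=; congr (_ *: (g _ - _)); last by case: w.
  by case: w => w1 w2; congr pair; rewrite /= ?scaler0 ?add0r.
split.
  exists Q, (fun w => 'D_(0, v) g w); split=> //.
    by move=> r; apply: Cr_on_derive; exact: hg.
  move=> w Qw AXw; rewrite -(near_derive _ (key w Qw AXw)).
  by rewrite /derive E.
apply: (near_derivable (key z Qz (conj Az Xz))).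
by rewrite /derivable E; exact: Cr_on_derivable (hg 1%N) Qz.
Unshelve. all: by end_near. Qed.

End SmoothGerms2.

(** * Orthogonal projections and normalised frames *)

Section Projections.
Context {R : realType}.

(** The orthogonal projection onto the row space of a row-free [W]. Its formula shows smooth
    dependence on [W], which cannot be read off [orth_proj], defined by a choice. *)
Definition row_proj k n (W : 'M[R]_(k, n)) : 'M[R]_n :=
  W^T *m invmx (W *m W^T) *m W.

Lemma mulmx_tr_eq0 n (v : 'rV[R]_n) : v *m v^T = 0 -> v = 0.
Proof.
move=> /matrixP /(_ 0 0); rewrite !mxE => h.
have h2 : \sum_j (v 0 j) ^+ 2 = 0.
  by rewrite -[RHS]h; apply: eq_bigr => j _; rewrite mxE expr2.
apply/rowP => j; rewrite mxE; apply/eqP; rewrite -sqrf_eq0.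
have /eqP := h2; rewrite psumr_eq0; last by move=> i _; exact: sqr_ge0.
by move=> /allP /(_ j (mem_index_enum _)).
Qed.

Lemma gram_unitmx k n (W : 'M[R]_(k, n)) : row_free W -> W *m W^T \in unitmx.
Proof.
move=> fW; rewrite -row_free_unit; apply/inj_row_free => v h.
apply/eqP; rewrite -(mulmx_free_eq0 v fW); apply/eqP.
by apply: mulmx_tr_eq0; rewrite trmx_mul mulmxA -[v *m W *m _]mulmxA h mul0mx.
Qed.

Lemma row_proj_tr k n (W : 'M[R]_(k, n)) : (row_proj W)^T = row_proj W.
Proof. by rewrite /row_proj !trmx_mul trmxK trmx_inv trmx_mul trmxK mulmxA. Qed.

Lemma row_proj_id k n (W : 'M[R]_(k, n)) : row_free W -> W *m row_proj W = W.
Proof.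
by move=> fW; rewrite /row_proj !mulmxA mulmxV ?mul1mx // gram_unitmx.
Qed.

Lemma row_proj_idem k n (W : 'M[R]_(k, n)) : row_free W ->
  row_proj W *m row_proj W = row_proj W.
Proof. by move=> fW; rewrite {1}/row_proj -mulmxA row_proj_id. Qed.

Lemma row_proj_eqmx k n (W : 'M[R]_(k, n)) : row_free W -> (row_proj W :=: W)%MS.
Proof.
move=> fW; apply/eqmxP; rewrite {1}/row_proj submxMl /=.
by rewrite -{1}(row_proj_id fW) submxMl.
Qed.

Lemma sub_idem n m (P : 'M[R]_n) (A : 'M[R]_(m, n)) :
  P *m P = P -> (A <= P)%MS -> A *m P = A.
Proof. by move=> iP /submxP[D ->]; rewrite -mulmxA iP. Qed.

(** Idempotents with the same row space absorb one another; transposing one of the two products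
    gives the equality. *)
Lemma orth_proj_unique n (P Q : 'M[R]_n) :
  P^T = P -> P *m P = P -> Q^T = Q -> Q *m Q = Q -> (P :=: Q)%MS -> P = Q.
Proof.
move=> sP iP sQ iQ PQ.
have h1 : P *m Q = P by apply: sub_idem; rewrite // PQ.
have h2 : Q *m P = Q by apply: sub_idem; rewrite // PQ.
by rewrite -h1 -sP -{1}sQ -trmx_mul h2 sQ.
Qed.

Lemma orth_projE n (P : 'M[R]_n) :
  P^T = P -> P *m P = P -> orth_proj [set v : 'rV[R]_n | (v <= P)%MS] = P.
Proof.
move=> sP iP; rewrite /orth_proj.
set S := [set Q | _].
have : S (get S) by apply: getPex; exists P.
move=> [sQ iQ e]; apply: orth_proj_unique => //; apply/eqmxP/andP; split.
  apply/rV_subP => v; have := congr1 (fun B : set _ => B v) e => /= h vQ.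
  by rewrite h.
apply/rV_subP => v; have := congr1 (fun B : set _ => B v) e => /= h vQ.
by rewrite -h.
Qed.

Lemma orth_proj_rows k n (W : 'M[R]_(k, n)) : row_free W ->
  orth_proj [set v : 'rV[R]_n | (v <= W)%MS] = row_proj W.
Proof.
move=> fW; rewrite -[RHS]orth_projE ?row_proj_tr ?row_proj_idem //.
by congr orth_proj; apply/funext => v /=; rewrite row_proj_eqmx.
Qed.

(** The affine chart of the Grassmannian given by the columns [f]: a plane has at most one frame
    that is the identity there, so normalised frames are coordinates on planes. *)
Definition normalized k n (f : 'I_k -> 'I_n) (W : 'M[R]_(k, n)) := colsub f W = 1%:M.

Lemma normalizedP k n (f : 'I_k -> 'I_n) (W : 'M[R]_(k, n)) a b :
  normalized f W -> W a (f b) = (a == b)%:R.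
Proof. by move=> /matrixP /(_ a b); rewrite !mxE. Qed.

Lemma normalized_free k n (f : 'I_k -> 'I_n) (W : 'M[R]_(k, n)) :
  normalized f W -> row_free W.
Proof.
move=> nW; apply/row_freeP; exists (colsub f 1%:M).
by rewrite mulmx_colsub mulmx1.
Qed.

(** For a projection [P] of rank [k], the rows [f] span the plane when the principal minor
    [mxsub f f P] is invertible, and its inverse normalises them. Invertibility is the condition for
    the plane to lie in the affine chart [f]. *)
Definition normal_frame k n (f : 'I_k -> 'I_n) (P : 'M[R]_n) : 'M[R]_(k, n) :=
  invmx (mxsub f f P) *m rowsub f P.

Lemma normal_frameP k n (f : 'I_k -> 'I_n) (P : 'M[R]_n) :
  \rank P = k -> mxsub f f P \in unitmx ->
  normalized f (normal_frame f P) /\ (normal_frame f P :=: P)%MS.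
Proof.
move=> rP u; have nf : normalized f (normal_frame f P).
  rewrite /normalized /normal_frame -mulmx_colsub.
  have -> : colsub f (rowsub f P) = mxsub f f P by apply/matrixP => i j; rewrite !mxE.
  by rewrite mulVmx.
split=> //.
have s : (normal_frame f P <= P)%MS.
  rewrite /normal_frame (_ : rowsub f P = rowsub f 1%:M *m P); last first.
    by rewrite mul_rowsub_mx mul1mx.
  by rewrite mulmxA submxMl.
apply/eqmxP; rewrite s /=; rewrite -(mxrank_leqif_sup s) rP.
by have := normalized_free nf.
Qed.

Lemma row_proj_normal_frame k n (f : 'I_k -> 'I_n) (P : 'M[R]_n) :
  \rank P = k -> mxsub f f P \in unitmx -> P^T = P -> P *m P = P ->
  row_proj (normal_frame f P) = P.
Proof.
move=> rP u sP iP; have [nf e] := normal_frameP rP u.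
have fr := normalized_free nf.
apply: orth_proj_unique; rewrite ?row_proj_tr ?row_proj_idem //.
by apply: eqmx_trans e; exact: row_proj_eqmx.
Qed.

Lemma normal_frame_row_proj k n (f : 'I_k -> 'I_n) (W : 'M[R]_(k, n)) :
  normalized f W ->
  mxsub f f (row_proj W) \in unitmx /\ normal_frame f (row_proj W) = W.
Proof.
move=> nW; have u := gram_unitmx (normalized_free nW).
have r1 : rowsub f (row_proj W) = invmx (W *m W^T) *m W.
  rewrite /row_proj -!mul_rowsub_mx (_ : rowsub f W^T = 1%:M) ?mul1mx //.
  by rewrite -(trmx1 R k) -nW; apply/matrixP => i j; rewrite !mxE.
have r2 : mxsub f f (row_proj W) = invmx (W *m W^T).
  have -> : mxsub f f (row_proj W) = colsub f (rowsub f (row_proj W)).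
    by apply/matrixP => i j; rewrite !mxE.
  by rewrite r1 -mulmx_colsub nW mulmx1.
by rewrite /normal_frame r1 r2 unitmx_inv invmxK mulmxA mulmxV ?mul1mx.
Qed.

(** Choose [f] so that the columns [f] of [W] form an invertible matrix [C]; the minor of the
    projection is then [C^T (W W^T)^-1 C]. *)
Lemma frame_normalize k n (W : 'M[R]_(k, n)) : row_free W ->
  exists f : 'I_k -> 'I_n, mxsub f f (row_proj W) \in unitmx.
Proof.
move=> fW; have rf : row_full W^T by rewrite /row_full mxrank_tr.
pose f := fullrankfun rf.
have fu : colsub f W \in unitmx.
  by rewrite -unitmx_tr (_ : (colsub f W)^T = rowsub f W^T) ?fullrowsub_unit //;
     apply/matrixP => i j; rewrite !mxE.
exists f.
have -> : mxsub f f (row_proj W) = (colsub f W)^T *m invmx (W *m W^T) *m colsub f W.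
  rewrite mulmx_colsub (_ : (colsub f W)^T = rowsub f W^T); last by apply/matrixP => i j; rewrite !mxE.
  by rewrite mul_rowsub_mx mul_rowsub_mx; apply/matrixP => i j; rewrite !mxE.
by rewrite !unitmx_mul unitmx_tr fu unitmx_inv gram_unitmx.
Qed.

Lemma rank_proj_frame k n (P : 'M[R]_n) : \rank P = k -> P^T = P -> P *m P = P ->
  exists f : 'I_k -> 'I_n, mxsub f f P \in unitmx.
Proof.
move=> <- sP iP; have fW : row_free (row_base P) by exact: row_base_free.
have e : row_proj (row_base P) = P.
  apply: orth_proj_unique; rewrite ?row_proj_tr ?row_proj_idem //.
  by apply: (eqmx_trans (row_proj_eqmx fW)); exact: eq_row_base.
by have [f] := frame_normalize fW; rewrite e; exists f.
Qed.

Lemma smooth_at_row_proj (V : normedModType R) (A : set V) (z : V) k n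
    (W : V -> 'M[R]_(k, n)) :
  A z -> row_free (W z) -> smooth_at A z W -> smooth_at A z (fun y => row_proj (W y)).
Proof.
move=> Az fW hW; apply: smooth_at_mulmx => //; apply: smooth_at_mulmx.
  exact: smooth_at_tr.
apply: smooth_at_invmx => //; first exact: gram_unitmx.
by apply: smooth_at_mulmx => //; exact: smooth_at_tr.
Qed.

Lemma smooth_at_mxsub (V : normedModType R) (A : set V) (z : V) m n p q
    (f : 'I_p -> 'I_m) (g : 'I_q -> 'I_n) (W : V -> 'M[R]_(m, n)) :
  smooth_at A z W -> smooth_at A z (fun y => mxsub f g (W y)).
Proof.
move=> hW; apply: smooth_at_mx => i j.
apply: (@smooth_at_eq R V A z R (fun y => W y (f i) (g j))).
  by apply: nearW => y _; rewrite mxE.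
exact: smooth_at_entry.
Qed.

Lemma smooth_at_normal_frame (V : normedModType R) (A : set V) (z : V) k n
    (f : 'I_k -> 'I_n) (P : V -> 'M[R]_n) :
  A z -> mxsub f f (P z) \in unitmx -> smooth_at A z P ->
  smooth_at A z (fun y => normal_frame f (P y)).
Proof.
move=> Az u hP; apply: smooth_at_mulmx; last exact: smooth_at_mxsub.
by apply: smooth_at_invmx => //; exact: smooth_at_mxsub.
Qed.

Lemma annihilator_row_full m n (A : 'M[R]_(m, n)) :
  (forall y : 'cV[R]_n, A *m y = 0 -> y = 0) -> row_full A.
Proof.
move=> h; rewrite -cokermx_eq0; apply/eqP/matrixP => i j.
have e : A *m col j (cokermx A) = 0 by rewrite colE mulmxA mulmx_coker mul0mx.
by have /matrixP /(_ i 0) := h _ e; rewrite [LHS]mxE => ->; rewrite !mxE.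
Qed.

End Projections.

(** * Tangent vectors and planes in charts *)

Section MoreCalculus.
Context {R : realType}.

Lemma smooth_at_open (V W : normedModType R) (A : set V) z (f : V -> W) :
  open A -> A z -> smooth_at A z f ->
  exists U, [/\ open_nbhs z U, U `<=` A & forall r, Cr_on r U f].
Proof.
move=> oA Az [Q [g [[oQ Qz] hg fg]]]; exists (Q `&` A).
have oI := openI oQ oA; split; [by []|by move=> ? []|].
move=> r; apply: (Cr_on_eq (f := g)) => //; first by move=> x [Qx Ax]; rewrite fg.
by apply: Cr_on_sub (hg r) => ? [].
Qed.

Lemma derive_comp (V W : normedModType R) (I : finType) (b : I -> W) (c : I -> W -> R)
    p q (G : W -> 'M[R]_(p, q)) (O : set W) (f : V -> W) (x v : V) :
  fin_coords b c -> open O -> O (f x) -> Cr_on 1 O G -> derivable f x v ->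
  is_derive x v (fun y => G (f y)) (\sum_j c j ('D_v f x) *: 'D_(b j) G (f x)).
Proof.
move=> fc oO Of hG df.
have H i j : is_derive x v (fun y => G (f y) i j)
    (\sum_l c l ('D_v f x) * 'D_(b l) (fun y => G y i j) (f x)).
  have hij := Cr_on_entry i j oO hG.
  apply: (chain_C1 fc oO Of) => //.
    by move=> l y Oy; exact: Cr_on_derivable hij Oy.
  by move=> l; exact: (Cr_on_cont (Cr_on_derive (b l) hij)).
have dG : derivable (fun y => G (f y)) x v.
  by apply/derivable_mxP => i j; case: (H i j).
split=> //; rewrite derive_mx //; apply/matrixP => i j; rewrite mxE summxE.
have [_ ->] := H i j; apply: eq_bigr => l _.
have dGl : derivable G (f x) (b l) by exact: Cr_on_derivable hG Of.
by rewrite (derive_mx dGl) !mxE.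
Qed.

(** The derivative of a composite sees only the value and the derivative of the inner map; this is
    what makes equality of 1-jets independent of the chart. *)
Lemma derive_comp_eq (V W : normedModType R) p q (G : W -> 'M[R]_(p, q)) (O : set W)
    (f1 f2 : V -> W) (x v : V) :
  finite_dim W -> open O -> O (f1 x) -> Cr_on 1 O G ->
  derivable f1 x v -> derivable f2 x v -> f1 x = f2 x -> 'D_v f1 x = 'D_v f2 x ->
  'D_v (fun y => G (f1 y)) x = 'D_v (fun y => G (f2 y)) x.
Proof.
move=> [I [b [c fc]]] oO Of hG d1 d2 e0 e1.
have [_ ->] := derive_comp fc oO Of hG d1.
rewrite e0 in Of; have [_ ->] := derive_comp fc oO Of hG d2.
by rewrite e0 e1.
Qed.

Lemma derive_rV n p q (G : 'rV[R]_n -> 'M[R]_(p, q)) (O : set 'rV[R]_n) x v :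
  open O -> O x -> Cr_on 1 O G ->
  'D_v G x = \sum_l v 0 l *: 'D_(delta_mx 0 l) G x.
Proof.
move=> oO Ox hG.
have fc : @fin_coords R 'rV[R]_n 'I_n (fun l => delta_mx 0 l) (fun l w => w 0 l).
  split.
  - by move=> j; exact: entry_linear.
  - by move=> j; exact: coord_continuous.
  - by exists 1 => j w; rewrite mul1r entry_le_norm.
  - by move=> w; exact: row_sum_delta.
have [_ h] := derive_comp (f := id) fc oO Ox hG (@derivable_id _ _ x v).
by rewrite -[LHS]/('D_v (fun y => G (id y)) x) h derive_id.
Qed.

Lemma derive_comp_rV (V : normedModType R) n p q (G : 'rV[R]_n -> 'M[R]_(p, q))
    (O : set 'rV[R]_n) (f : V -> 'rV[R]_n) (x v : V) :
  open O -> O (f x) -> Cr_on 1 O G -> derivable f x v ->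
  is_derive x v (fun y => G (f y)) ('D_('D_v f x) G (f x)).
Proof.
move=> oO Of hG df.
have fc : @fin_coords R 'rV[R]_n 'I_n (fun l => delta_mx 0 l) (fun l w => w 0 l).
  split.
  - by move=> j; exact: entry_linear.
  - by move=> j; exact: coord_continuous.
  - by exists 1 => j w; rewrite mul1r entry_le_norm.
  - by move=> w; exact: row_sum_delta.
by rewrite (derive_rV _ oO Of hG); exact: (derive_comp fc oO Of hG df).
Qed.

Lemma is_derive_mulmx (V : normedModType R) m n p (F : V -> 'M[R]_(m, n))
    (G : V -> 'M[R]_(n, p)) x v :
  derivable F x v -> derivable G x v ->
  is_derive x v (fun y => F y *m G y) ('D_v F x *m G x + F x *m 'D_v G x).
Proof.
move=> dF dG; have /derivable_mxP dF' := dF; have /derivable_mxP dG' := dG.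
have H i j : is_derive x v (fun y => (F y *m G y) i j)
   (('D_v F x *m G x + F x *m 'D_v G x) i j).
  have -> : (fun y => (F y *m G y) i j) = \sum_k (fun y => F y i k * G y k j).
    by apply/funext => y; rewrite mxE fct_sumE.
  rewrite !mxE -big_split /=.
  apply: is_derive_sum => k.
  have [d1 d2] := is_deriveM (derivableP (dF' i k)) (derivableP (dG' k j)).
  split; first exact: d1.
  have -> : 'D_v F x = \matrix_(a, b) 'D_v (fun y => F y a b) x by exact: derive_mx.
  have -> : 'D_v G x = \matrix_(a, b) 'D_v (fun y => G y a b) x by exact: derive_mx.
  rewrite [X in _ = X * _ + _]mxE [X in _ = _ + _ * X]mxE.
  rewrite -[LHS]/('D_v ((fun y => F y i k) * (fun y => G y k j)) x) d2 addrC.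
  by congr (_ + _); exact: mulrC.
have d : derivable (fun y => F y *m G y) x v.
  by apply/derivable_mxP => i j; case: (H i j).
by split=> //; rewrite derive_mx //; apply/matrixP => i j; rewrite mxE; case: (H i j).
Qed.

End MoreCalculus.

Section Charts.
Context {R : realType} {n : nat} (H : set 'rV[R]_n) (M : smooth_manifold_on H).
Implicit Types (i j l : chart_index M) (p q : M).

Lemma chart_invK i x : (chart i @` dom i) x ->
  dom i (chart_inv i x) /\ chart i (chart_inv i x) = x.
Proof. by move=> [p dp <-]; rewrite chartK. Qed.

Lemma chart_cont i p : dom i p -> {for p, continuous (chart i)}.
Proof.
move=> dp; have := @chart_continuous _ _ _ M i.
by rewrite (continuous_open_subspace _ (dom_open i)) => /(_ p); apply; rewrite inE.
Qed.

Lemma near_chart i p (Q : set M) : dom i p -> (\forall q \near p, Q q) ->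
  \forall x \near chart i p, (chart i @` dom i) x -> Q (chart_inv i x).
Proof.
move=> dp hQ; have xi : (chart i @` dom i) (chart i p) by exists p.
have := @chart_inv_continuous _ _ _ M i.
move=> /subspace_continuousP h; apply: (h _ xi Q).
by rewrite /from_subspace chartK.
Qed.

End Charts.

Section Manifold.
Context {R : realType} {n : nat} {M : manifold R n}.
Implicit Types (i j l : chart_index M) (p q : M).

Lemma open_chart_image i : open (chart_image i).
Proof. by have [Q oQ e] := chart_image_open i; rewrite /chart_image e setIT. Qed.

Lemma near_chart_inv i p (Q : set M) : dom i p -> (\forall q \near p, Q q) ->
  \forall x \near chart i p, Q (chart_inv i x).
Proof.
move=> dp hQ; have := near_chart dp hQ; apply: filter_app.
have : \forall x \near chart i p, chart_image i x.
  by apply: open_nbhs_nbhs; split; [exact: open_chart_image|exists p].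
by apply: filterS => x ? /(_ _); apply.
Qed.

Lemma near_chart_inv2 i x (Q : set M) : chart_image i x ->
  (\forall q \near chart_inv i x, Q q) -> \forall y \near x, Q (chart_inv i y).
Proof. by move=> [p dp <-]; rewrite chartK //; exact: near_chart_inv. Qed.

Lemma near_dom i p : dom i p -> \forall q \near p, dom i q.
Proof. by move=> dp; apply: open_nbhs_nbhs; split=> //; exact: dom_open. Qed.

Lemma near_chart_fwd i p (Q : set 'rV[R]_n) : dom i p ->
  (\forall x \near chart i p, Q x) -> \forall q \near p, Q (chart i q).
Proof. by move=> /chart_cont c hQ; exact: c. Qed.

Definition overlap i j : set 'rV[R]_n := chart i @` (dom i `&` dom j).

Lemma overlap_chart i j p : dom i p -> dom j p -> overlap i j (chart i p).
Proof. by move=> di dj; exists p. Qed.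

Lemma open_chart_preimage i (U : set M) : open U -> open (chart i @` (dom i `&` U)).
Proof.
move=> oU; rewrite openE => x [p [dp Up] <-].
have h1 := near_chart_inv dp (open_nbhs_nbhs (conj oU Up)).
have h2 : \forall x \near chart i p, chart_image i x.
  by apply: open_nbhs_nbhs; split; [exact: open_chart_image|exists p].
apply: filterS2 h1 h2 => y Uy [q dq e]; exists q => //.
by split=> //; move: Uy; rewrite -e chartK.
Qed.

Lemma open_overlap i j : open (overlap i j).
Proof. exact/open_chart_preimage/dom_open. Qed.
Arguments open_overlap : clear implicits.

Definition transition i j (x : 'rV[R]_n) : 'rV[R]_n := chart j (chart_inv i x).

Lemma transition_chart i j p : dom i p -> transition i j (chart i p) = chart j p.
Proof. by move=> dp; rewrite /transition chartK. Qed.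

Lemma transition_overlap i j x : overlap i j x -> overlap j i (transition i j x).
Proof. by move=> [p [di dj] <-]; rewrite transition_chart //; exists p. Qed.

Lemma Cr_on_local (V W : normedModType R) r (O : set V) (f : V -> W) :
  (forall x, O x -> exists U, [/\ open_nbhs x U & Cr_on r U f]) -> Cr_on r O f.
Proof.
elim: r f => [|r IH] f h.
  by split=> // x Ox; have [U [[oU Ux] c]] := h x Ox; exact: Cr_on_cont c Ux.
split=> [x Ox|v].
  by have [U [[oU Ux] c]] := h x Ox; exact: Cr_on_cont c Ux.
split=> [x Ox|]; first by have [U [[oU Ux] c]] := h x Ox; exact: Cr_on_derivable c Ux.
apply: IH => x Ox; have [U [Ux c]] := h x Ox; exists U; split=> //.
exact: Cr_on_derive.
Qed.

Lemma Cr_on_transition i j r : Cr_on r (overlap i j) (transition i j).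
Proof.
apply: Cr_on_local => x ox.
by have [U [h1 h2 h3]] := smooth_at_open (open_overlap i j) ox (transition_smooth ox); exists U.
Qed.

Definition jac i j (x : 'rV[R]_n) : 'M[R]_n :=
  \matrix_(l, m) ('D_(delta_mx 0 l) (transition i j) x) 0 m.

Lemma jacE i j x v : overlap i j x -> 'D_v (transition i j) x = v *m jac i j x.
Proof.
move=> ox; rewrite (derive_rV v (open_overlap i j) ox (Cr_on_transition i j 1)).
apply/rowP => m; rewrite !mxE summxE; apply: eq_bigr => l _.
by rewrite !mxE.
Qed.

Lemma Cr_on_jac i j r : Cr_on r (overlap i j) (jac i j).
Proof.
apply: Cr_on_mx; first exact: open_overlap.
move=> l m; have h := Cr_on_entry 0 m (open_overlap i j) (Cr_on_derive (delta_mx 0 l) (Cr_on_transition i j r.+1)).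
by apply: (Cr_on_eq _ _ h); [exact: open_overlap|move=> x _; rewrite mxE].
Qed.

Lemma near_overlap i j x : overlap i j x -> \forall y \near x, overlap i j y.
Proof. by move=> ox; apply: open_nbhs_nbhs; split=> //; exact: open_overlap. Qed.

Lemma jac_comp i j l p : dom i p -> dom j p -> dom l p ->
  jac i j (chart i p) *m jac j l (chart j p) = jac i l (chart i p).
Proof.
move=> di dj dl.
have oij := overlap_chart di dj; have ojl := overlap_chart dj dl.
have oil := overlap_chart di dl.
apply/row_matrixP => a; rewrite row_mul !rowE.
rewrite -(jacE (delta_mx 0 a) oij) -(jacE _ ojl) -(jacE _ oil).
have dt : derivable (transition i j) (chart i p) (delta_mx 0 a).
  exact: Cr_on_derivable (Cr_on_transition i j 1) oij.
have ojl' : overlap j l (transition i j (chart i p)) by rewrite transition_chart.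
have := derive_comp_rV (open_overlap j l) ojl' (Cr_on_transition j l 1) dt.
rewrite transition_chart // => -[_ <-]; apply: near_derive.
have h := near_chart_inv di (near_dom dj); apply: filterS h => x djx.
by rewrite /transition chartK.
Qed.

Lemma jac_id i p : dom i p -> jac i i (chart i p) = 1%:M.
Proof.
move=> di; have oii := overlap_chart di di.
apply/row_matrixP => a; rewrite !rowE -jacE // mulmx1.
rewrite -[RHS](derive_id (chart i p)); apply: near_derive.
by apply: filterS (near_overlap oii) => x [q [dq _] <-]; rewrite transition_chart.
Qed.

Lemma jac_inv i j p : dom i p -> dom j p ->
  jac i j (chart i p) *m jac j i (chart j p) = 1%:M.
Proof. by move=> di dj; rewrite jac_comp // jac_id. Qed.

Lemma tangent_jac p w i j : tangent p w -> dom i p -> dom j p ->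
  w j = w i *m jac i j (chart i p).
Proof.
move=> [_ h] di dj; rewrite (h i j di dj); apply: jacE; exact: overlap_chart.
Qed.

Lemma tangent_eq i p (w w' : tvec M) : tangent p w -> tangent p w' -> dom i p ->
  w i = w' i -> w = w'.
Proof.
move=> tw tw' di e; apply/funext => j.
have [dj|ndj] := pselect (dom j p).
  by rewrite (tangent_jac tw di dj) (tangent_jac tw' di dj) e.
by case: tw => -> // _; case: tw' => ->.
Qed.

Definition tvec_of i p (v : 'rV[R]_n) : tvec M :=
  fun j => if `[< dom j p >] then v *m jac i j (chart i p) else 0.

Lemma tvec_of_tangent i p v : dom i p -> tangent p (tvec_of i p v).
Proof.
move=> di; split=> [j ndj|j l dj dl].
  by rewrite /tvec_of; case: asboolP.
rewrite -[LHS]/(tvec_of i p v l) [RHS]jacE; last exact: overlap_chart.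
by rewrite /tvec_of (asboolT dj) (asboolT dl) -mulmxA jac_comp.
Qed.

Lemma tvec_ofE i p v : dom i p -> tvec_of i p v i = v.
Proof. by move=> di; rewrite /tvec_of; case: asboolP => // _; rewrite jac_id // mulmx1. Qed.

Lemma tvec_linE (c : R) (u v : tvec M) i : (c *: u + v) i = c *: u i + v i.
Proof. by []. Qed.

Lemma tvec_sumE (J : Type) (s : seq J) (c : J -> R) (w : J -> tvec M) i :
  (\sum_(a <- s) c a *: w a) i = \sum_(a <- s) c a *: w a i.
Proof.
elim: s => [|a s IH]; first by rewrite !big_nil.
by rewrite !big_cons -IH.
Qed.

Lemma tangent_lin p c (u v : tvec M) : tangent p u -> tangent p v -> tangent p (c *: u + v).
Proof.
move=> tu tv; split=> [i ndi|i j di dj].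
  by case: tu => hu _; case: tv => hv _; rewrite tvec_linE hu // hv // scaler0 addr0.
rewrite jacE; last exact: overlap_chart.
rewrite !tvec_linE (tangent_jac tu di dj) (tangent_jac tv di dj).
by rewrite mulmxDl scalemxAl.
Qed.

Lemma tangent0 p : tangent p (0 : tvec M).
Proof.
split=> // i j di dj; rewrite jacE; last exact: overlap_chart.
by rewrite mul0mx.
Qed.

Lemma tangent_sum p (J : Type) (s : seq J) (c : J -> R) (w : J -> tvec M) :
  (forall a, tangent p (w a)) -> tangent p (\sum_(a <- s) c a *: w a).
Proof.
move=> h; elim: s => [|a s IH]; first by rewrite big_nil; exact: tangent0.
by rewrite big_cons; exact: tangent_lin.
Qed.

Definition plane k i p (W : 'M[R]_(k, n)) : set (tvec M) :=
  [set w | tangent p w /\ (w i <= W)%MS].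

Lemma plane_eqmx k m i p (W : 'M[R]_(k, n)) (W' : 'M[R]_(m, n)) :
  (W :=: W')%MS -> plane i p W = plane i p W'.
Proof. by move=> e; apply/seteqP; split=> w [tw]; rewrite /plane /= e. Qed.

Lemma plane_grassmann k i p (W : 'M[R]_(k, n)) : dom i p -> row_free W ->
  grassmann k p (plane i p W).
Proof.
move=> di fW; exists (fun a => tvec_of i p (row a W)); split.
- by move=> a; exact: tvec_of_tangent.
- move=> c /(congr1 (fun w : tvec M => w i)); rewrite tvec_sumE => h a.
  have : (\row_b c b) *m W = 0.
    rewrite mulmx_sum_row -[RHS]h; apply: eq_bigr => b _.
    by rewrite mxE tvec_ofE.
  move=> /(congr1 (fun v => v *m pinvmx W)); rewrite mul0mx -mulmxA mulmxVp // mulmx1.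
  by move=> /rowP /(_ a); rewrite !mxE.
- apply/seteqP; split=> w.
    move=> [tw /submxP[D e]]; exists (fun a => D 0 a).
    apply: (tangent_eq tw _ di).
      by apply: tangent_sum => a; exact: tvec_of_tangent.
    rewrite tvec_sumE e mulmx_sum_row; apply: eq_bigr => a _.
    by rewrite tvec_ofE.
  move=> [c ->]; split; first by apply: tangent_sum => a; exact: tvec_of_tangent.
  rewrite tvec_sumE; apply: summx_sub => a _.
  by rewrite tvec_ofE // scalemx_sub // row_sub.
Qed.

Lemma grassmann_plane k i p V : dom i p -> grassmann k p V ->
  exists2 W : 'M[R]_(k, n), row_free W & V = plane i p W.
Proof.
move=> di [w [tw iw ->]]; exists (\matrix_a w a i).
  apply/inj_row_free => v; rewrite mulmx_sum_row => h; apply/rowP => a; rewrite mxE.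
  apply: iw; apply: (tangent_eq (tangent_sum _ _ tw) (tangent0 p) di).
  by rewrite tvec_sumE -[RHS]h; apply: eq_bigr => b _; rewrite rowK.
apply/seteqP; split=> u.
  move=> [c ->]; split; first exact: tangent_sum.
  rewrite tvec_sumE; apply: summx_sub => a _; rewrite scalemx_sub //.
  by rewrite (_ : w a i = row a (\matrix_a w a i)) ?row_sub // rowK.
move=> [tu /submxP[D e]]; exists (fun a => D 0 a).
apply: (tangent_eq tu (tangent_sum _ _ tw) di).
by rewrite tvec_sumE e mulmx_sum_row; apply: eq_bigr => a _; rewrite rowK.
Qed.

Lemma plane_image k i p (W : 'M[R]_(k, n)) : dom i p ->
  [set w i | w in plane i p W] = [set v : 'rV[R]_n | (v <= W)%MS].
Proof.
move=> di; apply/seteqP; split=> v; first by move=> [w [_ h] <-].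
move=> h; exists (tvec_of i p v); last exact: tvec_ofE.
by split; [exact: tvec_of_tangent|rewrite tvec_ofE].
Qed.

Lemma plane_trans k i j p (W : 'M[R]_(k, n)) : dom i p -> dom j p ->
  plane i p W = plane j p (W *m jac i j (chart i p)).
Proof.
move=> di dj; apply/seteqP; split=> w [tw h]; split=> //.
  by rewrite (tangent_jac tw di dj) submxMr.
rewrite (tangent_jac tw dj di) -[W]mulmx1 -(jac_inv di dj) mulmxA.
by rewrite submxMr.
Qed.

Lemma jac_unit i j p : dom i p -> dom j p -> jac i j (chart i p) \in unitmx.
Proof. by move=> di dj; exact: (mulmx1_unit (jac_inv di dj)).1. Qed.

Lemma plane_coord_plane k i p (W : 'M[R]_(k, n)) (xi : plane_field M) :
  dom i p -> row_free W -> xi p = plane i p W ->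
  plane_coord i xi (chart i p) = row_proj W.
Proof.
by move=> di fW e; rewrite /plane_coord chartK // e plane_image // orth_proj_rows.
Qed.

Lemma plane_coord_grassmann k i p (xi : plane_field M) :
  dom i p -> grassmann k p (xi p) ->
  let P := plane_coord i xi (chart i p) in
  [/\ P^T = P, P *m P = P, \rank P = k & xi p = plane i p P].
Proof.
move=> di gp /=; have [W fW e] := grassmann_plane di gp.
rewrite (plane_coord_plane di fW e); split.
- exact: row_proj_tr.
- exact: row_proj_idem.
- by rewrite row_proj_eqmx //; apply/eqP.
- by rewrite e; apply: plane_eqmx; exact/eqmx_sym/row_proj_eqmx.
Qed.

End Manifold.
Arguments open_overlap {R n M} i j.

(** * Jets of distributions *)

Section FrameFields.
Context {R : realType} {n : nat} {M : manifold R n}.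
Implicit Types (i j l : chart_index M) (p q : M) (xi eta : plane_field M).

Definition frame_field k i (w : 'rV[R]_n -> 'M[R]_(k, n)) : plane_field M :=
  fun p => plane i p (w (chart i p)).

Definition smooth_frame k (O : set 'rV[R]_n) (w : 'rV[R]_n -> 'M[R]_(k, n)) : Prop :=
  [/\ open O, forall r, Cr_on r O w & forall x, O x -> row_free (w x)].

Definition frame_dom i (O : set 'rV[R]_n) : set M := dom i `&` chart i @^-1` O.

Lemma open_frame_dom i O : open O -> open (frame_dom i O).
Proof.
move=> oO; move: O oO; apply/continuous_inP; first exact: dom_open.
by move=> p; rewrite inE => dp; exact: chart_cont.
Qed.

Lemma frame_field_coord k i (w : 'rV[R]_n -> 'M[R]_(k, n)) xi j q :
  dom i q -> dom j q -> row_free (w (chart i q)) -> xi q = frame_field i w q ->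
  plane_coord j xi (chart j q) =
    row_proj (w (transition j i (chart j q)) *m jac i j (transition j i (chart j q))).
Proof.
move=> di dj fw e; rewrite transition_chart //.
apply: plane_coord_plane => //; last by rewrite e /frame_field (plane_trans _ di dj).
by rewrite /row_free mxrankMfree // row_free_unit jac_unit.
Qed.

(** Reads in the chart [j] a plane given by a frame in the chart [i]. Packed as one smooth map of
    the frame and the point, so that changes of chart for jets and for families reduce to the chain
    rule. *)
Definition trans_proj k i j (z : 'M[R]_(k, n) * 'rV[R]_n) : 'M[R]_n :=
  row_proj (z.1 *m jac i j (transition j i z.2)).

Lemma smooth_at_trans_proj k i j (W : 'M[R]_(k, n)) x :
  row_free W -> overlap j i x -> smooth_at setT (W, x) (trans_proj i j).
Proof.
move=> fW ox; rewrite /trans_proj.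
have ov : overlap i j (transition j i x) by exact: transition_overlap.
have h1 : smooth_at setT (W, x) (fun z : 'M[R]_(k, n) * 'rV[R]_n => z.1).
  by apply: (smooth_at_lin (l := fst)); [by move=> ? ? ?|move=> z; exact: cvg_fst|exact: smooth_at_id].
have h2 : smooth_at setT (W, x) (fun z : 'M[R]_(k, n) * 'rV[R]_n => z.2).
  by apply: (smooth_at_lin (l := snd)); [by move=> ? ? ?|move=> z; exact: cvg_snd|exact: smooth_at_id].
have h3 : smooth_at setT (W, x) (fun z : 'M[R]_(k, n) * 'rV[R]_n => transition j i z.2).
  apply: (smooth_at_compT (finite_dim_mx _ _) _ h2) => //.
  apply: (smooth_at_of _ (open_overlap j i)) => //.
  by move=> r; exact: Cr_on_transition.
have h4 : smooth_at setT (W, x) (fun z : 'M[R]_(k, n) * 'rV[R]_n => jac i j (transition j i z.2)).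
  apply: (smooth_at_compT (finite_dim_mx _ _) _ h3) => //.
  apply: (smooth_at_of _ (open_overlap i j)) => //.
  by move=> r; exact: Cr_on_jac.
apply: smooth_at_row_proj => //=; last exact: smooth_at_mulmx.
have [q [dj di] <-] := ox; rewrite transition_chart //.
by rewrite /row_free mxrankMfree // row_free_unit jac_unit.
Qed.

Lemma smooth_at_trans_proj_comp (V : normedModType R) (A : set V) z k i j
    (w : V -> 'M[R]_(k, n)) (f : V -> 'rV[R]_n) :
  A z -> row_free (w z) -> overlap j i (f z) ->
  smooth_at A z w -> smooth_at A z f -> smooth_at A z (fun y => trans_proj i j (w y, f y)).
Proof.
move=> Az fw of_ hw hf.
apply: (smooth_at_compT (f := fun y => (w y, f y))) => //.
- by apply: finite_dim_pair; exact: finite_dim_mx.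
- exact: smooth_at_pair.
- exact: smooth_at_trans_proj.
Qed.

Lemma distribution_frame_field k i (O : set 'rV[R]_n) (w : 'rV[R]_n -> 'M[R]_(k, n)) xi (U : set M) :
  smooth_frame O w -> U `<=` frame_dom i O -> (forall q, U q -> xi q = frame_field i w q) ->
  distribution_on k U xi.
Proof.
move=> [oO hw fw] UO e; split=> [q Uq|j].
  have [di Oq] := UO q Uq; rewrite e //; apply: plane_grassmann => //; exact: fw.
move=> x0 [p [dj Up] <-]; have [di Op] := UO p Up.
set B := chart j @` _.
have Bp : B (chart j p) by exists p.
have h1 : smooth_at B (chart j p) (transition j i).
  apply: (smooth_at_of _ (open_overlap j i)); first exact: overlap_chart.
  by move=> r; exact: Cr_on_transition.
have h2 : smooth_at B (chart j p) (fun x => w (transition j i x)).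
  apply: (smooth_at_compT (finite_dim_mx _ _) Bp h1).
  by apply: (smooth_at_of _ oO) => //; rewrite transition_chart.
have := smooth_at_trans_proj_comp (i := i) (j := j) Bp _ _ h2 (smooth_at_id _ _).
move=> /(_ _ _)/wrap[]; first by rewrite transition_chart //; exact: fw.
  exact: overlap_chart.
move=> hh; suff : smooth_at B (chart j p) (plane_coord j xi) by [].
apply: smooth_at_eqA hh => _ [q [djq Uq] <-].
have [diq Oq] := UO q Uq.
rewrite (@frame_field_coord k i w) //; [by exact: fw|exact: e].
Qed.

Lemma local_section_frame_field k i p (O : set 'rV[R]_n) (w : 'rV[R]_n -> 'M[R]_(k, n)) xi :
  dom i p -> O (chart i p) -> smooth_frame O w -> (\forall q \near p, xi q = frame_field i w q) ->
  local_section k p xi.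
Proof.
move=> di Op sw; rewrite -nbhs_nearE nbhsE => -[U [oU Up] e].
exists (U `&` frame_dom i O).
  split; last by split.
  by apply: openI => //; apply: open_frame_dom; case: sw.
apply: (distribution_frame_field (i := i) sw); first by move=> q [].
by move=> q [Uq _]; exact: (e q Uq).
Qed.

Lemma local_section_frame k i p xi (f : 'I_k -> 'I_n) :
  dom i p -> local_section k p xi -> mxsub f f (plane_coord i xi (chart i p)) \in unitmx ->
  exists O, [/\ O (chart i p), smooth_frame O (fun x => normal_frame f (plane_coord i xi x)),
    O `<=` chart_image i /\ (forall r, Cr_on r O (plane_coord i xi)),
    forall x, O x -> normalized f (normal_frame f (plane_coord i xi x)) &
    forall q, frame_dom i O q ->
      mxsub f f (plane_coord i xi (chart i q)) \in unitmx /\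
      xi q = frame_field i (fun x => normal_frame f (plane_coord i xi x)) q].
Proof.
move=> di [U [oU Up] [gU sU]] u.
set P := plane_coord i xi.
have oB := @open_chart_preimage _ _ _ i _ oU; set B := chart i @` _ in oB.
have Bp : B (chart i p) by exists p.
have [Q1 [[oQ1 Q1p] Q1B c1]] := smooth_at_open oB Bp (sU i _ Bp).
have hP : smooth_at B (chart i p) P := sU i _ Bp.
have [Q2 [[oQ2 Q2p] Q2B c2]] := smooth_at_open oB Bp (smooth_at_normal_frame Bp u hP).
have hd : smooth_at setT (chart i p) (fun x => \det (mxsub f f (P x))).
  apply: smooth_at_det; apply: smooth_at_mxsub; exact: (smooth_at_of _ oQ1).
have : \forall x \near chart i p, \det (mxsub f f (P x)) != 0.
  have u' : \det (mxsub f f (P (chart i p))) != 0 by rewrite -unitfE -unitmxE.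
  by apply: filterS (smooth_at_neq0 _ hd u') => // x; exact.
rewrite -nbhs_nearE nbhsE => -[Q3 [oQ3 Q3p] h3].
have oQ : open (Q1 `&` Q2 `&` Q3) by do 2 apply: openI => //.
have key q : frame_dom i (Q1 `&` Q2 `&` Q3) q -> [/\ mxsub f f (P (chart i q)) \in unitmx,
    normalized f (normal_frame f (P (chart i q))) &
    xi q = frame_field i (fun x => normal_frame f (P x)) q].
  move=> [diq [[/Q1B [q' [diq' Uq'] e] _] /h3 uq]].
  have e' : q' = q by rewrite -(chartK diq') e chartK.
  rewrite e' in Uq'.
  have [sP iP rP eP] := plane_coord_grassmann diq (gU q Uq').
  have uq' : mxsub f f (P (chart i q)) \in unitmx by rewrite unitmxE unitfE.
  have [nf fe] := normal_frameP rP uq'.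
  by split=> //; rewrite eP /frame_field; apply: plane_eqmx; exact/eqmx_sym.
have inI x : (Q1 `&` Q2 `&` Q3) x -> exists2 q, frame_dom i (Q1 `&` Q2 `&` Q3) q & x = chart i q.
  move=> Qx; have [[/Q1B [q [dq Uq] e] _] _] := Qx; exists q => //; split=> //.
  by rewrite /preimage /= e.
exists (Q1 `&` Q2 `&` Q3); split=> //.
- split=> //; first by move=> r; apply: Cr_on_sub (c2 r) => ? [[]].
  by move=> x /inI[q /key[_ nf _] ->]; exact: normalized_free nf.
- split; first by move=> x /inI[q [dq _] ->]; exists q.
  by move=> r; apply: Cr_on_sub (c1 r) => ? [[]].
- by move=> x /inI[q /key[? ? ?] ->].
- by move=> q /key[].
Qed.

Lemma same_jet1_refl p xi : same_jet1 p xi xi.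
Proof. by []. Qed.

Lemma same_jet1_sym p xi eta : same_jet1 p xi eta -> same_jet1 p eta xi.
Proof. by move=> h i di; have [h1 h2] := h i di; split=> // v; rewrite h2. Qed.

Lemma same_jet1_trans p xi eta zeta :
  same_jet1 p xi eta -> same_jet1 p eta zeta -> same_jet1 p xi zeta.
Proof.
move=> h h' i di; have [h1 h2] := h i di; have [h3 h4] := h' i di.
by split=> [|v]; rewrite ?h1 ?h2.
Qed.

Lemma same_jet1_near p xi eta : (\forall q \near p, xi q = eta q) -> same_jet1 p xi eta.
Proof.
move=> h i di; have hx : \forall x \near chart i p, plane_coord i xi x = plane_coord i eta x.
  by apply: filterS (near_chart_inv di h) => x; rewrite /plane_coord => ->.
by split=> [|v]; [exact: (nbhs_singleton hx)|exact: near_derive].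
Qed.

Lemma same_jet1_frame k i p xi eta (O : set 'rV[R]_n) (w w' : 'rV[R]_n -> 'M[R]_(k, n)) :
  dom i p -> O (chart i p) -> smooth_frame O w -> smooth_frame O w' ->
  (\forall q \near p, xi q = frame_field i w q) ->
  (\forall q \near p, eta q = frame_field i w' q) ->
  w (chart i p) = w' (chart i p) ->
  (forall a, 'D_(delta_mx 0 a) w (chart i p) = 'D_(delta_mx 0 a) w' (chart i p)) ->
  same_jet1 p xi eta.
Proof.
move=> di Op [oO hw fw] [_ hw' fw'] nxi neta e0 e1 j dj.
have near_O : \forall q \near p, dom i q /\ O (chart i q).
  by apply: open_nbhs_nbhs; split; [exact: open_frame_dom|split].
have co (z : plane_field M) (u : 'rV[R]_n -> 'M[R]_(k, n)) : (forall x, O x -> row_free (u x)) ->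
    (\forall q \near p, z q = frame_field i u q) ->
    \forall x \near chart j p, plane_coord j z x = trans_proj i j (u (transition j i x), x).
  move=> fu nz.
  have h : \forall q \near p, dom j q -> plane_coord j z (chart j q) =
      trans_proj i j (u (transition j i (chart j q)), chart j q).
    apply: filterS2 near_O nz => q [diq Oq] ez djq.
    by rewrite (@frame_field_coord k i u) //; exact: fu.
  have h2 := near_chart_inv dj h.
  have : \forall x \near chart j p, chart_image j x.
    by apply: open_nbhs_nbhs; split; [exact: open_chart_image|exists p].
  apply: filterS2 h2 => x hx [q djq exq]; move: hx; rewrite -exq chartK //; exact.
have c1 := co xi w fw nxi; have c2 := co eta w' fw' neta.
split; first by rewrite (nbhs_singleton c1) (nbhs_singleton c2) transition_chart // e0.
move=> v; rewrite (near_derive v c1) (near_derive v c2).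
have ox : overlap j i (chart j p) by exact: overlap_chart.
have ops : Cr_on 1 (overlap j i) (transition j i) := Cr_on_transition j i 1.
have ft : transition j i (chart j p) = chart i p by rewrite transition_chart.
have Ot : O (transition j i (chart j p)) by rewrite ft.
have dt : derivable (transition j i) (chart j p) v by exact: Cr_on_derivable ops ox.
have [d1 d1'] := derive_comp_rV oO Ot (hw 1%N) dt.
have [d2 d2'] := derive_comp_rV oO Ot (hw' 1%N) dt.
have [I1 I2] := is_derive_pair d1 (@derivable_id _ _ (chart j p) v).
have [J1 J2] := is_derive_pair d2 (@derivable_id _ _ (chart j p) v).
have [U [[oU Ux] _ hU]] : exists U, [/\ open_nbhs (w (chart i p), chart j p) U, U `<=` setT &
    forall r, Cr_on r U (@trans_proj k i j)].
  by apply: smooth_at_open => //; [exact: openT|apply: smooth_at_trans_proj => //; exact: fw].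
apply: (@derive_comp_eq R _ _ n n (@trans_proj k i j) U
  (fun x => (w (transition j i x), x)) (fun x => (w' (transition j i x), x)) _ v
  _ oU _ (hU 1%N) I1 J1).
- by apply: finite_dim_pair; exact: finite_dim_mx.
- by rewrite ft.
- by rewrite ft e0.
- rewrite I2 J2 d1' d2'; congr pair; rewrite ft.
  rewrite (derive_rV _ oO Op (hw 1%N)) (derive_rV _ oO Op (hw' 1%N)).
  by apply: eq_bigr => a _; rewrite e1.
Qed.

Lemma jet1_eq k p xi eta : same_jet1 p xi eta -> jet1 k xi p = jet1 k eta p.
Proof.
move=> h; apply/seteqP; split=> z [lz hz]; (split; first exact: lz).
  exact: same_jet1_trans (same_jet1_sym h) hz.
exact: same_jet1_trans h hz.
Qed.

Lemma jet1_mem k p xi : local_section k p xi -> jet1 k xi p xi.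
Proof. by move=> l; split=> //; exact: same_jet1_refl. Qed.

Lemma J1_jet1 k p F xi : J1 k p F -> F xi -> F = jet1 k xi p.
Proof. by move=> [eta le ->] [lx h]; exact: jet1_eq. Qed.

Lemma local_section_grassmann k p xi : local_section k p xi -> grassmann k p (xi p).
Proof. by move=> [U [oU Up] [g _]]; exact: g. Qed.

Lemma J1_xget k p F : J1 k p F -> F (xget (fun=> set0) F) /\ local_section k p (xget (fun=> set0) F).
Proof.
move=> [eta le ->]; have h : jet1 k eta p (xget (fun=> set0) (jet1 k eta p)).
  by apply: xgetPex; exists eta; exact: jet1_mem.
by split=> //; case: h.
Qed.

Lemma jet_coord_jet1 k i p xi : dom i p -> local_section k p xi ->
  jet_coord0 i (jet1 k xi p) (chart i p) = plane_coord i xi (chart i p) /\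
  forall v, jet_coord1 i (jet1 k xi p) (chart i p) v = 'D_v (plane_coord i xi) (chart i p).
Proof.
move=> di lx; have J : J1 k p (jet1 k xi p) by exists xi.
have [[_ h] _] := J1_xget J; have [h1 h2] := h i di.
by split=> [|v]; rewrite /jet_coord0 /jet_coord1 ?h1 ?h2.
Qed.

Lemma jet0_jet1 k p xi : local_section k p xi -> jet0 p (jet1 k xi p) = xi p.
Proof.
move=> lx; apply/seteqP; split=> w; last by move=> xw; exists xi => //; exact: jet1_mem.
move=> [eta [le h] ew]; have [i di] := dom_cover p.
have [_ _ _ ->] := plane_coord_grassmann di (local_section_grassmann lx).
have [h1 _] := h i di; rewrite h1.
by have [_ _ _ <-] := plane_coord_grassmann di (local_section_grassmann le).
Qed.

Lemma jet0_plane k i p F : dom i p -> J1 k p F ->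
  let P := jet_coord0 i F (chart i p) in
  [/\ P^T = P, P *m P = P, \rank P = k & jet0 p F = plane i p P].
Proof.
move=> di [xi lx ->] /=; have [-> _] := jet_coord_jet1 di lx.
by rewrite jet0_jet1 //; exact: plane_coord_grassmann di (local_section_grassmann lx).
Qed.

(** A canonical map with value [W] and partial derivatives [E] at [x0]: every pair [(W, E)] with [W]
    row-free thus determines a jet without choices. *)
Definition affine_frame k (x0 : 'rV[R]_n) (W : 'M[R]_(k, n)) (E : 'I_n -> 'M[R]_(k, n))
    (x : 'rV[R]_n) : 'M[R]_(k, n) :=
  W + \sum_a (x - x0) 0 a *: E a.

(** Restricted to normalised [W] and to [E] vanishing in the columns [f], this is inverse to
    [normal_coord0] and [normal_coord1], by [jet_normal_form] and [frame_jet_coords]; such pairs are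
    coordinates on the jets whose plane lies in the affine chart [f]. *)
Definition frame_jet k i p (W : 'M[R]_(k, n)) (E : 'I_n -> 'M[R]_(k, n)) : jet M :=
  jet1 k (frame_field i (affine_frame (chart i p) W E)) p.

Lemma affine_frame0 k x0 (W : 'M[R]_(k, n)) E : affine_frame x0 W E x0 = W.
Proof.
rewrite /affine_frame subrr big1 ?addr0 // => a _.
by rewrite mxE scale0r.
Qed.

Lemma Cr_on_affine k x0 (W : 'M[R]_(k, n)) E r (O : set 'rV[R]_n) : open O ->
  Cr_on r O (affine_frame x0 W E).
Proof.
move=> oO; apply: Cr_onD => //; first exact: Cr_on_cst.
apply: Cr_on_sum => // a _.
apply: (Cr_on_lin (l := fun c : R => c *: E a) oO).
- by move=> c u v; rewrite scalerDl scalerA.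
- by move=> c; apply: cvgZr_tmp; exact: cvg_id.
- apply: Cr_on_entry => //; apply: Cr_onD => //; first exact: Cr_on_id.
  exact: Cr_on_cst.
Qed.

Lemma derive_affine k x0 (W : 'M[R]_(k, n)) E x a :
  'D_(delta_mx 0 a) (affine_frame x0 W E) x = E a.
Proof.
have dl b : is_derive x (delta_mx 0 a) (fun y : 'rV[R]_n => (y - x0) 0 b *: E b)
   ((a == b)%:R *: E b).
  have d1 : is_derive x (delta_mx 0 a) (fun y : 'rV[R]_n => y - x0) (delta_mx 0 a).
    have [d1 d2] := is_deriveD (is_derive_id x (delta_mx 0 a)) (is_derive_cst (- x0) x (delta_mx 0 a)).
    by split=> //; rewrite -[RHS]addr0; exact: d2.
  have [d3 d4] := d1.
  have := @is_derive_lin R 'rV[R]_n 'rV[R]_n 'M[R]_(k, n) (fun y => y 0 b *: E b) _ x (delta_mx 0 a) _ _ d3.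
  rewrite d4 mxE eqxx /= [b == a]eq_sym; apply.
    by move=> c u v; rewrite !mxE scalerDl scalerA.
  move=> y; apply: (@cvgZr_tmp R 'M[R]_(k, n) _ (nbhs y) _ (fun z : 'rV[R]_n => z 0 b)).
  exact: (@coord_continuous R 1 n 0 b y).
have h := is_deriveD (is_derive_cst W x (delta_mx 0 a)) (is_derive_sum dl).
have -> : affine_frame x0 W E = cst W + \sum_b (fun y : 'rV[R]_n => (y - x0) 0 b *: E b).
  by apply/funext => y; rewrite /affine_frame fctE fct_sumE.
case: h => _ ->; rewrite add0r (bigD1 a) //= eqxx scale1r big1 ?addr0 //.
by move=> b /negPf; rewrite eq_sym => ->; rewrite scale0r.
Qed.

Lemma row_free_near k (O : set 'rV[R]_n) (w : 'rV[R]_n -> 'M[R]_(k, n)) x :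
  open O -> O x -> (forall r, Cr_on r O w) -> row_free (w x) ->
  exists O', [/\ O' `<=` O, O' x & smooth_frame O' w].
Proof.
move=> oO Ox hw fw.
have hs : smooth_at setT x w by exact: (smooth_at_of _ oO).
have hd : smooth_at setT x (fun y => \det (w y *m (w y)^T)).
  by apply: smooth_at_det; apply: smooth_at_mulmx => //; exact: smooth_at_tr.
have := smooth_at_neq0 _ hd _ => /(_ I); rewrite -unitfE -unitmxE gram_unitmx // => /(_ isT).
rewrite -nbhs_nearE nbhsE => -[U [oU Ux] hU].
exists (U `&` O); split; [by move=> ? []|by []|].
split; first exact: openI.
  by move=> r; apply: Cr_on_sub (hw r) => ? [].
move=> y [/hU /(_ I) u _]; have {}u : w y *m (w y)^T \in unitmx by rewrite unitmxE unitfE.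
rewrite -row_free_unit in u; rewrite /row_free eqn_leq rank_leq_row /=.
by rewrite -{1}(eqP u) mxrankM_maxl.
Qed.

Lemma frame_jet_section k i p (W : 'M[R]_(k, n)) E : dom i p -> row_free W ->
  local_section k p (frame_field i (affine_frame (chart i p) W E)).
Proof.
move=> di fW; have [||U [_ Up sU]] := @row_free_near k setT (affine_frame (chart i p) W E) (chart i p) openT I.
- by move=> r; apply: Cr_on_affine; exact: openT.
- by rewrite affine_frame0.
by apply: (local_section_frame_field di Up sU); exact: nearW.
Qed.

Lemma frame_jet_J1 k i p (W : 'M[R]_(k, n)) E : dom i p -> row_free W ->
  J1 k p (frame_jet i p W E).
Proof. by move=> di fW; exists (frame_field i (affine_frame (chart i p) W E)) => //; exact: frame_jet_section. Qed.

Lemma jet1_frame k i p xi (O : set 'rV[R]_n) (w : 'rV[R]_n -> 'M[R]_(k, n)) :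
  dom i p -> O (chart i p) -> smooth_frame O w -> (\forall q \near p, xi q = frame_field i w q) ->
  jet1 k xi p = frame_jet i p (w (chart i p)) (fun a => 'D_(delta_mx 0 a) w (chart i p)).
Proof.
move=> di Op sw hxi; apply: jet1_eq.
have [oO hw fw] := sw; have fwp := fw _ Op.
set W := w _; set E := fun a => _.
have [||U [UO Up sU]] := @row_free_near k O (affine_frame (chart i p) W E) (chart i p) oO Op.
- by move=> r; exact: Cr_on_affine.
- by rewrite affine_frame0.
apply: (@same_jet1_frame k i p _ _ U w (affine_frame (chart i p) W E)) => //.
- have [oU _ _] := sU; split=> //; first by move=> r; exact: Cr_on_sub (hw r).
  by move=> x /UO; exact: fw.
- exact: nearW.
- by rewrite affine_frame0.
- by move=> a; rewrite derive_affine.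
Qed.

End FrameFields.

(** * Curvature in a normalised frame *)

Section NormalForm.
Context {R : realType} {n : nat} {M : manifold R n}.
Implicit Types (i j : chart_index M) (p q : M) (xi eta : plane_field M).

(** Obtained by differentiating the identity [mxsub f f P *m normal_frame f P = rowsub f P]; [Q]
    stands for the derivative of [P]. *)
Definition normal_deriv k (f : 'I_k -> 'I_n) (P Q : 'M[R]_n) : 'M[R]_(k, n) :=
  invmx (mxsub f f P) *m (rowsub f Q - mxsub f f Q *m normal_frame f P).

Lemma derive_mxsub (V : normedModType R) m m' r r' (f : 'I_m' -> 'I_m) (g : 'I_r' -> 'I_r)
    (F : V -> 'M[R]_(m, r)) x v : derivable F x v ->
  is_derive x v (fun y => mxsub f g (F y)) (mxsub f g ('D_v F x)).
Proof.
move=> dF.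
have lin : linear (fun A : 'M[R]_(m, r) => mxsub f g A).
  by move=> c u w; apply/matrixP => a b; rewrite !mxE.
have cont : continuous (fun A : 'M[R]_(m, r) => mxsub f g A).
  apply: continuous_mx => a b.
  have -> : (fun t : 'M[R]_(m, r) => mxsub f g t a b) = (fun t => t (f a) (g b)).
    by apply/funext => t; rewrite mxE.
  exact: (@coord_continuous R m r (f a) (g b)).
exact: (is_derive_lin lin cont dF).
Qed.

Lemma derive_normal_frame k (f : 'I_k -> 'I_n) (O : set 'rV[R]_n) (P : 'rV[R]_n -> 'M[R]_n) x v :
  open O -> O x -> Cr_on 1 O P -> Cr_on 1 O (fun y => normal_frame f (P y)) ->
  (forall y, O y -> mxsub f f (P y) \in unitmx) ->
  'D_v (fun y => normal_frame f (P y)) x = normal_deriv f (P x) ('D_v P x).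
Proof.
move=> oO Ox hP hW hu.
have dP : derivable P x v := Cr_on_derivable (v := v) hP Ox.
have dW : derivable (fun y => normal_frame f (P y)) x v := Cr_on_derivable (v := v) hW Ox.
have [d1 e1] := derive_mxsub f f dP.
have [_ e2] := derive_mxsub f (fun a => a) dP.
have [_ e3] := is_derive_mulmx d1 dW.
have E : 'D_v (fun y => mxsub f f (P y) *m normal_frame f (P y)) x =
         'D_v (fun y => rowsub f (P y)) x.
  apply: near_derive; have : \forall y \near x, O y by exact: open_nbhs_nbhs.
  apply: filterS => y Oy; rewrite /normal_frame mulmxA mulmxV; last exact: hu.
  by rewrite mul1mx.
rewrite e3 e1 in E; rewrite /normal_deriv -[rowsub f _]e2 -E addrAC subrr add0r.
by rewrite mulmxA mulVmx ?mul1mx //; exact: hu.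
Qed.

Definition normal_coord0 k (f : 'I_k -> 'I_n) i p (F : jet M) : 'M[R]_(k, n) :=
  normal_frame f (jet_coord0 i F (chart i p)).

Definition normal_coord1 k (f : 'I_k -> 'I_n) i p (F : jet M) (a : 'I_n) : 'M[R]_(k, n) :=
  normal_deriv f (jet_coord0 i F (chart i p)) (jet_coord1 i F (chart i p) (delta_mx 0 a)).

Lemma section_normal_form k (f : 'I_k -> 'I_n) i p xi :
  dom i p -> local_section k p xi -> mxsub f f (plane_coord i xi (chart i p)) \in unitmx ->
  exists O w, [/\ O (chart i p), smooth_frame O w, O `<=` chart_image i,
    forall x, O x -> normalized f (w x) &
    (forall q, frame_dom i O q -> xi q = frame_field i w q) /\
    w (chart i p) = normal_coord0 f i p (jet1 k xi p) /\
    (forall a, 'D_(delta_mx 0 a) w (chart i p) = normal_coord1 f i p (jet1 k xi p) a)].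
Proof.
move=> di lx u; have [Q [Qp sQ [Qi cQ] nQ hQ]] := local_section_frame di lx u.
have [c0 c1] := jet_coord_jet1 di lx.
exists Q, (fun x => normal_frame f (plane_coord i xi x)); split=> //; split; first by move=> q /hQ[].
split; first by rewrite /normal_coord0 c0.
move=> a; rewrite /normal_coord1 c0 c1; have [oQ wQ _] := sQ.
apply: derive_normal_frame (cQ 1%N) (wQ 1%N) _ => // y Qy.
by have [q dq e] := Qi y Qy; rewrite -e; apply: (hQ q _).1; split=> //; rewrite /preimage /= e.
Qed.

Lemma jet_normal_form k (f : 'I_k -> 'I_n) i p F :
  dom i p -> J1 k p F -> mxsub f f (jet_coord0 i F (chart i p)) \in unitmx ->
  F = frame_jet i p (normal_coord0 f i p F) (normal_coord1 f i p F).
Proof.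
move=> di [xi lx ->]; have [c0 c1] := jet_coord_jet1 di lx; rewrite c0 => u.
have [Q [w [Qp sQ Qi nQ [hQ [w0 w1]]]]] := section_normal_form di lx u.
rewrite [LHS](jet1_frame di Qp sQ) ?w0; last first.
  have [oQ _ _] := sQ.
  have : \forall q \near p, frame_dom i Q q.
    by apply: open_nbhs_nbhs; split; [exact: open_frame_dom|].
  by apply: filterS => q /hQ.
have -> : (fun a => 'D_(delta_mx 0 a) w (chart i p)) = normal_coord1 f i p (jet1 k xi p).
  by apply/funext => a; exact: w1.
by [].
Qed.

Lemma normal_coord_normalized k (f : 'I_k -> 'I_n) i p F :
  dom i p -> J1 k p F -> mxsub f f (jet_coord0 i F (chart i p)) \in unitmx ->
  normalized f (normal_coord0 f i p F) /\ forall a, colsub f (normal_coord1 f i p F a) = 0.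
Proof.
move=> di J u; have [sP iP rP _] := jet0_plane di J.
have [nf _] := normal_frameP rP u; split=> // a.
rewrite /normal_coord1 /normal_deriv -mulmx_colsub.
set W := normal_frame _ _ in nf *; set Q := jet_coord1 _ _ _ _.
have -> : colsub f (rowsub f Q - mxsub f f Q *m W) = mxsub f f Q - mxsub f f Q *m colsub f W.
  by rewrite mulmx_colsub; apply/matrixP => b c; rewrite !mxE.
by rewrite nf mulmx1 subrr mulmx0.
Qed.

Lemma affine_normalized k (f : 'I_k -> 'I_n) x0 (W : 'M[R]_(k, n)) E x :
  normalized f W -> (forall a, colsub f (E a) = 0) -> normalized f (affine_frame x0 W E x).
Proof.
move=> nW nE; apply/matrixP => a b; rewrite !mxE summxE big1 ?addr0.
  by rewrite (normalizedP _ _ nW).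
move=> c _; rewrite mxE; have /matrixP /(_ a b) := nE c; rewrite !mxE => ->.
by rewrite mulr0.
Qed.

Lemma frame_jet_coords k (f : 'I_k -> 'I_n) i p (W : 'M[R]_(k, n)) E :
  dom i p -> normalized f W -> (forall a, colsub f (E a) = 0) ->
  [/\ jet_coord0 i (frame_jet i p W E) (chart i p) = row_proj W,
      mxsub f f (jet_coord0 i (frame_jet i p W E) (chart i p)) \in unitmx,
      normal_coord0 f i p (frame_jet i p W E) = W &
      forall a, normal_coord1 f i p (frame_jet i p W E) a = E a].
Proof.
move=> di nW nE; have fW := normalized_free nW.
have lx := frame_jet_section E di fW.
have [c0 c1] := jet_coord_jet1 di lx.
have e0 : jet_coord0 i (frame_jet i p W E) (chart i p) = row_proj W.
  rewrite c0; apply: plane_coord_plane => //.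
  by rewrite /frame_field affine_frame0.
have [u nfW] := normal_frame_row_proj nW.
have u' : mxsub f f (plane_coord i (frame_field i (affine_frame (chart i p) W E)) (chart i p)) \in unitmx.
  by rewrite -c0 e0.
have [Q [w [Qp sQ Qi nQ [hQ [w0 w1]]]]] := section_normal_form di lx u'.
split=> //; [by rewrite e0|by rewrite /normal_coord0 e0|].
(* Near [p] the frames [w] and [affine_frame] span the same planes and are both normalised, so they
   coincide and have the same derivatives. *)
move=> a; rewrite -w1 -[RHS](derive_affine (chart i p) W E (chart i p) a).
apply: near_derive; have [oQ _ _] := sQ.
have : \forall x \near chart i p, Q x by exact: open_nbhs_nbhs.
apply: filterS => x Qx; have [q dq e] := Qi x Qx; subst x.
have := hQ q (conj dq Qx); rewrite /frame_field => eq.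
have n1 := nQ _ Qx; have n2 := affine_normalized (chart i p) (chart i q) nW nE.
have [_ <-] := normal_frame_row_proj n1; have [_ <-] := normal_frame_row_proj n2.
congr (normal_frame f _); rewrite -!orth_proj_rows ?(normalized_free n1) ?(normalized_free n2) //.
by rewrite -!(plane_image _ dq) eq.
Qed.

(** The Lie bracket of the frame fields [W_a] and [W_b] in coordinates, with the formal derivatives
    [E] in place of true ones; modulo the plane it is the curvature. *)
Definition curv k (W : 'M[R]_(k, n)) (E : 'I_n -> 'M[R]_(k, n)) (a b : 'I_k) : 'rV[R]_n :=
  row b (\sum_c W a c *: E c) - row a (\sum_c W b c *: E c).

(** Surjectivity of the curvature in dual form, with [y] a covector. In this form it becomes
    positivity on a compact sphere, hence is stable under small perturbations. *)
Definition curv_epi k (W : 'M[R]_(k, n)) (E : 'I_n -> 'M[R]_(k, n)) : Prop :=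
  forall y : 'cV[R]_n, W *m y = 0 -> (forall a b, curv W E a b *m y = 0) -> y = 0.

Lemma smooth_vector_field_derivable (U : set M) (X : vector_field M) i p v :
  open U -> U p -> dom i p -> smooth_vector_field_on U X ->
  derivable (fun x => X (chart_inv i x) i) (chart i p) v.
Proof.
move=> oU Up di [_ sX]; have oB := @open_chart_preimage _ _ _ i _ oU.
have Bp : (chart i @` (dom i `&` U)) (chart i p) by exists p.
have [Q [[oQ Qp] _ c]] := smooth_at_open oB Bp (sX i _ Bp).
exact: Cr_on_derivable (c 1%N) Qp.
Qed.

(** Under a change of chart the bracket picks up second derivatives of the transition map, which
    cancel by [clairaut]. *)
Lemma lie_bracket_tangent (U : set M) (X Y : vector_field M) p :
  open U -> U p -> smooth_vector_field_on U X -> smooth_vector_field_on U Y ->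
  tangent p (lie_bracket X Y p).
Proof.
move=> oU Up sX sY; split=> [i ndi|i j di dj].
  by rewrite /lie_bracket; case: asboolP.
rewrite [RHS]jacE; last exact: overlap_chart.
rewrite /lie_bracket (asboolT di) (asboolT dj) !chartK //.
have oij := overlap_chart di dj.
pose phi := transition i j.
have dphi v : derivable phi (chart i p) v := Cr_on_derivable (v := v) (Cr_on_transition i j 1) oij.
have djac v : derivable (jac i j) (chart i p) v := Cr_on_derivable (v := v) (Cr_on_jac i j 1) oij.
have key (Z : vector_field M) v : smooth_vector_field_on U Z ->
   'D_(v *m jac i j (chart i p)) (fun x => Z (chart_inv j x) j) (chart j p) =
   'D_v (fun x => Z (chart_inv i x) i) (chart i p) *m jac i j (chart i p) +
   Z p i *m 'D_v (jac i j) (chart i p).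
  move=> sZ; have [tZ cZ] := sZ.
  have oB := @open_chart_preimage _ _ _ j _ oU.
  have Bp : (chart j @` (dom j `&` U)) (chart j p) by exists p.
  have [Q [[oQ Qp] _ c]] := smooth_at_open oB Bp (cZ j _ Bp).
  have Qp' : Q (phi (chart i p)) by rewrite /phi transition_chart.
  have [_ e1] := derive_comp_rV oQ Qp' (c 1%N) (dphi v).
  rewrite jacE // /phi transition_chart // in e1.
  rewrite -e1.
  have [_ e2] := is_derive_mulmx (smooth_vector_field_derivable oU Up di sZ) (djac v).
  rewrite chartK // in e2; rewrite -e2; apply: near_derive.
  have h1 := near_chart_inv di (near_dom dj).
  have h2 := near_chart_inv di (open_nbhs_nbhs (conj oU Up)).
  have h3 : \forall x \near chart i p, chart_image i x.
    by apply: open_nbhs_nbhs; split; [exact: open_chart_image|exists p].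
  near=> x; have : chart_image i x by near: x.
  have : U (chart_inv i x) by near: x.
  have : dom j (chart_inv i x) by near: x.
  move=> hdj hU [q dq e]; rewrite -e chartK // in hdj hU *.
  by rewrite transition_chart // chartK // (tangent_jac (tZ q hU) dq hdj).
have [tX _] := sX; have [tY _] := sY.
rewrite (tangent_jac (tX p Up) di dj) (tangent_jac (tY p Up) di dj).
rewrite !key // mulmxBl.
set u := X p i; set v := Y p i; set J := jac i j (chart i p).
suff -> : v *m 'D_u (jac i j) (chart i p) = u *m 'D_v (jac i j) (chart i p).
  by rewrite opprD [LHS]addrACA subrr; exact: addr0.
have D2 a b : b *m 'D_a (jac i j) (chart i p) = 'D_a (fun x => 'D_b phi x) (chart i p).
  have [_ e] := is_derive_mulmx (derivable_cst b (chart i p) a) (djac a).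
  rewrite derive_cst mul0mx add0r in e; rewrite -e; apply: near_derive.
  by apply: filterS (near_overlap oij) => x ox; rewrite /phi jacE.
rewrite !D2; apply/rowP => m.
have h2 := Cr_on_transition i j 2.
have o := open_overlap i j.
have em a b : ('D_a (fun x => 'D_b phi x) (chart i p)) 0 m =
    'D_a (fun x => 'D_b (fun y => phi y 0 m) x) (chart i p).
  have dd : derivable (fun x => 'D_b phi x) (chart i p) a.
    exact: Cr_on_derivable (Cr_on_derive b h2) oij.
  rewrite (derive_mx dd) mxE; apply: near_derive.
  apply: filterS (near_overlap oij) => x ox.
  by rewrite (derive_mx (Cr_on_derivable (v := b) h2 ox)) mxE.
apply: etrans (em u v) _; apply: etrans _ (esym (em v u)).
exact: (clairaut u v o oij (Cr_on_entry 0 m o h2)).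
Unshelve. all: by end_near. Qed.

Lemma frame_vector_field i (g : 'rV[R]_n -> 'rV[R]_n) :
  (forall r, Cr_on r (chart_image i) g) ->
  smooth_vector_field_on (dom i) (fun q => tvec_of i q (g (chart i q))).
Proof.
move=> hg; split=> [q dq|j x0 [p [dj di] <-]]; first exact: tvec_of_tangent.
set B := chart j @` _; have Bp : B (chart j p) by exists p.
suff : smooth_at B (chart j p) (fun x => tvec_of i (chart_inv j x) (g (chart i (chart_inv j x))) j) by [].
have oji := overlap_chart dj di; have oij := overlap_chart di dj.
have h1 : smooth_at B (chart j p) (transition j i).
  by apply: (smooth_at_of _ (open_overlap j i)) => // r; exact: Cr_on_transition.
have h2 : smooth_at B (chart j p) (fun x => g (transition j i x)).
  apply: (smooth_at_compT (finite_dim_mx _ _) Bp h1).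
  by apply: (smooth_at_of _ (@open_chart_image _ _ _ i)) => //; rewrite transition_chart //; exists p.
have h3 : smooth_at B (chart j p) (fun x => jac i j (transition j i x)).
  apply: (smooth_at_compT (finite_dim_mx _ _) Bp h1).
  apply: (smooth_at_of _ (open_overlap i j)); first by rewrite transition_chart.
  by move=> r; exact: Cr_on_jac.
apply: smooth_at_eqA (smooth_at_mulmx h2 h3) => x [q [djq diq] <-].
by rewrite transition_chart // chartK // /tvec_of (asboolT djq).
Qed.

(** Bilinearity reduces the bracket of arbitrary sections, with coefficients [c] and [d] at the
    point, to the brackets of the frame vectors. *)
Lemma row_mul_curv k (W : 'M[R]_(k, n)) E (c d : 'rV[R]_k) (y : 'cV[R]_n) :
  (forall a b, curv W E a b *m y = 0) ->
  d *m (\sum_l (c *m W) 0 l *: E l) *m y - c *m (\sum_l (d *m W) 0 l *: E l) *m y = 0.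
Proof.
move=> h.
have ex (c' d' : 'rV[R]_k) : d' *m (\sum_l (c' *m W) 0 l *: E l) =
    \sum_a \sum_b (c' 0 a * d' 0 b) *: row b (\sum_l W a l *: E l).
  have -> : \sum_l (c' *m W) 0 l *: E l = \sum_a c' 0 a *: (\sum_l W a l *: E l).
    under eq_bigr do rewrite mxE scaler_suml.
    rewrite exchange_big /=; apply: eq_bigr => a _.
    by rewrite scaler_sumr; apply: eq_bigr => l _; rewrite scalerA.
  rewrite mulmx_sumr; apply: eq_bigr => a _.
  rewrite -scalemxAr mulmx_sum_row scaler_sumr; apply: eq_bigr => b _.
  by rewrite scalerA.
rewrite -mulmxBl !ex [X in _ - X]exchange_big -sumrB /= mulmx_suml big1 // => a _.
rewrite -sumrB mulmx_suml big1 // => b _.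
by rewrite [d 0 b * _]mulrC -scalerBr -scalemxAl h scaler0.
Qed.

Lemma derive_frame k (O : set 'rV[R]_n) (w : 'rV[R]_n -> 'M[R]_(k, n)) x E u :
  open O -> O x -> Cr_on 1 O w -> (forall a, 'D_(delta_mx 0 a) w x = E a) ->
  'D_u w x = \sum_a u 0 a *: E a.
Proof.
by move=> oO Ox hw hE; rewrite (derive_rV u oO Ox hw); apply: eq_bigr => a _; rewrite hE.
Qed.

(** Any section of a representative is a combination of the normalised frame, with its own columns
    [f] as coefficients. Differentiating the coefficients only adds vectors of the plane, so a
    covector killing the plane sees nothing but the values [curv W E]. *)
Lemma curvature_epi_curv k (f : 'I_k -> 'I_n) i p (W : 'M[R]_(k, n)) E :
  dom i p -> normalized f W -> (forall a, colsub f (E a) = 0) ->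
  curvature_epi p (frame_jet i p W E) -> curv_epi W E.
Proof.
move=> di nW nE epi y Wy cy.
have fW := normalized_free nW.
have J := frame_jet_J1 E di fW; set F := frame_jet i p W E in epi J.
have [c0 u c1 c2] := frame_jet_coords di nW nE.
have [_ _ _ j0] := jet0_plane di J; rewrite c0 in j0.
have jW w : jet0 p F w -> w i *m y = 0.
  rewrite j0 => -[_]; rewrite row_proj_eqmx // => /submxP[D ->].
  by rewrite -mulmxA Wy mulmx0.
suff key a b om : curvature p F a b om -> om i *m y = 0.
  apply/matrixP => l m; rewrite [m]ord1 -[LHS]/((fun z : 'cV[R]_n => z l 0) y).
  have := epi _ (tvec_of_tangent (delta_mx 0 l) di) => -[N [ua [ub [om [h1 h2]]]]].
  have := jW _ h2.
  have -> : (tvec_of i p (delta_mx 0 l) - \sum_l0 om l0) i = delta_mx 0 l - \sum_l0 om l0 i.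
    rewrite -[LHS]/(tvec_of i p (delta_mx 0 l) i - (\sum_l0 om l0) i) tvec_ofE //.
    congr (_ - _); have := tvec_sumE (index_enum _) (fun=> 1) om i.
    by under eq_bigr do rewrite scale1r; move=> ->; apply: eq_bigr => c _; rewrite scale1r.
  rewrite mulmxBl mulmx_suml big1 ?subr0; last by move=> c _; have [_ _ hc] := h1 c; exact: key hc.
  by rewrite -rowE => /matrixP /(_ 0 0); rewrite !mxE.
move=> [xi [U [X [Y [Fxi [oU Up] [sX sY] XY [_ _ h]]]]]].
have lx : local_section k p xi by case: Fxi.
have eF := J1_jet1 J Fxi.
have ux : mxsub f f (plane_coord i xi (chart i p)) \in unitmx.
  by have [<- _] := jet_coord_jet1 di lx; rewrite -eF.
have [Q [w [Qp [oQ hw _] Qi nQ [hQ [w0 w1]]]]] := section_normal_form di lx ux.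
rewrite -eF c1 in w0.
have {}w1 l : 'D_(delta_mx 0 l) w (chart i p) = E l by rewrite w1 -eF c2.
have rep (Z : vector_field M) v : smooth_vector_field_on U Z -> (forall q, U q -> xi q (Z q)) ->
   exists d, Z p i = colsub f (Z p i) *m W /\
   'D_v (fun x => Z (chart_inv i x) i) (chart i p) =
     d *m W + colsub f (Z p i) *m (\sum_l v 0 l *: E l).
  move=> sZ xZ.
  have dZ : derivable (fun x => Z (chart_inv i x) i) (chart i p) v.
    exact: (smooth_vector_field_derivable oU Up di sZ).
  have eZ q : U q -> frame_dom i Q q -> Z q i = colsub f (Z q i) *m w (chart i q).
    move=> Uq dq; have := xZ q Uq; rewrite (hQ q dq) => -[_ /submxP[D e]].
    have [_ Qq] := dq.
    have h3 : colsub f (Z q i) = D by rewrite e -mulmx_colsub (nQ _ Qq) mulmx1.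
    by rewrite h3.
  exists ('D_v (fun x => colsub f (Z (chart_inv i x) i)) (chart i p)).
  split; first by rewrite {1}(eZ p Up (conj di Qp)) w0.
  have [d1 e1] := derive_mxsub (fun a : 'I_1 => a) f dZ.
  have dw : derivable w (chart i p) v := Cr_on_derivable (v := v) (hw 1%N) Qp.
  have [_ e2] := is_derive_mulmx d1 dw.
  rewrite w0 (derive_frame v oQ Qp (hw 1%N) w1) chartK // in e2; rewrite -e2.
  apply: near_derive.
  have h1 := near_chart_inv di (open_nbhs_nbhs (conj oU Up)).
  have h2 : \forall x \near chart i p, Q x by exact: open_nbhs_nbhs.
  apply: filterS2 h1 h2 => x Ux Qx; have [q dq e] := Qi x Qx; subst x.
  rewrite chartK // in Ux *; apply: eZ => //.
have [dX [eX hX]] := rep X (Y p i) sX (fun q Uq => (XY q Uq).1).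
have [dY [eY hY]] := rep Y (X p i) sY (fun q Uq => (XY q Uq).2).
have := jW _ h; rewrite -[(om - _) i]/(om i - lie_bracket X Y p i) mulmxBl.
move=> /eqP; rewrite subr_eq0 => /eqP ->.
rewrite /lie_bracket (asboolT di) !chartK // hX hY mulmxBl !mulmxDl -!mulmxA Wy !mulmx0 !add0r !mulmxA.
by rewrite {1}eX {2}eY; exact: row_mul_curv.
Qed.

(** The frame fields of the affine representative have exactly the brackets [curv W E a b] at [p].
    Since [curvature_epi] allows no coefficients in its sum, the coefficient of each bracket is put
    into the first vector field. *)
Lemma curv_curvature_epi k (f : 'I_k -> 'I_n) i p (W : 'M[R]_(k, n)) E :
  dom i p -> normalized f W -> (forall a, colsub f (E a) = 0) ->
  curv_epi W E -> curvature_epi p (frame_jet i p W E).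
Proof.
move=> di nW nE epi w tw.
have fW := normalized_free nW.
have lx := frame_jet_section E di fW.
set x0 := chart i p in lx; set aff := affine_frame x0 W E in lx.
have J := frame_jet_J1 E di fW; set F := frame_jet i p W E in J *.
have [c0 _ _ _] := frame_jet_coords di nW nE.
have [_ _ _ j0] := jet0_plane di J; rewrite c0 in j0.
have {}j0 : jet0 p F = plane i p W by rewrite j0; apply: plane_eqmx; exact: row_proj_eqmx.
pose S := (W + \sum_(ab : 'I_k * 'I_k) <<curv W E ab.1 ab.2>>)%MS.
have fS : row_full S.
  apply: annihilator_row_full => y Sy.
  have sub m (A : 'M[R]_(m, n)) : (A <= S)%MS -> A *m y = 0.
    by move=> /submxP[D ->]; rewrite -mulmxA Sy mulmx0.
  apply: epi; first by apply: sub; exact: addsmxSl.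
  move=> a b; apply: sub; apply: submx_trans (addsmxSr _ _).
  by apply: (sumsmx_sup (a, b)) => //; rewrite genmxE.
have /sub_addsmxP[[d g] /= ew] : (w i <= S)%MS by exact: submx_full.
have /sub_sumsmxP[g' eg] : (g *m (\sum_(ab : 'I_k * 'I_k) <<curv W E ab.1 ab.2>>)%MS <=
   \sum_(ab : 'I_k * 'I_k) <<curv W E ab.1 ab.2>>)%MS by exact: submxMl.
have /choice[cf hcf] : forall ab, exists c : R, g' ab *m <<curv W E ab.1 ab.2>>%MS = c *: curv W E ab.1 ab.2.
  by move=> ab; apply/sub_rVP; apply: submx_trans (submxMl _ _) _; rewrite genmxE.
pose X (c : R) a : vector_field M := fun q => tvec_of i q (c *: row a (aff (chart i q))).
have oi : open (chart_image i) := @open_chart_image _ _ _ i.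
have smr c a r : Cr_on r (chart_image i) (fun x => c *: row a (aff x)).
  apply: Cr_on_mx => // s l.
  have := Cr_onM oi (Cr_on_cst r (chart_image i) c) (Cr_on_entry a l oi (Cr_on_affine x0 W E r oi)).
  by apply: Cr_on_eq => // x _; rewrite !mxE.
have sX c a : smooth_vector_field_on (dom i) (X c a).
  exact: (@frame_vector_field i (fun x => c *: row a (aff x)) (smr c a)).
have odi : open (dom i) by exact: dom_open.
have XF c a q : dom i q -> frame_field i aff q (X c a q).
  move=> dq; split; first exact: tvec_of_tangent.
  by rewrite /X tvec_ofE // scalemx_sub // row_sub.
have dX c a u : 'D_u (fun x => X c a (chart_inv i x) i) x0 = c *: row a (\sum_l u 0 l *: E l).
  have daff := derive_frame u openT I (Cr_on_affine x0 W E 1 openT) (fun b => derive_affine x0 W E x0 b).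
  have dd : derivable aff x0 u := Cr_on_derivable (v := u) (Cr_on_affine x0 W E 1 openT) I.
  rewrite -daff.
  have lin : linear (fun A : 'M[R]_(k, n) => c *: row a A).
    by move=> e A B; apply/matrixP => s t; rewrite !mxE; ring.
  have cont : continuous (fun A : 'M[R]_(k, n) => c *: row a A).
    apply: continuous_mx => s t.
    have -> : (fun B : 'M[R]_(k, n) => (c *: row a B) s t) = (fun B => c * B a t).
      by apply/funext => B; rewrite !mxE.
    move=> A; have h := Cr_onM openT (Cr_on_cst 0 setT c) (Cr_on_entry a t openT (@Cr_on_id R 'M[R]_(k, n) 0 setT)).
    exact: (Cr_on_cont h I).
  have [_ <-] := is_derive_lin lin cont dd.
  apply: near_derive; have : \forall x \near x0, chart_image i x.
    by apply: open_nbhs_nbhs; split=> //; exists p.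
  by apply: filterS => x [q dq <-]; rewrite /X tvec_ofE chartK.
have lieE c a b : lie_bracket (X c a) (X 1 b) p i = c *: curv W E a b.
  rewrite /lie_bracket (asboolT di) !chartK // !dX /X !tvec_ofE // /aff affine_frame0 scale1r.
  rewrite /curv scalerBr scale1r; congr (_ - _).
    apply/rowP => t; rewrite !mxE !summxE mulr_sumr; apply: eq_bigr => l _.
    by rewrite !mxE mulrA.
  by congr (c *: row a _); apply: eq_bigr => l _; rewrite !mxE.
pose P (s : 'I_#|{: 'I_k * 'I_k}|) := enum_val s.
pose C (s : 'I_#|{: 'I_k * 'I_k}|) : R := cf (P s).
exists #|{: 'I_k * 'I_k}|, (fun s => X (C s) (P s).1 p), (fun s => X 1 (P s).2 p),
  (fun s => lie_bracket (X (C s) (P s).1) (X 1 (P s).2) p).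
have XW c a : jet0 p F (X c a p).
  by rewrite jet0_jet1 //; exact: XF.
have tl s : tangent p (lie_bracket (X (C s) (P s).1) (X 1 (P s).2) p).
  exact: (lie_bracket_tangent odi di).
split.
  move=> s; split=> //.
  exists (frame_field i aff), (dom i), (X (C s) (P s).1), (X 1 (P s).2); split=> //.
  - by move=> q dq; split; exact: XF.
  - split=> //; rewrite subrr j0; split; first exact: tangent0.
    exact: sub0mx.
have sumE : (\sum_s lie_bracket (X (C s) (P s).1) (X 1 (P s).2) p) i = g *m (\sum_(ab : 'I_k * 'I_k) <<curv W E ab.1 ab.2>>)%MS.
  have := tvec_sumE (index_enum _) (fun=> 1) (fun s => lie_bracket (X (C s) (P s).1) (X 1 (P s).2) p) i.
  under eq_bigr do rewrite scale1r; move=> ->.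
  rewrite eg [RHS](reindex (@enum_val _ {: 'I_k * 'I_k})) /=; last first.
    by exists enum_rank => s _; [exact: enum_valK|exact: enum_rankK].
  by apply: eq_bigr => s _; rewrite scale1r lieE /C /P hcf.
rewrite j0; split.
  have t1 : tangent p (\sum_s lie_bracket (X (C s) (P s).1) (X 1 (P s).2) p).
    have := tangent_sum (index_enum _) (fun=> 1) tl.
    by under eq_bigr do rewrite scale1r.
  have := tangent_lin (-1) t1 tw; rewrite scaleN1r addrC; exact.
rewrite -[(_ - _) i]/(w i - (\sum_s lie_bracket (X (C s) (P s).1) (X 1 (P s).2) p) i) sumE ew.
by rewrite addrK submxMl.
Qed.

End NormalForm.

(** * Smooth families *)

Lemma cvg_fst_fst (T1 T2 T3 : topologicalType) (a : T1) (b : T2) (c : T3) :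
  t.1.1 @[t --> (a, b, c)] --> a.
Proof. by apply: (cvg_comp _ _ (@cvg_fst _ _ (nbhs (a, b)) (nbhs c) _)); exact: cvg_fst. Qed.

Lemma cvg_snd_fst (T1 T2 T3 : topologicalType) (a : T1) (b : T2) (c : T3) :
  t.1.2 @[t --> (a, b, c)] --> b.
Proof. by apply: (cvg_comp _ _ (@cvg_fst _ _ (nbhs (a, b)) (nbhs c) _)); exact: cvg_snd. Qed.

Section Families.
Context {R : realType} {n d : nat} (K : manifold_with_boundary R d) (X : set 'rV[R]_n).

Local Notation Z := (K * R * 'rV[R]_n)%type.
Local Notation V := ('rV[R]_d * R * 'rV[R]_n)%type.

Definition param_dom (a : chart_index K) : set V :=
  ((chart a @` dom a) `*` [set s : R | 0 <= s <= 1]) `*` X.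
Definition param_of (a : chart_index K) (v : V) : Z := (chart_inv a v.1.1, v.1.2, v.2).
Definition param_coord (a : chart_index K) (z : Z) : V := (chart a z.1.1, z.1.2, z.2).
Definition fam_dom : set Z := [set z | 0 <= z.1.2 <= 1 /\ X z.2].

(* A point (q, s, x) consists of a parameter, the time of the homotopy and
   coordinates on M; time is treated as one more parameter. *)
Definition fam_smooth (W : normedModType R) (f : Z -> W) (z : Z) : Prop :=
  forall a, dom a z.1.1 ->
    smooth_at (param_dom a) (param_coord a z) (fun v => f (param_of a v)).

Lemma param_coordK a z : dom a z.1.1 -> param_of a (param_coord a z) = z.
Proof. by case: z => [[q s] x] /= dq; rewrite /param_of /param_coord /= chartK. Qed.

Lemma param_dom_coord a z : dom a z.1.1 -> fam_dom z -> param_dom a (param_coord a z).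
Proof. by move=> dq [hs hx]; split=> //; split=> //; exists z.1.1. Qed.

Lemma near_param a z (Q : set Z) : dom a z.1.1 -> (\forall y \near z, Q y) ->
  \forall v \near param_coord a z, param_dom a v -> Q (param_of a v).
Proof.
case: z => [[q s] x] /= dq [[A1 A3] /= [[[B1 B2] /= [hB1 hB2] sB] hA3] sA].
have h1 := near_chart dq hB1.
have c1 : \forall v \near (param_coord a (q, s, x)), (chart a @` dom a) v.1.1 -> B1 (chart_inv a v.1.1).
  have : (v.1.1 @[v --> param_coord a (q, s, x)] --> chart a q).
    by apply: (cvg_comp _ _ (@cvg_fst _ _ (nbhs (chart a q, s)) (nbhs x) _)); exact: cvg_fst.
  by move=> h; exact: (h _ h1).
have c2 : \forall v \near (param_coord a (q, s, x)), B2 v.1.2.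
  have : (v.1.2 @[v --> param_coord a (q, s, x)] --> s).
    by apply: (cvg_comp _ _ (@cvg_fst _ _ (nbhs (chart a q, s)) (nbhs x) _)); exact: cvg_snd.
  by move=> h; exact: (h _ hB2).
have c3 : \forall v \near (param_coord a (q, s, x)), A3 v.2.
  have : (v.2 @[v --> param_coord a (q, s, x)] --> x) by exact: cvg_snd.
  by move=> h; exact: (h _ hA3).
near=> v => -[[vK _] _]; apply: sA; split=> /=; last by near: v.
apply: sB; split=> /=; last by near: v.
have : (chart a @` dom a) v.1.1 -> B1 (chart_inv a v.1.1) by near: v; exact: c1.
exact.
Unshelve. all: by end_near. Qed.

Lemma fam_smooth_eq (W : normedModType R) (f g : Z -> W) z :
  (\forall y \near z, fam_dom y -> f y = g y) -> fam_smooth f z -> fam_smooth g z.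
Proof.
move=> h hf a dq; apply: smooth_at_eq (hf a dq).
have := near_param dq h; apply: filterS => v hv pv; apply: (hv pv).
by case: pv => [[_ hs] hx].
Qed.

Lemma fam_smooth_eqA (W : normedModType R) (f g : Z -> W) z :
  (forall y, fam_dom y -> f y = g y) -> fam_smooth f z -> fam_smooth g z.
Proof. by move=> h; apply: fam_smooth_eq; exact: (@filterE _ _ (nbhs_filter z)). Qed.

Lemma fam_smooth_cst (W : normedModType R) (k : W) z : fam_smooth (fun=> k) z.
Proof. by move=> a _; exact: smooth_at_cst. Qed.

Lemma fam_smoothD (W : normedModType R) (f g : Z -> W) z :
  fam_smooth f z -> fam_smooth g z -> fam_smooth (fun y => f y + g y) z.
Proof. by move=> hf hg a dq; apply: smooth_atD; [exact: hf|exact: hg]. Qed.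

Lemma fam_smoothM (f g : Z -> R) z :
  fam_smooth f z -> fam_smooth g z -> fam_smooth (fun y => f y * g y) z.
Proof. by move=> hf hg a dq; apply: smooth_atM; [exact: hf|exact: hg]. Qed.

Lemma fam_smooth_scale m p (f : Z -> R) (g : Z -> 'M[R]_(m, p)) z :
  fam_smooth f z -> fam_smooth g z -> fam_smooth (fun y => f y *: g y) z.
Proof. by move=> hf hg a dq; apply: smooth_at_scalemx; [exact: hf|exact: hg]. Qed.

Lemma fam_smoothB m p (f g : Z -> 'M[R]_(m, p)) z :
  fam_smooth f z -> fam_smooth g z -> fam_smooth (fun y => f y - g y) z.
Proof.
move=> hf hg.
have h := fam_smoothD hf (fam_smooth_scale (@fam_smooth_cst _ (-1 : R) z) hg).
by apply: fam_smooth_eqA h => y _; rewrite scaleN1r.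
Qed.

Lemma fam_smooth_sum (W : normedModType R) (J : Type) (s : seq J) (P : pred J)
    (f : J -> Z -> W) z : (forall j, P j -> fam_smooth (f j) z) ->
  fam_smooth (fun y => \sum_(j <- s | P j) f j y) z.
Proof. by move=> h a dq; apply: smooth_at_sum => j Pj; exact: h. Qed.

Lemma fam_smooth_mulmx m p r (f : Z -> 'M[R]_(m, p)) (g : Z -> 'M[R]_(p, r)) z :
  fam_smooth f z -> fam_smooth g z -> fam_smooth (fun y => f y *m g y) z.
Proof. by move=> hf hg a dq; apply: smooth_at_mulmx; [exact: hf|exact: hg]. Qed.

Lemma fam_smooth_entry m p (f : Z -> 'M[R]_(m, p)) i j z :
  fam_smooth f z -> fam_smooth (fun y => f y i j) z.
Proof. by move=> hf a dq; apply: smooth_at_entry; exact: hf. Qed.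

Lemma fam_smooth_mx m p (f : Z -> 'M[R]_(m, p)) z :
  (forall i j, fam_smooth (fun y => f y i j) z) -> fam_smooth f z.
Proof. by move=> hf a dq; apply: smooth_at_mx => i j; exact: hf. Qed.

Lemma fam_smooth_mxsub m p m' p' (e : 'I_m' -> 'I_m) (e' : 'I_p' -> 'I_p)
    (f : Z -> 'M[R]_(m, p)) z :
  fam_smooth f z -> fam_smooth (fun y => mxsub e e' (f y)) z.
Proof. by move=> hf a dq; apply: smooth_at_mxsub; exact: hf. Qed.

Lemma fam_smooth_det m (f : Z -> 'M[R]_m) z :
  fam_smooth f z -> fam_smooth (fun y => \det (f y)) z.
Proof. by move=> hf a dq; apply: smooth_at_det; exact: hf. Qed.

Lemma fam_smooth_fun1 (f : Z -> R) (g : R -> R) z : fam_dom z ->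
  (forall r, Cr_on r setT g) -> fam_smooth f z -> fam_smooth (fun y => g (f y)) z.
Proof.
move=> Dz hg hf a dq; apply: (smooth_at_fun1 (param_dom_coord dq Dz) hg).
exact: hf.
Qed.

Lemma fam_smooth_invmx m (f : Z -> 'M[R]_m) z : fam_dom z ->
  f z \in unitmx -> fam_smooth f z -> fam_smooth (fun y => invmx (f y)) z.
Proof.
move=> Dz u hf a dq; apply: smooth_at_invmx; first exact: param_dom_coord.
  by rewrite param_coordK.
exact: hf.
Qed.

Lemma fam_smooth_x l z : fam_smooth (fun y => y.2 0 l) z.
Proof.
move=> a dq /=.
apply: (@smooth_at_entry R V (param_dom a) (param_coord a z) 1 n (fun v => v.2) 0 l).
apply: (smooth_at_lin (l := snd)) (smooth_at_id _ _); first by move=> ? ? ?.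
by move=> v; exact: cvg_snd.
Qed.

Definition dx (W : normedModType R) (f : Z -> W) (l : 'I_n) (z : Z) : W :=
  'D_(delta_mx 0 l) (fun x => f (z.1, x)) z.2.

Lemma fam_smooth_dx (W : normedModType R) (f : Z -> W) l z : open X -> fam_dom z ->
  fam_smooth f z ->
  fam_smooth (dx f l) z /\ derivable (fun x => f (z.1, x)) z.2 (delta_mx 0 l).
Proof.
move=> oX Dz hf; have pd a dq := @param_dom_coord a z dq Dz.
split.
  move=> a dq; have [[hK hs] hx] := pd a dq.
  have [h _] := smooth_at_dx (delta_mx 0 l) oX (conj hK hs) hx (hf a dq).
  by apply: smooth_at_eqA h => v _.
have [a dq] := dom_cover z.1.1; have [[hK hs] hx] := pd a dq.
have [_] := smooth_at_dx (delta_mx 0 l) oX (conj hK hs) hx (hf a dq).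
rewrite /param_coord /param_of /= chartK //.
by case: z.1.
Qed.

Lemma fam_smooth_cvg (W : normedModType R) (f : Z -> W) z : fam_dom z -> fam_smooth f z ->
  f y @[y --> within fam_dom (nbhs z)] --> f z.
Proof.
move=> Dz hf; have [a dq] := dom_cover z.1.1.
have c := smooth_at_cvg (param_dom_coord dq Dz) (hf a dq).
rewrite param_coordK // in c.
have cc : param_coord a y @[y --> z] --> param_coord a z.
  case: z dq {Dz hf c} => [[q s] x] /= dq; rewrite /param_coord /=.
  apply: (@cvg_pair _ _ _ _ (nbhs (chart a q, s)) (nbhs x)); last exact: cvg_snd.
  apply: (@cvg_pair _ _ _ _ (nbhs (chart a q)) (nbhs s)).
    exact: (cvg_comp _ _ (@cvg_fst_fst _ _ _ q s x) (chart_cont dq)).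
  exact: (@cvg_snd_fst _ _ _ q s x).
have nd : \forall y \near z, dom a y.1.1.
  have : y.1.1 @[y --> z] --> z.1.1.
    case: z {dq Dz hf c cc} => [[q s] x].
    by apply: (cvg_comp _ _ (@cvg_fst _ _ (nbhs (q, s)) (nbhs x) _)); exact: cvg_fst.
  by apply; apply: open_nbhs_nbhs; split=> //; exact: dom_open.
move=> A /c hA.
have {}hA : \forall v \near param_coord a z, param_dom a v -> A (f (param_of a v)) := hA.
have h2 : \forall y \near z, param_dom a (param_coord a y) -> A (f (param_of a (param_coord a y))).
  exact: (cc _ hA).
suff : \forall y \near z, fam_dom y -> A (f y) by [].
apply: (@filterS2 _ _ (nbhs_filter z) _ _ _ _ nd h2) => y dy.
by rewrite param_coordK // => hy Dy; apply: hy; exact: param_dom_coord.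
Qed.

(* Continuity as k -> 0 of functions of (z, u, k), with u in a compact set. *)
Definition tube_cont (U : topologicalType) (W : topologicalType) (G : Z * U * R -> W) (z : Z) (u : U) : Prop :=
  G y @[y --> within [set t | fam_dom t.1.1] (nbhs (z, u, 0 : R))] --> G (z, u, 0 : R).

(** The source of the uniform constants of a step, such as the amplitude of the oscillation:
    compactness of [S] and [C], used as a near covering with [k] as the parameter. *)
Lemma tube (U : topologicalType) (C : set U) (S : set Z) (P : R -> Z * U -> Prop) :
  compact S -> compact C -> S `<=` fam_dom ->
  (forall z u, S z -> C u -> \forall t \near (z, u, 0 : R), fam_dom t.1.1 -> P t.2 t.1) ->
  exists2 e : R, 0 < e & forall k, `|k| < e -> forall z u, S z -> C u -> P k (z, u).
Proof.
move=> cS cC SD h.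
have /compact_near_coveringP nc := compact_setX cS cC.
have key x : (S `*` C) x -> \forall x' \near x & k \near nbhs (0 : R),
    fam_dom x'.1 -> P k x'.
  by case: x => z u [Sz Cu]; exact: (h z u Sz Cu).
have := nc R (nbhs (0 : R)) (fun k zu => fam_dom zu.1 -> P k zu) (nbhs_filter _) key.
move=> /nbhs_normP[e /= e0 he]; exists e => // k ke z u Sz Cu.
have := he k; rewrite /ball_ /= sub0r normrN => /(_ ke (z, u)); apply; first by split.
exact: SD.
Qed.

Lemma tube_gt0 (U : topologicalType) (G : Z * U * R -> R) z u :
  fam_dom z -> tube_cont G z u -> 0 < G (z, u, 0) ->
  \forall t \near (z, u, 0 : R), fam_dom t.1.1 -> 0 < G t.
Proof.
move=> Dz c G0; have /cvgrPdist_lt /(_ _ G0) hn := c.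
have {}hn : \forall t \near (z, u, 0 : R), fam_dom t.1.1 -> `|G (z, u, 0) - G t| < G (z, u, 0) := hn.
apply: filterS hn => t h /h; rewrite ltr_distlC subrr => /andP[]//.
Qed.

Lemma tube_cont_fam (U : topologicalType) (W : normedModType R) (f : Z -> W) z (u : U) :
  fam_dom z -> fam_smooth f z -> tube_cont (fun t => f t.1.1) z u.
Proof.
move=> Dz /(fam_smooth_cvg Dz) c A /c hA.
have {}hA : \forall y \near z, fam_dom y -> A (f y) := hA.
have c1 : t.1.1 @[t --> (z, u, 0 : R)] --> z.
  by apply: (cvg_comp _ _ (@cvg_fst _ _ (nbhs (z, u)) (nbhs (0 : R)) _)); exact: cvg_fst.
exact: (c1 _ hA).
Qed.

Lemma tube_cont_u (U W : topologicalType) (f : U -> W) z (u : U) :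
  {for u, continuous f} -> tube_cont (fun t => f t.1.2) z u.
Proof.
move=> c; apply: cvg_within_filter.
have c1 : t.1.2 @[t --> (z, u, 0 : R)] --> u.
  by apply: (cvg_comp _ _ (@cvg_fst _ _ (nbhs (z, u)) (nbhs (0 : R)) _)); exact: cvg_snd.
exact: (cvg_comp _ _ c1 c).
Qed.

Lemma tube_cont_k (U : topologicalType) z (u : U) : tube_cont (fun t => t.2) z u.
Proof. by apply: cvg_within_filter; exact: cvg_snd. Qed.

Lemma tube_contD (U : topologicalType) (W : normedModType R) (f g : Z * U * R -> W) z u :
  tube_cont f z u -> tube_cont g z u -> tube_cont (fun t => f t + g t) z u.
Proof. exact: cvgD. Qed.

Lemma tube_contM (U : topologicalType) (f g : Z * U * R -> R) z u :
  tube_cont f z u -> tube_cont g z u -> tube_cont (fun t => f t * g t) z u.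
Proof. exact: cvgM. Qed.

Lemma tube_cont_cst (U W : topologicalType) (w : W) z (u : U) : tube_cont (fun=> w) z u.
Proof. exact: cvg_cst. Qed.

Lemma tube_contN (U : topologicalType) (f : Z * U * R -> R) z u :
  tube_cont f z u -> tube_cont (fun t => - f t) z u.
Proof. exact: cvgN. Qed.

Lemma tube_cont_sum (U : topologicalType) (W : normedModType R) (J : Type) (s : seq J)
    (f : J -> Z * U * R -> W) z u :
  (forall j, tube_cont (f j) z u) -> tube_cont (fun t => \sum_(j <- s) f j t) z u.
Proof. by move=> h; apply: cvg_sumr => j; exact: h. Qed.

Lemma tube_cont_mx (U : topologicalType) m p (f : Z * U * R -> 'M[R]_(m, p)) z u :
  (forall i j, tube_cont (fun t => f t i j) z u) -> tube_cont f z u.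
Proof. by move=> h; apply: cvg_mx_entries => i j; exact: h. Qed.

Lemma tube_cont_entry (U : topologicalType) m p (f : Z * U * R -> 'M[R]_(m, p)) i j z u :
  tube_cont f z u -> tube_cont (fun t => f t i j) z u.
Proof. by move=> h; exact: (cvg_comp _ _ h (@coord_continuous R m p i j (f (z, u, 0)))). Qed.

Lemma tube_cont_mulmx (U : topologicalType) m p r (f : Z * U * R -> 'M[R]_(m, p))
    (g : Z * U * R -> 'M[R]_(p, r)) z u :
  tube_cont f z u -> tube_cont g z u -> tube_cont (fun t => f t *m g t) z u.
Proof.
move=> hf hg; apply: tube_cont_mx => i j.
have -> : (fun t => (f t *m g t) i j) = (fun t => \sum_l f t i l * g t l j).
  by apply/funext => t; rewrite mxE.
by apply: tube_cont_sum => l; apply: tube_contM; exact: tube_cont_entry.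
Qed.

Lemma tube_cont_scale (U : topologicalType) m p (f : Z * U * R -> R)
    (g : Z * U * R -> 'M[R]_(m, p)) z u :
  tube_cont f z u -> tube_cont g z u -> tube_cont (fun t => f t *: g t) z u.
Proof. exact: cvgZ. Qed.

End Families.

(** * One step of convex integration *)

Section CurvatureAlgebra.
Context {R : realType} {n k : nat}.
Implicit Types (W : 'M[R]_(k, n)) (E : 'I_n -> 'M[R]_(k, n)) (f : 'I_k -> 'I_n).

(** The formal derivative in the direction of the frame vector [W_a]. *)
Definition along W E (a : 'I_k) : 'M[R]_(k, n) := \sum_l W a l *: E l.

Lemma curvE W E a b : curv W E a b = row b (along W E a) - row a (along W E b).
Proof. by []. Qed.

Lemma alongD W E E' a : along W (fun l => E l + E' l) a = along W E a + along W E' a.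
Proof. by rewrite /along -big_split; apply: eq_bigr => l _; rewrite scalerDr. Qed.

Lemma alongN W E a : along W (fun l => - E l) a = - along W E a.
Proof. by rewrite /along -sumrN; apply: eq_bigr => l _; rewrite scalerN. Qed.

Lemma alongZ W E c a : along W (fun l => c *: E l) a = c *: along W E a.
Proof. by rewrite /along scaler_sumr; apply: eq_bigr => l _; rewrite !scalerA mulrC. Qed.

(** On a normalised frame the coordinate covectors [f a] form the dual basis, so a change of [E] at
    the index [f a] alone is felt only in the direction [W_a]. *)
Lemma along_delta W f (B : 'M[R]_(k, n)) a a' : normalized f W ->
  along W (fun l => (l == f a)%:R *: B) a' = (a' == a)%:R *: B.
Proof.
move=> nW; rewrite /along (bigD1 (f a)) //= eqxx scale1r (normalizedP _ _ nW).
by rewrite big1 ?addr0 // => l /negPf ->; rewrite scale0r scaler0.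
Qed.

(* The part of e that one step removes: everything but the components
   (e(W_a'))_b' in the frame directions, together with the component (a, b). *)
Definition kill f W (a b : 'I_k) E (l : 'I_n) : 'M[R]_(k, n) :=
  E l - \sum_a' (l == f a')%:R *: along W E a'
  + (l == f a)%:R *: (delta_mx b b *m along W E a).

Lemma along_kill f W a b E a' : normalized f W ->
  along W (kill f W a b E) a' = (a' == a)%:R *: (delta_mx b b *m along W E a).
Proof.
move=> nW; rewrite /kill alongD alongD alongN along_delta //.
suff -> : along W (fun l => \sum_c (l == f c)%:R *: along W E c) a' = along W E a'.
  by rewrite subrr add0r.
rewrite [LHS]/along; under eq_bigr do rewrite scaler_sumr.
rewrite exchange_big /= (bigD1 a') //= [X in _ + X]big1 ?addr0; last first.
  move=> c ca; rewrite -[LHS]/(along W (fun l => (l == f c)%:R *: along W E c) a').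
  by rewrite along_delta // eq_sym (negPf ca) scale0r.
by rewrite -[LHS]/(along W (fun l => (l == f a')%:R *: along W E a') a') along_delta // eqxx scale1r.
Qed.

Lemma row_delta_mul (b b' : 'I_k) (A : 'M[R]_(k, n)) :
  row b' (delta_mx b b *m A) = (b' == b)%:R *: row b A.
Proof.
rewrite row_mul; have -> : row b' (delta_mx b b) = (b' == b)%:R *: (delta_mx 0 b : 'rV[R]_k).
  by apply/rowP => t; rewrite !mxE /=; case: (b' == b); rewrite ?mul1r ?mul0r.
by rewrite -scalemxAl -rowE.
Qed.

Definition curv_at W E (y : 'cV[R]_n) (a b : 'I_k) : R :=
  \sum_l W a l * (E l *m y) b 0 - \sum_l W b l * (E l *m y) a 0.

Lemma along_at W E (y : 'cV[R]_n) a b :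
  (along W E a *m y) b 0 = \sum_l W a l * (E l *m y) b 0.
Proof.
rewrite /along mulmx_suml summxE; apply: eq_bigr => l _.
by rewrite -scalemxAl mxE.
Qed.

Lemma curv_atE W E (y : 'cV[R]_n) a b :
  curv_at W E y a b = (along W E a *m y) b 0 - (along W E b *m y) a 0.
Proof. by rewrite !along_at. Qed.

Lemma curv_mul W E (y : 'cV[R]_n) a b : curv W E a b *m y = (curv_at W E y a b)%:M.
Proof.
apply/matrixP => i j; rewrite !ord1 [RHS]mxE eqxx mulr1n curv_atE curvE mulmxBl.
by rewrite -!row_mul !mxE.
Qed.

Lemma curv_epiP W E : curv_epi W E <-> forall y : 'cV[R]_n, y != 0 ->
  0 < \sum_a ((W *m y) a 0) ^+ 2 + \sum_a \sum_b (curv_at W E y a b) ^+ 2.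
Proof.
split=> [h y y0|h y Wy cy].
  have ge1 : 0 <= \sum_a ((W *m y) a 0) ^+ 2 by apply: sumr_ge0 => a _; exact: sqr_ge0.
  have ge2 : 0 <= \sum_a \sum_b (curv_at W E y a b) ^+ 2.
    by do 2 (apply: sumr_ge0 => ? _); exact: sqr_ge0.
  rewrite lt_neqAle addr_ge0 // andbT; apply: contra_neq y0 => /eqP.
  rewrite eq_sym paddr_eq0 // => /andP[/eqP e1 /eqP e2]; apply: h.
    apply/matrixP => a j; rewrite ord1 [RHS]mxE; apply/eqP; rewrite -sqrf_eq0.
    have /eqP := e1; rewrite psumr_eq0; last by move=> ? _; exact: sqr_ge0.
    by move=> /allP /(_ a (mem_index_enum _)).
  move=> a b; rewrite curv_mul.
  have /eqP := e2; rewrite psumr_eq0; last by move=> ? _; apply: sumr_ge0 => ? _; exact: sqr_ge0.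
  move=> /allP /(_ a (mem_index_enum _)) /=; rewrite psumr_eq0; last by move=> ? _; exact: sqr_ge0.
  move=> /allP /(_ b (mem_index_enum _)) /=; rewrite sqrf_eq0 => /eqP ->.
  by apply/matrixP => i j; rewrite !mxE mul0rn.
apply/eqP; apply: contraT => y0; have := h y y0.
rewrite big1 ?add0r; last by move=> a _; rewrite Wy mxE expr0n.
rewrite big1 ?ltxx // => a _; rewrite big1 // => b _.
have := cy a b; rewrite curv_mul => /matrixP /(_ 0 0); rewrite !mxE eqxx mulr1n => ->.
by rewrite expr0n.
Qed.

(* The loop u + i h on the circle u^2 + v^2 = 1 has mean zero but avoids the
   half-line of nonpositive reals, quantitatively. *)
Lemma loop_avoids (u v r : R) : u ^+ 2 + v ^+ 2 = 1 -> 0 <= r ->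
  r ^+ 2 / 32%:R <= (1 + r * u) ^+ 2 + (r * (u + (u ^+ 2 - v ^+ 2) / 2)) ^+ 2.
Proof.
move=> e r0; have -> : u + (u ^+ 2 - v ^+ 2) / 2 = u + u ^+ 2 - 2^-1.
  have -> : v ^+ 2 = 1 - u ^+ 2 by rewrite -e; ring.
  by field.
have u1 : u ^+ 2 <= 1 by rewrite -e lerDl sqr_ge0.
have um : -1 <= u by nra.
have uM : u <= 1 by nra.
set h := u + u ^+ 2 - 2^-1.
(* The origin of the constant: for [u <= 1/4] one has [h <= -3/16], and [9/256 >= 1/32]; for
   [u > 1/4] the real part is at least [r u], with [u ^+ 2 >= 1/16]. *)
have hh : 32%:R^-1 <= h ^+ 2 \/ (0 <= u /\ 32%:R^-1 <= u ^+ 2).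
  have [u14|u14] := leP u (4%:R^-1); last by right; split; nra.
  left; have : h <= - (3%:R / 16%:R) by rewrite /h; nra.
  by nra.
rewrite [in leRHS]exprMn; case: hh => [hh|[u0 hu]].
  have := sqr_ge0 (1 + r * u); have := sqr_ge0 r.
  have : r ^+ 2 * 32%:R^-1 <= r ^+ 2 * h ^+ 2 by rewrite ler_wpM2l ?sqr_ge0.
  lra.
have h1 : (r * u) ^+ 2 <= (1 + r * u) ^+ 2.
  have : 0 <= r * u by rewrite mulr_ge0.
  by nra.
have : r ^+ 2 * 32%:R^-1 <= r ^+ 2 * u ^+ 2 by rewrite ler_wpM2l ?sqr_ge0.
rewrite exprMn in h1; have := mulr_ge0 (sqr_ge0 r) (sqr_ge0 h); lra.
Qed.

(** The two equations say [(1 + r (u - i h)) (x + i y) = s t] with [r = s L]. Taking squared moduli,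
    [loop_avoids] bounds the factor below by [s ^+ 2 L ^+ 2 / 32], so [s ^+ 2] cancels and the bound
    is uniform in [s]. *)
Lemma loop_bound (x y s L u v t : R) : u ^+ 2 + v ^+ 2 = 1 -> 0 <= s -> 0 < L ->
  let h := u + (u ^+ 2 - v ^+ 2) / 2 in
  x - s * t + s * L * (u * x + h * y) = 0 -> y + s * L * (u * y - h * x) = 0 ->
  x ^+ 2 <= 32%:R * t ^+ 2 / L ^+ 2 /\ y ^+ 2 <= 32%:R * t ^+ 2 / L ^+ 2.
Proof.
move=> e s0 L0 h; set r := s * L => e1 e2.
have r0 : 0 <= r by rewrite mulr_ge0 // ltW.
have ex : (1 + r * u) * x + (r * h) * y = s * t by lra.
have ey : (1 + r * u) * y - (r * h) * x = 0 by lra.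
have E : ((1 + r * u) ^+ 2 + (r * h) ^+ 2) * (x ^+ 2 + y ^+ 2) = s ^+ 2 * t ^+ 2.
  have -> : ((1 + r * u) ^+ 2 + (r * h) ^+ 2) * (x ^+ 2 + y ^+ 2) =
    ((1 + r * u) * x + (r * h) * y) ^+ 2 + ((1 + r * u) * y - (r * h) * x) ^+ 2 by ring.
  by rewrite ex ey expr0n addr0 exprMn.
have B := loop_avoids e r0; rewrite -/h in B.
have S0 : 0 <= x ^+ 2 + y ^+ 2 by rewrite addr_ge0 ?sqr_ge0.
have L2 : 0 < L ^+ 2 by rewrite exprn_gt0.
have key : (x ^+ 2 + y ^+ 2) <= 32%:R * t ^+ 2 / L ^+ 2.
  rewrite ler_pdivlMr //.
  have [s00|sn0] := eqVneq s 0.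
    have -> : x = 0 by move: ex; rewrite /r s00 => ex; lra.
    have -> : y = 0 by move: ey; rewrite /r s00 => ey; lra.
    by rewrite expr0n addr0 mul0r mulr_ge0 ?sqr_ge0.
  have s2 : 0 < s ^+ 2 by rewrite exprn_even_gt0.
  rewrite -(ler_pM2l s2).
  have := ler_wpM2r S0 B; rewrite E /r exprMn => hh.
  have -> : s ^+ 2 * (32%:R * t ^+ 2) = 32%:R * (s ^+ 2 * t ^+ 2) by ring.
  have -> : s ^+ 2 * ((x ^+ 2 + y ^+ 2) * L ^+ 2) = 32%:R * (s ^+ 2 * L ^+ 2 / 32%:R * (x ^+ 2 + y ^+ 2)).
    by field.
  by rewrite ler_pM2l // ltr0n.
have := sqr_ge0 x; have := sqr_ge0 y; split; lra.
Qed.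

Definition bump_mx (b c : 'I_k) (w1 w2 : 'rV[R]_n) : 'M[R]_(k, n) :=
  (delta_mx b 0 : 'cV[R]_k) *m w1 + (delta_mx c 0 : 'cV[R]_k) *m w2.

Lemma bump_mx_at (b c b' : 'I_k) w1 w2 (y : 'cV[R]_n) : 
  (bump_mx b c w1 w2 *m y) b' 0 = (b' == b)%:R * (w1 *m y) 0 0 + (b' == c)%:R * (w2 *m y) 0 0.
Proof.
rewrite /bump_mx mulmxDl -!mulmxA mxE; congr (_ + _).
  by rewrite mxE big_ord1 mxE eqxx andbT.
by rewrite mxE big_ord1 mxE eqxx andbT.
Qed.

(* If y kills the oscillated curvature, then the curvature before the step was
   already small on y, by a factor 1 / L. *)
Lemma step_bound f W E e (a b c a1 b1 : 'I_k) (s L u v : R) (y : 'cV[R]_n) :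
  normalized f W -> a != b -> a != c -> b != c ->
  (a1 = a /\ b1 = b) \/ a1 = b1 ->
  u ^+ 2 + v ^+ 2 = 1 -> 0 <= s -> 0 < L ->
  let h := u + (u ^+ 2 - v ^+ 2) / 2 in
  let w1 := curv W E a b in let w2 := curv W E a c in
  let E0 l := E l - s *: kill f W a1 b1 e l
     + (l == f a)%:R *: (L *: (u *: (s *: bump_mx b c w1 w2) + h *: (s *: bump_mx b c w2 (- w1)))) in
  (forall a' b', curv_at W E0 y a' b' = 0) ->
  forall a' b', (curv_at W E y a' b') ^+ 2 <= 32%:R * ((along W e a1 *m y) b1 0) ^+ 2 / L ^+ 2.
Proof.
move=> nW ab ac bc hab uv s0 L0 h w1 w2 E0 H.
set t : R := (along W e a1 *m y) b1 0.
set q := curv_at W E y.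
have qa a' b' : q a' b' = - q b' a' by rewrite /q !curv_atE opprB.
have q0 a' : q a' a' = 0 by rewrite /q curv_atE subrr.
have w1y : (w1 *m y) 0 0 = q a b by rewrite /w1 curv_mul mxE eqxx mulr1n.
have w2y : (w2 *m y) 0 0 = q a c by rewrite /w2 curv_mul mxE eqxx mulr1n.
pose B b' := (b' == b)%:R * (u * q a b + h * q a c) + (b' == c)%:R * (u * q a c - h * q a b).
(* The hypothesis [H] expressed by the curvature [q] before the step: the removed entry enters
   antisymmetrised, and the loop only where one of the indices is [a]. *)
have key a' b' : q a' b' - s * ((a' == a1)%:R * (b' == b1)%:R * t - (b' == a1)%:R * (a' == b1)%:R * t)
    + s * L * ((a' == a)%:R * B b' - (b' == a)%:R * B a') = 0.
  rewrite -(H a' b') !curv_atE.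
  have al a'' b'' : (along W E0 a'' *m y) b'' 0 = (along W E a'' *m y) b'' 0
     - s * ((a'' == a1)%:R * (b'' == b1)%:R * t) + s * L * ((a'' == a)%:R * B b'').
    rewrite /E0 alongD alongD alongN alongZ along_kill // along_delta //.
    have lin (X Y : 'M[R]_(k, n)) : ((u *: (s *: X) + h *: (s *: Y)) *m y) b'' 0 =
        s * (u * (X *m y) b'' 0 + h * (Y *m y) b'' 0).
      by rewrite mulmxDl -!scalemxAl !mxE; ring.
    have tri (X Y T : 'M[R]_(k, n)) (x1 x2 x3 x4 : R) :
        ((X + - (x1 *: (x2 *: Y)) + x3 *: (x4 *: T)) *m y) b'' 0 =
        (X *m y) b'' 0 - x1 * (x2 * (Y *m y) b'' 0) + x3 * (x4 * (T *m y) b'' 0).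
      by rewrite !mulmxDl mulNmx -!scalemxAl !mxE; ring.
    rewrite tri lin !bump_mx_at mulNmx w1y w2y -mulmxA.
    have -> : (delta_mx b1 b1 *m (along W e a1 *m y)) b'' 0 = (b'' == b1)%:R * t.
      rewrite mxE (bigD1 b1) //= big1 ?addr0; last by move=> j jb; rewrite mxE (negPf jb) andbF mul0r.
      by rewrite mxE eqxx andbT.
    have -> : (- (w1 *m y)) 0 0 = - q a b by rewrite mxE w1y.
    rewrite /B; ring.
  rewrite !al /q curv_atE; ring.
have ca : (c == a) = false by rewrite eq_sym (negPf ac).
have ba : (b == a) = false by rewrite eq_sym (negPf ab).
have cb : (c == b) = false by rewrite eq_sym (negPf bc).
have Ba : B a = 0 by rewrite /B (negPf ab) (negPf ac) !mul0r addr0.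
have Bb : B b = u * q a b + h * q a c by rewrite /B eqxx (negPf bc) mul0r mul1r addr0.
have Bc : B c = u * q a c - h * q a b by rewrite /B eqxx cb mul0r mul1r add0r.
have Bo b' : b' != b -> b' != c -> B b' = 0.
  by move=> /negPf h1 /negPf h2; rewrite /B h1 h2 !mul0r addr0.
have M0 : 0 <= 32%:R * t ^+ 2 / L ^+ 2 by rewrite divr_ge0 ?sqr_ge0 // mulr_ge0 ?sqr_ge0 // ler0n.
have fin a' b' : q a' b' = 0 -> (q a' b') ^+ 2 <= 32%:R * t ^+ 2 / L ^+ 2.
  by move=> ->; rewrite expr0n.
(* The removed entry enters the equation of the pair [(a, b)] as [t]; if [a1 = b1] it drops out by
   antisymmetry and [t' = 0]. *)
have [t' tt' kb] : exists2 t', t' ^+ 2 <= t ^+ 2 &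
    q a b - s * t' + s * L * (u * q a b + h * q a c) = 0.
  case: hab => [[ea eb]|eab].
    exists t => //; have := key a b; rewrite ea eb !eqxx Ba Bb ba (negPf ab) !mul1r !mul0r !subr0.
    by [].
  exists 0; first by rewrite expr0n sqr_ge0.
  have := key a b; rewrite eab Ba Bb !eqxx ba !mul1r mul0r subr0 => K; rewrite -[RHS]K; ring.
have kc : q a c + s * L * (u * q a c - h * q a b) = 0.
  have := key a c; rewrite Ba Bc !eqxx ca !mul1r mul0r subr0.
  case: hab => [[-> ->]|->]; first by rewrite cb ca (negPf ab) !mul0r mulr0 mul0r subrr mulr0 subr0.
  by move=> K; rewrite -[RHS]K; ring.
have [Hb Hc] := loop_bound uv s0 L0 kb kc.
have {}Hb : (q a b) ^+ 2 <= 32%:R * t ^+ 2 / L ^+ 2.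
  by apply: (le_trans Hb); rewrite ler_wpM2r ?invr_ge0 ?sqr_ge0 // ler_wpM2l.
have {}Hc : (q a c) ^+ 2 <= 32%:R * t ^+ 2 / L ^+ 2.
  by apply: (le_trans Hc); rewrite ler_wpM2r ?invr_ge0 ?sqr_ge0 // ler_wpM2l.
have Hrow b' : (q a b') ^+ 2 <= 32%:R * t ^+ 2 / L ^+ 2.
  have [->//|nb] := eqVneq b' b; have [->//|nc] := eqVneq b' c.
  have [->|na] := eqVneq b' a; first exact: fin.
  apply: fin; have := key a b'; rewrite Ba (Bo b' nb nc) !mulr0 subr0 mulr0 addr0.
  case: hab => [[-> ->]|-> ].
    by rewrite (negPf nb) (negPf na) mulr0 !mul0r subrr mulr0 subr0.
  by move=> K; rewrite -[RHS]K; ring.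
move=> a' b'; have [->|na] := eqVneq a' a; first exact: Hrow.
have [->|nb] := eqVneq b' a; first by rewrite qa sqrrN.
apply: fin; have := key a' b'; rewrite (negPf na) (negPf nb) !mul0r subrr mulr0 addr0.
case: hab => [[-> ->]|-> ].
  by rewrite (negPf na) (negPf nb) !mul0r subrr mulr0 subr0.
by move=> K; rewrite -[RHS]K; ring.
Qed.
End CurvatureAlgebra.

(** * Surjectivity as positivity on the unit sphere *)

Section Quadratic.
Context {R : realType} {n k : nat}.
Implicit Types (W : 'M[R]_(k, n)) (E : 'I_n -> 'M[R]_(k, n)) (y : 'rV[R]_n).

Definition quad W E y : R :=
  \sum_a ((W *m y^T) a 0) ^+ 2 + \sum_a \sum_b (curv_at W E y^T a b) ^+ 2.

Lemma quad_gt0 W E y :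
  ~ (W *m y^T = 0 /\ forall a b, curv_at W E y^T a b = 0) -> 0 < quad W E y.
Proof.
have ge1 : 0 <= \sum_a ((W *m y^T) a 0) ^+ 2 by apply: sumr_ge0 => a _; exact: sqr_ge0.
have ge2 : 0 <= \sum_a \sum_b (curv_at W E y^T a b) ^+ 2.
  by do 2 (apply: sumr_ge0 => ? _); exact: sqr_ge0.
move=> h; rewrite lt_neqAle addr_ge0 // andbT; apply/negP => /eqP e; apply: h.
move: e => /eqP; rewrite eq_sym paddr_eq0 // => /andP[/eqP e1 /eqP e2]; split.
  apply/matrixP => a j; rewrite ord1 [RHS]mxE; apply/eqP; rewrite -sqrf_eq0.
  have /eqP := e1; rewrite psumr_eq0; last by move=> ? _; exact: sqr_ge0.
  by move=> /allP /(_ a (mem_index_enum _)).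
move=> a b.
have /eqP := e2; rewrite psumr_eq0; last by move=> ? _; apply: sumr_ge0 => ? _; exact: sqr_ge0.
move=> /allP /(_ a (mem_index_enum _)) /=; rewrite psumr_eq0; last by move=> ? _; exact: sqr_ge0.
by move=> /allP /(_ b (mem_index_enum _)) /=; rewrite sqrf_eq0 => /eqP.
Qed.

Definition usphere : set 'rV[R]_n := [set y | \sum_j (y 0 j) ^+ 2 = 1].

Lemma usphere_compact : compact usphere.
Proof.
pose C : set 'rV[R]_n := [set v | forall i, (`[-1, 1]%classic : set R) (v ord0 i)].
have cC : compact C.
  by apply: (@rV_compact R n (fun=> (`[-1, 1]%classic : set R))) => i; exact: segment_compact.
apply: (subclosed_compact _ cC).
  have c : continuous (fun y : 'rV[R]_n => \sum_j (y 0 j) ^+ 2).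
    move=> y; apply: (@cvg_sumr R _ (nbhs y) (nbhs_filter y) R _ _ (fun j (y : 'rV[R]_n) => y 0 j ^+ 2) (fun j => y 0 j ^+ 2)) => j.
    have h := @coord_continuous R 1 n 0 j y.
    rewrite -[y 0 j ^+ 2]/(y 0 j * y 0 j).
    exact: (@cvgM _ _ (nbhs y) (nbhs_filter y) _ _ _ _ h h).
  rewrite -[usphere]/((fun y : 'rV[R]_n => \sum_j (y 0 j) ^+ 2) @^-1` [set 1]).
  apply: preimage_closed; first by move=> y _; exact: c.
  exact: closed_eq.
move=> y hy j /=; rewrite in_itv /= -ler_norml.
have h : (y 0 j) ^+ 2 <= 1.
  have e : \sum_j (y 0 j) ^+ 2 = 1 := hy.
  by rewrite -e (bigD1 j) //= lerDl sumr_ge0 // => i _; exact: sqr_ge0.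
by rewrite -(ler_pXn2r (n := 2)) ?nnegrE // expr1n real_normK ?num_real.
Qed.

(** [quad] is homogeneous of degree two in the covector, so every nonzero covector can be scaled to
    the sphere. *)
Lemma quad_epi W E : (forall y, usphere y -> 0 < quad W E y) -> curv_epi W E.
Proof.
move=> h; apply/curv_epiP => y y0.
pose N := \sum_j (y j 0) ^+ 2.
have N0 : 0 < N.
  rewrite lt_neqAle sumr_ge0 ?andbT; last by move=> ? _; exact: sqr_ge0.
  apply: contra_neq y0 => /eqP; rewrite eq_sym psumr_eq0; last by move=> ? _; exact: sqr_ge0.
  move=> /allP hy; apply/matrixP => i j; rewrite ord1 [RHS]mxE; apply/eqP.
  by rewrite -sqrf_eq0; exact: (hy i (mem_index_enum _)).
have sq : Num.sqrt N ^+ 2 = N by rewrite sqr_sqrtr // ltW.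
pose c := (Num.sqrt N)^-1.
have c2 : c ^+ 2 = N^-1 by rewrite exprVn sq.
have c0 : 0 < c ^+ 2 by rewrite c2 invr_gt0.
have uy : usphere (c *: y^T).
  rewrite /usphere /=; under eq_bigr do rewrite !mxE exprMn.
  by rewrite -mulr_sumr c2 mulVf // gt_eqF.
rewrite -(pmulr_rgt0 _ c0); have := h _ uy; congr (0 < _).
rewrite /quad !linearZ /= trmxK mulrDr; congr (_ + _).
  by rewrite mulr_sumr; apply: eq_bigr => a _; rewrite mxE exprMn.
rewrite mulr_sumr; apply: eq_bigr => a _; rewrite mulr_sumr; apply: eq_bigr => b _.
by rewrite !curv_atE -!scalemxAr !mxE -mulrBr exprMn.
Qed.

Lemma epi_quad W E y : curv_epi W E -> usphere y -> 0 < quad W E y.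
Proof.
move=> /curv_epiP h uy; apply: h; apply/eqP => y0.
have {}y0 : y = 0 by rewrite -[y]trmxK y0 trmx0.
have e : \sum_j (y 0 j) ^+ 2 = 1 := uy.
by move: e; rewrite y0 big1 => [/eqP|i _]; rewrite ?mxE ?expr0n // eq_sym oner_eq0.
Qed.

(** The phase of the oscillation has no limit as the amplitude tends to zero. Replacing cosine and
    sine by an arbitrary point of this compact circle makes the estimates uniform in the phase. *)
Definition ucircle : set (R * R) := [set w | w.1 ^+ 2 + w.2 ^+ 2 = 1].

Lemma ucircle_compact : compact ucircle.
Proof.
have cC := compact_setX (@segment_compact R (-1) 1) (@segment_compact R (-1) 1).
apply: (subclosed_compact _ cC).
  have c : continuous (fun w : R * R => w.1 ^+ 2 + w.2 ^+ 2).
    move=> w; apply: cvgD.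
      by rewrite -[w.1 ^+ 2]/(w.1 * w.1); apply: (@cvgM _ _ (nbhs w)); exact: cvg_fst.
    by rewrite -[w.2 ^+ 2]/(w.2 * w.2); apply: (@cvgM _ _ (nbhs w)); exact: cvg_snd.
  rewrite -[ucircle]/((fun w : R * R => w.1 ^+ 2 + w.2 ^+ 2) @^-1` [set 1]).
  apply: preimage_closed; first by move=> w _; exact: c.
  exact: closed_eq.
have aux (x z : R) : x ^+ 2 + z ^+ 2 = 1 -> `[-1, 1]%classic x.
  move=> e; rewrite /= in_itv /= -ler_norml.
  rewrite -(ler_pXn2r (n := 2)) ?nnegrE // expr1n real_normK ?num_real //.
  by rewrite -e lerDl sqr_ge0.
by move=> [x z] /= e; split=> /=; [exact: aux e|apply: (aux _ x); rewrite addrC].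
Qed.

Lemma sincos_ucircle (t : R) : ucircle (cos t, sin t).
Proof. change (cos t ^+ 2 + sin t ^+ 2 = 1); exact: cos2Dsin2. Qed.

End Quadratic.

(** * Derivatives of oscillating families *)

Section Waves.
Context {R : realType} {n d : nat} {K : manifold_with_boundary R d} {X : set 'rV[R]_n}.
Local Notation Z := (K * R * 'rV[R]_n)%type.

Definition is_dx (W : normedModType R) (f : Z -> W) l z (D : W) :=
  is_derive z.2 (delta_mx 0 l : 'rV[R]_n) (fun x => f (z.1, x)) D.

Lemma is_dxE (W : normedModType R) (f : Z -> W) l z D : is_dx f l z D -> dx f l z = D.
Proof. by case. Qed.

Lemma fam_smooth_is_dx (W : normedModType R) (f : Z -> W) l z : open X -> fam_dom X z ->
  fam_smooth X f z -> is_dx f l z (dx f l z).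
Proof. by move=> oX Dz hf; have [_ h] := fam_smooth_dx l oX Dz hf; split. Qed.

Lemma is_dxD (W : normedModType R) (f g : Z -> W) l z Df Dg :
  is_dx f l z Df -> is_dx g l z Dg -> is_dx (fun y => f y + g y) l z (Df + Dg).
Proof. by move=> hf hg; apply: is_deriveD. Qed.

Lemma is_dx_scale m r (c : Z -> R) (f : Z -> 'M[R]_(m, r)) l z Dc Df :
  is_dx c l z Dc -> is_dx f l z Df ->
  is_dx (fun y => c y *: f y) l z (Dc *: f z + c z *: Df).
Proof.
case: z => w x [dc ec] [df ef]; rewrite /is_dx /= in dc ec df ef *.
have lin : linear (@scalar_mx R m) by move=> a u v; apply/matrixP => i j; rewrite !mxE mulrnDl mulrnAr.
have cts : continuous (@scalar_mx R m).
  move=> t; apply: cvg_mx_entries => i j.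
  have -> : (fun t : R => (t%:M : 'M[R]_m) i j) = (fun t => t *+ (i == j)) by apply/funext => s; rewrite mxE.
  by rewrite mxE; case: (i == j) => /=; [exact: cvg_id|exact: cvg_cst].
have [d1 e1] := is_derive_lin lin cts dc.
have [d2 e2] := is_derive_mulmx d1 df.
have ee : (fun x => c (w, x) *: f (w, x)) = (fun x => (c (w, x))%:M *m f (w, x)).
  by apply/funext => t; rewrite mul_scalar_mx.
by rewrite ee; split=> //; rewrite e2 e1 ec ef !mul_scalar_mx.
Qed.

Lemma is_dx_cst (W : normedModType R) (w : W) l z : is_dx (fun=> w) l z 0.
Proof. exact: is_derive_cst. Qed.

Lemma is_dx_wave (g : R -> R) (dg N : R) j l (z : Z) :
  is_derive (N * z.2 0 j) (1 : R) g dg ->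
  is_dx (fun y => g (N * y.2 0 j)) l z ((l == j)%:R * (N * dg)).
Proof.
case: z => w x /= hg; rewrite /is_dx /=.
have h0 : is_derive (x 0 j) (1 : R) ( *%R N) N.
  have -> : ( *%R N) = (fun t : R => N *: t) by [].
  have h := @is_deriveZ R R R id N (x 0 j) 1 1 (is_derive_id _ _).
  by apply: is_derive_eq h _; rewrite /GRing.scale /= mulr1.
have h1 : is_derive (x 0 j) (1 : R) (fun t => g (N * t)) (N * dg).
  by have := @is_derive1_comp R g ( *%R N) (x 0 j) dg N hg h0; rewrite mulrC.
have [d2 e2] := is_derive_dir ((l == j)%:R) h1.
have q : (fun h : R => h^-1 *: (((fun x => g (N * x 0 j)) \o shift x) (h *: (delta_mx 0 l : 'rV[R]_n)) - g (N * x 0 j)))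
       = (fun h : R => h^-1 *: (((fun t => g (N * t)) \o shift (x 0 j)) (h *: ((l == j)%:R : R)) - g (N * x 0 j))).
  by apply/funext => h /=; rewrite !mxE /= [j == l]eq_sym.
split; first by rewrite /derivable q.
by rewrite /derive q.
Qed.

End Waves.

(** The loop has to amplify the curvature component disturbed by the removal, so [a1 = a] and
    [b1 = b] if these differ. If [a1 = b1] the removal does not disturb the curvature, and any
    triple would serve. *)
Lemma pick_three k (a1 b1 : 'I_k) : (2 < k)%N -> exists a b c : 'I_k,
  [/\ a != b, a != c, b != c & (a1 = a /\ b1 = b) \/ a1 = b1].
Proof.
move=> k3.
have pick (a b : 'I_k) : exists c, c \notin [set a; b]%SET.
  have : (0 < #|~: [set a; b]%SET|)%N.
    by rewrite cardsCs finset.setCK card_ord cards2; case: (a != b); rewrite subn_gt0 // (ltn_trans _ k3).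
  by move=> /card_gt0P[c]; rewrite inE; exists c.
have [e|ne] := eqVneq a1 b1; last first.
  have [c] := pick a1 b1; rewrite !inE negb_or => /andP[ca cb].
  by exists a1, b1, c; rewrite ne eq_sym ca eq_sym cb; split=> //; left.
have [b] := pick a1 a1; rewrite !inE negb_or => /andP[ba _].
have [c] := pick a1 b; rewrite !inE negb_or => /andP[ca cb].
by exists a1, b, c; rewrite eq_sym ba eq_sym ca eq_sym cb; split=> //; right.
Qed.

Lemma wave_algebra (R : realType) m r (A B1 B2 D1 D2 T : 'M[R]_(m, r)) (kp N L dl u h v w : R) :
  kp * N = L ->
  A + (0 *: T + kp *: ((dl * (N * u)) *: B1 + v *: D1 + ((dl * (N * h)) *: B2 + w *: D2))) =
  A + ((dl * L) *: (u *: B1 + h *: B2) + kp *: (v *: D1 + w *: D2)).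
Proof. by move=> <-; apply/matrixP => i j; rewrite !mxE; ring. Qed.

Lemma defect_algebra (R : realType) m r (A B C E F : 'M[R]_(m, r)) (dl L s : R) :
  A + ((dl * L) *: B + C) + (E - A - s *: F) = E - s *: F + dl *: (L *: B) + C.
Proof. by apply/matrixP => i j; rewrite !mxE; ring. Qed.

Section Step.
Context {R : realType} {n d : nat} {K : manifold_with_boundary R d} {X : set 'rV[R]_n}.
Local Notation Z := (K * R * 'rV[R]_n)%type.

Lemma tube_cont_quad (U : topologicalType) k (W : Z * U * R -> 'M[R]_(k, n))
    (E : 'I_n -> Z * U * R -> 'M[R]_(k, n)) (y : Z * U * R -> 'rV[R]_n) z u :
  tube_cont X W z u -> (forall l, tube_cont X (E l) z u) -> tube_cont X y z u ->
  tube_cont X (fun t => quad (W t) (E^~ t) (y t)) z u.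
Proof.
move=> hW hE hy.
have hyT : tube_cont X (fun t => (y t)^T) z u.
  apply: tube_cont_mx => i j; have -> : (fun t => (y t)^T i j) = (fun t => y t j i).
    by apply/funext => t; rewrite mxE.
  exact: tube_cont_entry.
have sq (g : Z * U * R -> R) : tube_cont X g z u -> tube_cont X (fun t => g t ^+ 2) z u.
  by move=> hg; exact: tube_contM.
apply: tube_contD.
  by apply: tube_cont_sum => a; apply: sq; apply: tube_cont_entry; exact: tube_cont_mulmx.
apply: tube_cont_sum => a; apply: tube_cont_sum => b; apply: sq.
have h a' b' : tube_cont X (fun t => \sum_l W t a' l * (E l t *m (y t)^T) b' 0) z u.
  apply: tube_cont_sum => l; apply: tube_contM; first exact: tube_cont_entry.
  by apply: tube_cont_entry; exact: tube_cont_mulmx.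
exact: tube_contD (h a b) (tube_contN (h b a)).
Qed.

Lemma fam_smooth_row m r (i : 'I_m) (A : Z -> 'M[R]_(m, r)) z :
  fam_smooth X A z -> fam_smooth X (fun y => row i (A y)) z.
Proof.
move=> hA; apply: fam_smooth_mx => a j.
apply: fam_smooth_eqA (fam_smooth_entry i j hA) => y _; by rewrite mxE.
Qed.

Variables (k : nat) (f : 'I_k -> 'I_n).

Lemma fam_smooth_along (W : Z -> 'M[R]_(k, n)) (E : 'I_n -> Z -> 'M[R]_(k, n)) a z :
  fam_smooth X W z -> (forall l, fam_smooth X (E l) z) ->
  fam_smooth X (fun y => along (W y) (E^~ y) a) z.
Proof.
move=> hW hE; apply: fam_smooth_sum => l _; apply: fam_smooth_scale => //.
exact: fam_smooth_entry.
Qed.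

Lemma fam_smooth_curv (W : Z -> 'M[R]_(k, n)) (E : 'I_n -> Z -> 'M[R]_(k, n)) a b z :
  fam_smooth X W z -> (forall l, fam_smooth X (E l) z) ->
  fam_smooth X (fun y => curv (W y) (E^~ y) a b) z.
Proof. by move=> hW hE; apply: fam_smoothB; apply: fam_smooth_row; exact: fam_smooth_along. Qed.

Lemma fam_smooth_bump (b c : 'I_k) (w1 w2 : Z -> 'rV[R]_n) z :
  fam_smooth X w1 z -> fam_smooth X w2 z -> fam_smooth X (fun y => bump_mx b c (w1 y) (w2 y)) z.
Proof.
by move=> h1 h2; apply: fam_smoothD; apply: fam_smooth_mulmx => //; exact: fam_smooth_cst.
Qed.

Lemma fam_smooth_kill (W : Z -> 'M[R]_(k, n)) (E : 'I_n -> Z -> 'M[R]_(k, n)) a b l z :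
  fam_smooth X W z -> (forall l, fam_smooth X (E l) z) ->
  fam_smooth X (fun y => kill f (W y) a b (E^~ y) l) z.
Proof.
move=> hW hE; apply: fam_smoothD; first apply: fam_smoothB => //.
  apply: fam_smooth_sum => a' _; apply: fam_smooth_scale; first exact: fam_smooth_cst.
  exact: fam_smooth_along.
apply: fam_smooth_scale; first exact: fam_smooth_cst.
by apply: fam_smooth_mulmx; [exact: fam_smooth_cst|exact: fam_smooth_along].
Qed.

Lemma colsub_along (W : 'M[R]_(k, n)) (E : 'I_n -> 'M[R]_(k, n)) a :
  (forall l, colsub f (E l) = 0) -> colsub f (along W E a) = 0.
Proof.
move=> h; apply/matrixP => i j; rewrite !mxE summxE big1 // => l _.
by have /matrixP/(_ i j) := h l; rewrite !mxE => ->; rewrite mulr0.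
Qed.

Lemma colsub_kill (W : 'M[R]_(k, n)) (E : 'I_n -> 'M[R]_(k, n)) a b l :
  (forall l, colsub f (E l) = 0) -> colsub f (kill f W a b E l) = 0.
Proof.
move=> h; have hc c i j : along W E c i (f j) = 0.
  by have /matrixP/(_ i j) := colsub_along W c h; rewrite !mxE.
apply/matrixP => i j; rewrite !mxE summxE [X in _ - X]big1 => [|c _]; last by rewrite mxE hc mulr0.
have /matrixP/(_ i j) := h l; rewrite !mxE => ->.
by rewrite big1 ?mulr0 ?subr0 ?addr0 // => c _; rewrite hc mulr0.
Qed.

Variables (Rg : set Z) (oX : open X).
Hypothesis RgD : Rg `<=` fam_dom X.
Hypothesis Rgo : forall z, Rg z -> \forall y \near z, fam_dom X y -> Rg y.

Lemma Rg_line z : Rg z -> \forall x \near z.2, Rg (z.1, x).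
Proof.
move=> Rz; have [hs Xx] := RgD Rz.
have h1 : \forall x \near z.2, X x by apply: open_nbhs_nbhs; split.
have h2 : \forall x \near z.2, fam_dom X (z.1, x) -> Rg (z.1, x).
  have c : (z.1, x) @[x --> z.2] --> z.
    rewrite [X in _ --> X]surjective_pairing.
    have c1 : (fun x : 'rV[R]_n => z.1) x @[x --> z.2] --> z.1.
      exact: (@cvg_cst _ z.1 _ _ (nbhs_filter z.2)).
    have c2 : (fun x : 'rV[R]_n => x) x @[x --> z.2] --> z.2 by exact: cvg_id.
    exact: (cvg_pair c1 c2).
  exact: (c _ (Rgo Rz)).
by apply: (@filterS2 _ _ (nbhs_filter z.2) _ _ _ _ h1 h2) => x hX; apply; split.
Qed.

(* E lists the formal derivatives of the frame W, which is holonomic where the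
   defect vanishes. *)
Definition defect (W : Z -> 'M[R]_(k, n)) (E : 'I_n -> Z -> 'M[R]_(k, n)) z l :=
  E l z - dx W l z.

Definition formal_frame (W : Z -> 'M[R]_(k, n)) (E : 'I_n -> Z -> 'M[R]_(k, n)) : Prop :=
  forall z, Rg z ->
  [/\ fam_smooth X W z, forall l, fam_smooth X (E l) z, normalized f (W z),
      forall l, colsub f (E l z) = 0 & curv_epi (W z) (E^~ z)].

Lemma colsub_dx (W : Z -> 'M[R]_(k, n)) (C : 'M[R]_k) z l :
  Rg z -> fam_smooth X W z -> (forall y, Rg y -> colsub f (W y) = C) ->
  colsub f (dx W l z) = 0.
Proof.
move=> Rz hW hC; have [dW eW] := fam_smooth_is_dx l oX (RgD Rz) hW.
have [_ <-] := derive_mxsub id f dW.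
rewrite -[RHS](@derive_cst R 'rV[R]_n _ C z.2 (delta_mx 0 l)).
apply: near_derive; move: (Rg_line Rz); apply: filterS => x Rx.
exact: hC.
Qed.

(** [V] is an open condition on the frame that the step must keep, [sigma] the fraction of the
    defect to remove, and [S] a compact set off which [sigma] vanishes locally in the slices. *)
Variables (V : Z -> 'M[R]_(k, n) -> Prop) (sigma : Z -> R) (S : set Z).
Hypothesis (cS : compact S) (SRg : S `<=` Rg).
Hypothesis Vo : forall z, S z -> forall B, V z B ->
  \forall t \near (z, B), fam_dom X t.1 -> V t.1 t.2.
Hypothesis sigma_smooth : forall z, Rg z -> fam_smooth X sigma z.
Hypothesis sigma_ge0 : forall z, 0 <= sigma z.
Hypothesis sigma_out : forall z, Rg z -> ~ S z -> \forall x \near z.2, sigma (z.1, x) = 0.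

(* W oscillates in the coordinate f a, with amplitude kp and frequency L / kp:
   as kp -> 0 this leaves W alone but adds the loop of loop_avoids to the
   curvature, and L is chosen so large that the curvature stays epi while the
   component (a1, b1) of the defect is removed. *)
Lemma convex_integration_step (a1 b1 : 'I_k) W E : (2 < k)%N -> formal_frame W E ->
  (forall z, Rg z -> V z (W z)) ->
  exists W' E', [/\ formal_frame W' E', forall z, Rg z -> V z (W' z),
    forall z l, Rg z -> defect W' E' z l =
       defect W E z l - sigma z *: kill f (W z) a1 b1 (defect W E z) l &
    forall z, Rg z -> (\forall x \near z.2, sigma (z.1, x) = 0) ->
      W' z = W z /\ forall l, E' l z = E l z].
Proof.
move=> k3 FF VW.
have [a [b [c [ab ac bc hab]]]] := pick_three a1 b1 k3.
pose e z l : 'M[R]_(k, n) := defect W E z l.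
have sW z : Rg z -> fam_smooth X W z by case/FF.
have sE z l : Rg z -> fam_smooth X (E l) z by case/FF.
have nW z : Rg z -> normalized f (W z) by case/FF.
have nE z l : Rg z -> colsub f (E l z) = 0 by case/FF.
have sdW z l : Rg z -> fam_smooth X (dx W l) z.
  by move=> Rz; have [] := fam_smooth_dx l oX (RgD Rz) (sW z Rz).
have se z l : Rg z -> fam_smooth X (fun y => e y l) z.
  by move=> Rz; apply: fam_smoothB; [exact: sE|exact: sdW].
have ne z l : Rg z -> colsub f (e z l) = 0.
  move=> Rz; rewrite /e /defect; apply/matrixP => i j; rewrite !mxE.
  have /matrixP/(_ i j) := nE z l Rz; rewrite !mxE => ->.
  have /matrixP/(_ i j) := colsub_dx l Rz (sW z Rz) nW; rewrite !mxE => ->.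
  by rewrite subr0.
pose w1 z := curv (W z) (E^~ z) a b; pose w2 z := curv (W z) (E^~ z) a c.
(* [U2] carries the pair [(w2, - w1)], so that [u U1 + h U2] corresponds to [sigma] times
   [(u + i h) (w1 - i w2)]: the loop acts by complex multiplication. *)
pose U1 z : 'M[R]_(k, n) := sigma z *: bump_mx b c (w1 z) (w2 z).
pose U2 z : 'M[R]_(k, n) := sigma z *: bump_mx b c (w2 z) (- w1 z).
have sw a' b' z : Rg z -> fam_smooth X (fun y => curv (W y) (E^~ y) a' b') z.
  by move=> Rz; apply: fam_smooth_curv => // *; [exact: sW|exact: sE].
have sU1 z : Rg z -> fam_smooth X U1 z.
  move=> Rz; apply: fam_smooth_scale; first exact: sigma_smooth.
  by apply: fam_smooth_bump; exact: sw.
have sU2 z : Rg z -> fam_smooth X U2 z.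
  move=> Rz; apply: fam_smooth_scale; first exact: sigma_smooth.
  apply: fam_smooth_bump; first exact: sw.
  have h := fam_smooth_scale (@fam_smooth_cst _ _ _ K X _ (-1 : R) z) (sw a b z Rz).
  by apply: fam_smooth_eqA h => y _; rewrite scaleN1r.
have nw a' b' z : Rg z -> forall j, curv (W z) (E^~ z) a' b' 0 (f j) = 0.
  move=> Rz j; rewrite curvE !mxE.
  have h c' : colsub f (along (W z) (E^~ z) c') = 0 by apply: colsub_along => l; exact: nE.
  have /matrixP/(_ b' j) := h a'; rewrite !mxE => ->.
  by have /matrixP/(_ a' j) := h b'; rewrite !mxE => ->; rewrite subr0.
have nbump z (x1 x2 : 'rV[R]_n) : (forall j, x1 0 (f j) = 0) -> (forall j, x2 0 (f j) = 0) ->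
    colsub f (sigma z *: bump_mx b c x1 x2) = 0.
  move=> h1 h2; apply/matrixP => i j; rewrite !mxE !big_ord1 h1 h2.
  by rewrite !mulr0 addr0 mulr0.
have nU1 z : Rg z -> colsub f (U1 z) = 0 by move=> Rz; apply: nbump => j; exact: nw.
have nU2 z : Rg z -> colsub f (U2 z) = 0.
  by move=> Rz; apply: nbump => j; [exact: nw|rewrite mxE /w1 nw ?oppr0].
pose T z l : 'M[R]_(k, n) := E l z - sigma z *: kill f (W z) a1 b1 (e z) l.
have sT z l : Rg z -> fam_smooth X (T^~ l) z.
  move=> Rz; apply: fam_smoothB; first exact: sE.
  apply: fam_smooth_scale; first exact: sigma_smooth.
  by apply: fam_smooth_kill => [|l']; [exact: sW|exact: se].
pose tau z (y : 'rV[R]_n) : R := (along (W z) (e z) a1 *m y^T) b1 0.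
(* [quad] is positive and [tau], the entry to be removed paired with a covector, is bounded on a
   compact set. The strict inequality is clear at [m = 0]; [tube] spreads it to small [m], and half
   of the bound found serves as [mu]. *)
have [mu mu0 Hmu] : exists2 mu : R, 0 < mu &
    forall z y, S z -> usphere y -> mu * tau z y ^+ 2 < quad (W z) (E^~ z) y.
  have [m m0 Hm] : exists2 e : R, 0 < e & forall m, `|m| < e -> forall z y, S z -> usphere y ->
      m * tau z y ^+ 2 < quad (W z) (E^~ z) y.
    apply: (@tube _ _ _ K X 'rV[R]_n usphere S
      (fun m t => m * tau t.1 t.2 ^+ 2 < quad (W t.1) (E^~ t.1) t.2) cS usphere_compact
      (subset_trans SRg RgD)).
    move=> z y Sz uy; have Rz := SRg Sz; have Dz := RgD Rz.
    pose G (t : Z * 'rV[R]_n * R) := quad (W t.1.1) (E^~ t.1.1) t.1.2 - t.2 * tau t.1.1 t.1.2 ^+ 2.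
    have cy : tube_cont X (fun t : Z * 'rV[R]_n * R => t.1.2) z y.
      by apply: (@tube_cont_u _ _ _ K X _ _ id); exact: cvg_id.
    have cy' : tube_cont X (fun t : Z * 'rV[R]_n * R => (t.1.2)^T) z y.
      apply: tube_cont_mx => i j.
      have -> : (fun t : Z * 'rV[R]_n * R => (t.1.2)^T i j) = (fun t => t.1.2 j i).
        by apply/funext => t; rewrite mxE.
      exact: tube_cont_entry.
    have ct : tube_cont X (fun t : Z * 'rV[R]_n * R => tau t.1.1 t.1.2) z y.
      apply: tube_cont_entry; apply: tube_cont_mulmx => //.
      apply: (tube_cont_fam (f := fun z => along (W z) (e z) a1)) => //.
      by apply: fam_smooth_along => [|l]; [exact: sW|exact: se].
    have cG : tube_cont X G z y.
      apply: tube_contD.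
        apply: tube_cont_quad => // [|l]; first exact: tube_cont_fam (sW z Rz).
        exact: tube_cont_fam (sE z l Rz).
      apply: tube_contN; apply: tube_contM; first exact: tube_cont_k.
      exact: tube_contM.
    have G0 : 0 < G (z, y, 0) by rewrite /G /= mul0r subr0; apply: epi_quad => //; case/FF: Rz.
    have := tube_gt0 Dz cG G0; apply: filterS => t h /h.
    by rewrite /G subr_gt0.
  exists (m / 2); first by rewrite divr_gt0.
  move=> z y Sz uy; apply: (Hm (m / 2)) => //.
  by rewrite ger0_norm ?divr_ge0 ?ltW // ltr_pdivrMr // ltr_pMr // ltr1n.
(* If a covector killed plane and curvature after the step, [step_bound] would make the sum of the
   [k * k] squares at most [32 k^2 tau^2 / L^2], hence at most [mu tau^2], against the choice of
   [mu]. The summand [1] ensures [L <= L ^+ 2]. *)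
pose L : R := 32%:R * (k * k)%:R / mu + 1.
have L1 : 1 <= L by rewrite /L lerDr divr_ge0 ?mulr_ge0 // ltW.
have L0 : 0 < L by rewrite (lt_le_trans _ L1).
have LL : 32%:R * (k * k)%:R <= mu * L ^+ 2.
  have : L <= L ^+ 2 by rewrite ler_eXnr // ltnW.
  have : 32%:R * (k * k)%:R / mu <= L by rewrite /L lerDl.
  rewrite ler_pdivrMr // => h1 h2; apply: (le_trans h1); rewrite mulrC.
  by rewrite ler_pM2l.
pose h (u v : R) := u + (u ^+ 2 - v ^+ 2) / 2.
(* [E0] is the limit of the formal derivatives as [kp] tends to [0], with [(u, v)] standing for
   cosine and sine of the phase. In [Wt] the factors [v] and [v + v * u / 2] are the primitives of
   [u] and [h]; that they are functions on the circle expresses mean zero. *)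
pose E0 z u v l : 'M[R]_(k, n) := T z l + (l == f a)%:R *: (L *: (u *: U1 z + h u v *: U2 z)).
pose Wt z u v kp : 'M[R]_(k, n) := W z + kp *: (v *: U1 z + (v + v * u / 2) *: U2 z).
pose Et z u v kp l : 'M[R]_(k, n) := E0 z u v l + kp *: (v *: dx U1 l z + (v + v * u / 2) *: dx U2 l z).
have sdU (U : Z -> 'M[R]_(k, n)) l z : Rg z -> fam_smooth X U z -> fam_smooth X (dx U l) z.
  by move=> Rz hU; have [] := fam_smooth_dx l oX (RgD Rz) hU.
have cWt (Q : topologicalType) (pu pv : Q -> R) z q : Rg z -> {for q, continuous pu} -> {for q, continuous pv} ->
    tube_cont X (fun t => Wt t.1.1 (pu t.1.2) (pv t.1.2) t.2) z q.
  move=> Rz cu cv; have Dz := RgD Rz.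
  have tu := @tube_cont_u _ _ _ K X _ _ pu z q cu.
  have tv := @tube_cont_u _ _ _ K X _ _ pv z q cv.
  apply: tube_contD; first exact: tube_cont_fam (sW z Rz).
  apply: tube_cont_scale; first exact: tube_cont_k.
  apply: tube_contD; apply: tube_cont_scale => //.
  - exact: tube_cont_fam (sU1 z Rz).
  - apply: tube_contD => //; apply: tube_contM; last exact: tube_cont_cst.
    exact: tube_contM.
  - exact: tube_cont_fam (sU2 z Rz).
have cEt (Q : topologicalType) (pu pv : Q -> R) z q l : Rg z -> {for q, continuous pu} -> {for q, continuous pv} ->
    tube_cont X (fun t => Et t.1.1 (pu t.1.2) (pv t.1.2) t.2 l) z q.
  move=> Rz cu cv; have Dz := RgD Rz.
  have tu := @tube_cont_u _ _ _ K X _ _ pu z q cu.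
  have tv := @tube_cont_u _ _ _ K X _ _ pv z q cv.
  have t2 := tube_contM tu tu; have t3 := tube_contM tv tv; have t4 := tube_contM tv tu.
  have chalf := @tube_cont_cst _ _ _ K X Q R (2^-1) z q.
  apply: tube_contD; first apply: tube_contD.
  - exact: (@tube_cont_fam R n d K X Q 'M[R]_(k, n) (T^~ l) z q Dz (sT z l Rz)).
  - apply: tube_cont_scale; first exact: tube_cont_cst.
    apply: tube_cont_scale; first exact: tube_cont_cst.
    apply: tube_contD; apply: tube_cont_scale => //.
    + exact: tube_cont_fam (sU1 z Rz).
    + apply: tube_contD => //; apply: tube_contM => //.
      exact: tube_contD t2 (tube_contN t3).
    + exact: tube_cont_fam (sU2 z Rz).
  - apply: tube_cont_scale; first exact: tube_cont_k.
    apply: tube_contD; apply: tube_cont_scale => //.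
    + exact: tube_cont_fam (sdU U1 l z Rz (sU1 z Rz)).
    + by apply: tube_contD => //; apply: tube_contM.
    + exact: tube_cont_fam (sdU U2 l z Rz (sU2 z Rz)).
(* Surjectivity is proved at [kp = 0] for every point of the circle and spread to small [kp] by
   compactness. *)
have [k1 k10 Hk1] : exists2 e : R, 0 < e & forall kp, `|kp| < e ->
    forall z q, S z -> (ucircle `*` usphere) q -> 0 < quad (Wt z q.1.1 q.1.2 kp) (Et z q.1.1 q.1.2 kp) q.2.
  apply: (@tube _ _ _ K X (R * R * 'rV[R]_n)%type (ucircle `*` usphere) S
    (fun kp t => 0 < quad (Wt t.1 t.2.1.1 t.2.1.2 kp) (Et t.1 t.2.1.1 t.2.1.2 kp) t.2.2)) => //.
  - by apply: compact_setX; [exact: ucircle_compact|exact: usphere_compact].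
  - exact: subset_trans RgD.
  move=> z [[u v] y] Sz [/= cuv uy]; have Rz := SRg Sz; have Dz := RgD Rz.
  apply: (tube_gt0 (G := fun t => quad (Wt t.1.1 t.1.2.1.1 t.1.2.1.2 t.2) (Et t.1.1 t.1.2.1.1 t.1.2.1.2 t.2) t.1.2.2)) => //.
    have cu : {for (u, v, y), continuous (fun q : R * R * 'rV[R]_n => q.1.1)} by exact: cvg_fst_fst.
    have cv : {for (u, v, y), continuous (fun q : R * R * 'rV[R]_n => q.1.2)} by exact: cvg_snd_fst.
    apply: tube_cont_quad => [|l|].
    - exact: (cWt _ _ _ _ _ Rz cu cv).
    - exact: (cEt _ _ _ _ _ l Rz cu cv).
    - by apply: (@tube_cont_u _ _ _ K X _ _ snd); exact: cvg_snd.
  rewrite /=; apply: quad_gt0; rewrite /Wt scale0r addr0 => -[Wy cy].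
  have cuv' : u ^+ 2 + v ^+ 2 = 1 := cuv.
  have EE : Et z u v 0 = E0 z u v by apply/funext => l; rewrite /Et scale0r addr0.
  rewrite EE in cy.
  have B := step_bound (nW z Rz) ab ac bc hab cuv' (sigma_ge0 z) L0 cy.
  have := Hmu z y Sz uy; rewrite /quad big1 ?add0r; last by move=> a' _; rewrite Wy mxE expr0n.
  apply/negP; rewrite -leNgt.
  apply: (@le_trans _ _ (\sum_(a' < k) \sum_(b' < k) (32%:R * tau z y ^+ 2 / L ^+ 2))).
    by apply: ler_sum => a' _; apply: ler_sum => b' _; exact: B.
  rewrite !sumr_const card_ord -mulrnA -[_ *+ (k * k)]mulr_natr.
  have L20 : 0 < L ^+ 2 by rewrite exprn_gt0.
  rewrite mulrAC ler_pdivrMr //.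
  have -> : 32%:R * tau z y ^+ 2 * (k * k)%:R = 32%:R * (k * k)%:R * tau z y ^+ 2 by ring.
  have -> : mu * tau z y ^+ 2 * L ^+ 2 = mu * L ^+ 2 * tau z y ^+ 2 by ring.
  by rewrite ler_wpM2r ?sqr_ge0.
have [k2 k20 Hk2] : exists2 e : R, 0 < e & forall kp, `|kp| < e ->
    forall z q, S z -> ucircle q -> V z (Wt z q.1 q.2 kp).
  apply: (@tube _ _ _ K X (R * R)%type ucircle S
    (fun kp t => V t.1 (Wt t.1 t.2.1 t.2.2 kp))) => //.
  - exact: ucircle_compact.
  - exact: subset_trans RgD.
  move=> z [u v] Sz cuv; have Rz := SRg Sz; have Dz := RgD Rz.
  have cu : {for (u, v), continuous (@fst R R)} by exact: cvg_fst.
  have cv : {for (u, v), continuous (@snd R R)} by exact: cvg_snd.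
  have cc := cWt _ _ _ _ _ Rz cu cv.
  have Vz := Vo Sz (VW z Rz).
  have e0 : Wt z u v 0 = W z by rewrite /Wt scale0r addr0.
  have cp : (t.1.1, Wt t.1.1 t.1.2.1 t.1.2.2 t.2) @[t --> within [set t | fam_dom X t.1.1] (nbhs (z, (u, v), 0 : R))]
      --> (z, W z).
    apply: (@cvg_pair _ _ _ _ (nbhs z) (nbhs (W z))).
      apply: cvg_within_filter.
      by apply: (cvg_comp _ _ (@cvg_fst _ _ (nbhs (z, (u, v))) (nbhs (0 : R)) _)); exact: cvg_fst.
    by rewrite -e0; exact: cc.
  have hh : \forall t \near (z, (u, v), 0 : R), fam_dom X t.1.1 ->
      (fam_dom X t.1.1 -> V t.1.1 (Wt t.1.1 t.1.2.1 t.1.2.2 t.2)) := cp _ Vz.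
  by apply: filterS hh => t ht Dt; exact: ht.
pose kp := Num.min k1 k2 / 2.
have kp0 : 0 < kp by rewrite divr_gt0 // lt_min k10 k20.
have kpm : `|kp| < Num.min k1 k2.
  by rewrite gtr0_norm // ltr_pdivrMr // ltr_pMr ?ltr1n // lt_min k10 k20.
have kp1 : `|kp| < k1 by apply: (lt_le_trans kpm); rewrite ge_min lexx.
have kp2 : `|kp| < k2 by apply: (lt_le_trans kpm); rewrite ge_min lexx orbT.
pose N := L / kp.
pose ph (z : Z) := N * z.2 0 (f a).
pose W' z := Wt z (cos (ph z)) (sin (ph z)) kp.
(* The new formal derivatives are the true ones of [W'] plus the defect that is to remain, so the
   formula for the new defect holds by construction; [E'E] then identifies them with [Et], for which
   surjectivity is known. *)
pose E' l z := dx W' l z + (e z l - sigma z *: kill f (W z) a1 b1 (e z) l).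
have dW' z l : Rg z -> is_dx W' l z (dx W l z + (((l == f a)%:R * L) *: (cos (ph z) *: U1 z + h (cos (ph z)) (sin (ph z)) *: U2 z)
     + kp *: (sin (ph z) *: dx U1 l z + (sin (ph z) + sin (ph z) * cos (ph z) / 2) *: dx U2 l z))).
  move=> Rz; have Dz := RgD Rz.
  have d1 := fam_smooth_is_dx l oX Dz (sU1 z Rz).
  have d2 := fam_smooth_is_dx l oX Dz (sU2 z Rz).
  have d0 := fam_smooth_is_dx l oX Dz (sW z Rz).
  have ds := @is_dx_wave R n d K sin (cos (ph z)) N (f a) l z (is_derive_sin (ph z)).
  have dbb : is_derive (N * z.2 0 (f a)) (1 : R) (fun t => sin t + sin t * cos t / 2) (h (cos (ph z)) (sin (ph z))).
    have p1 := is_derive_sin (ph z); have p2 := is_derive_cos (ph z).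
    have q3 := is_deriveD p1 (is_deriveZ (2^-1) (is_deriveM p1 p2)).
    have -> : (fun t : R => sin t + sin t * cos t / 2) = (sin + (2^-1 \*: (sin * cos))).
      by apply/funext => t; rewrite /= mulrC.
    apply: is_derive_eq q3 _; rewrite /h /GRing.scale /=; ring.
  have db := @is_dx_wave R n d K _ _ N (f a) l z dbb.
  have D := is_dxD d0 (is_dx_scale (is_dx_cst kp l z) (is_dxD (is_dx_scale ds d1) (is_dx_scale db d2))).
  apply: is_derive_eq D _.
  have kN : kp * N = L by rewrite /N mulrC divfK // gt_eqF.
  exact: wave_algebra.
have loc z : (\forall x \near z.2, sigma (z.1, x) = 0) -> W' z = W z /\ forall l, E' l z = E l z.
  move=> hs; have WW y : sigma y = 0 -> W' y = W y.
    by move=> s0; rewrite /W' /Wt /U1 /U2 s0 !scale0r !scaler0 addr0 scaler0 addr0.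
  have s0 : sigma z = 0 by have := nbhs_singleton hs; rewrite -surjective_pairing.
  split; first exact: WW.
  move=> l; rewrite /E' s0 scale0r subr0 /e /defect.
  have -> : dx W' l z = dx W l z.
    apply: near_derive; apply: filterS hs => x; exact: WW.
  by rewrite addrC subrK.
have E'E z : Rg z -> E'^~ z = Et z (cos (ph z)) (sin (ph z)) kp.
  move=> Rz; apply/funext => l; rewrite /E' (is_dxE (dW' z l Rz)) /Et /E0 /T /e /defect.
  exact: defect_algebra.
have sph z : Rg z -> fam_smooth X ph z.
  by move=> Rz; apply: fam_smoothM; [exact: fam_smooth_cst|exact: fam_smooth_x].
have ssin z : Rg z -> fam_smooth X (fun z => sin (ph z)) z.
  by move=> Rz; apply: (fam_smooth_fun1 (RgD Rz)) (sph z Rz) => r; case: (@Cr_on_sincos R r).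
have scos z : Rg z -> fam_smooth X (fun z => cos (ph z)) z.
  by move=> Rz; apply: (fam_smooth_fun1 (RgD Rz)) (sph z Rz) => r; case: (@Cr_on_sincos R r).
have sW' z : Rg z -> fam_smooth X W' z.
  move=> Rz; apply: fam_smoothD; first exact: sW.
  apply: fam_smooth_scale; first exact: fam_smooth_cst.
  apply: fam_smoothD; apply: fam_smooth_scale; [exact: ssin|exact: sU1| |exact: sU2].
  apply: fam_smoothD; first exact: ssin.
  apply: fam_smoothM; last exact: fam_smooth_cst.
  by apply: fam_smoothM; [exact: ssin|exact: scos].
have nW' z : Rg z -> colsub f (W' z) = 1%:M.
  move=> Rz; apply/matrixP => i j.
  have /matrixP/(_ i j) := nW z Rz; rewrite !mxE => <-.
  have /matrixP/(_ i j) := nU1 z Rz; have /matrixP/(_ i j) := nU2 z Rz.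
  by rewrite !mxE => -> ->; rewrite !mulr0 !addr0 mulr0 addr0.
have out z : Rg z -> ~ S z -> W' z = W z /\ E'^~ z = E^~ z.
  by move=> Rz Sz; have [-> hE] := loc z (sigma_out Rz Sz); split=> //; apply/funext.
exists W', E'; split.
- move=> z Rz; have Dz := RgD Rz; split.
  + exact: sW'.
  + move=> l; apply: fam_smoothD; first by have [] := fam_smooth_dx l oX Dz (sW' z Rz).
    apply: fam_smoothB; first exact: se.
    apply: fam_smooth_scale; first exact: sigma_smooth.
    by apply: fam_smooth_kill => [|l']; [exact: sW|exact: se].
  + exact: nW'.
  + have cs (A B C : 'M[R]_(k, n)) (s : R) : colsub f A = 0 -> colsub f B = 0 -> colsub f C = 0 ->
        colsub f (A + (B - s *: C)) = 0.
      move=> /matrixP hA /matrixP hB /matrixP hC; apply/matrixP => i j.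
      move: (hA i j) (hB i j) (hC i j); rewrite !mxE => -> -> ->.
      by rewrite mulr0 subr0 addr0.
    move=> l; apply: cs; first exact: colsub_dx Rz (sW' z Rz) nW'.
      exact: ne.
    by apply: colsub_kill => l'; exact: ne.
  + have [Sz|Sz] := pselect (S z).
      apply: quad_epi => y uy; rewrite E'E //.
      by apply: (Hk1 kp kp1 z (cos (ph z), sin (ph z), y) Sz); split=> //=; exact: sincos_ucircle.
    by have [-> ->] := out z Rz Sz; case/FF: Rz.
- move=> z Rz; have [Sz|Sz] := pselect (S z).
    by apply: (Hk2 kp kp2 z (cos (ph z), sin (ph z)) Sz); exact: sincos_ucircle.
  by have [-> _] := out z Rz Sz; exact: VW.
- by move=> z l Rz; rewrite [LHS]/defect /E' addrC addrA addNr add0r.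
- by move=> z Rz; exact: loc.
Qed.
End Step.

Section FrameStage.
Context {R : realType} {n d : nat} {K : manifold_with_boundary R d} {X : set 'rV[R]_n}.
Local Notation Z := (K * R * 'rV[R]_n)%type.
Variables (k : nat) (f : 'I_k -> 'I_n).

Lemma along_sum_delta (W : 'M[R]_(k, n)) (B : 'I_k -> 'M[R]_(k, n)) a : normalized f W ->
  along W (fun l => \sum_c (l == f c)%:R *: B c) a = B a.
Proof.
move=> nW; rewrite /along; under eq_bigr do rewrite scaler_sumr.
rewrite exchange_big /= (bigD1 a) //= [X in _ + X]big1 ?addr0; last first.
  move=> c ca; rewrite -[LHS]/(along W (fun l => (l == f c)%:R *: B c) a).
  by rewrite along_delta // eq_sym (negPf ca) scale0r.
by rewrite -[LHS]/(along W (fun l => (l == f a)%:R *: B a) a) along_delta // eqxx scale1r.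
Qed.

Variables (Rg : set Z) (oX : open X).
Hypothesis RgD : Rg `<=` fam_dom X.
Hypothesis Rgo : forall z, Rg z -> \forall y \near z, fam_dom X y -> Rg y.
Variables (V : Z -> 'M[R]_(k, n) -> Prop) (sigma : Z -> R) (S : set Z).
Hypothesis (cS : compact S) (SRg : S `<=` Rg).
Hypothesis Vo : forall z, S z -> forall B, V z B ->
  \forall t \near (z, B), fam_dom X t.1 -> V t.1 t.2.
Hypothesis sigma_smooth : forall z, Rg z -> fam_smooth X sigma z.
Hypothesis sigma_ge0 : forall z, 0 <= sigma z.
Hypothesis sigma_out : forall z, Rg z -> ~ S z -> \forall x \near z.2, sigma (z.1, x) = 0.

Lemma kill0 (W : 'M[R]_(k, n)) (E : 'I_n -> 'M[R]_(k, n)) a b l :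
  (forall l, E l = 0) -> kill f W a b E l = 0.
Proof.
move=> h; have h0 c : along W E c = 0 by rewrite /along big1 // => j _; rewrite h scaler0.
rewrite /kill h h0 mulmx0 scaler0 addr0 big1 ?subr0 // => c _; by rewrite h0 scaler0.
Qed.

(** The step is repeated over all entries [(a, b)]. Where [sigma = 1], each step clears its own
    entry and restores none of those cleared earlier. *)
Lemma frame_stage W E : (2 < k)%N -> formal_frame (X := X) f Rg W E ->
  (forall z, Rg z -> V z (W z)) ->
  exists W' E', [/\ formal_frame (X := X) f Rg W' E', forall z, Rg z -> V z (W' z),
    forall z, Rg z -> sigma z = 1 -> forall l, defect W' E' z l = 0,
    forall z, Rg z -> (forall l, defect W E z l = 0) -> forall l, defect W' E' z l = 0 &
    forall z, Rg z -> (\forall x \near z.2, sigma (z.1, x) = 0) ->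
      W' z = W z /\ forall l, E' l z = E l z].
Proof.
move=> k3 FF VW.
(* The first clause excludes the empty list: before any step the defect may have a part that
   vanishes on the plane, and the first step removes it. *)
pose inv (s : seq ('I_k * 'I_k)) W' E' := forall z, Rg z -> sigma z = 1 ->
  (s != [::] -> forall l, defect W' E' z l =
     \sum_a (l == f a)%:R *: along (W' z) (defect W' E' z) a) /\
  forall ab, ab \in s -> row ab.2 (along (W' z) (defect W' E' z) ab.1) = 0.
have main s : exists W' E', [/\ formal_frame (X := X) f Rg W' E', forall z, Rg z -> V z (W' z),
    inv s W' E',
    forall z, Rg z -> (forall l, defect W E z l = 0) -> forall l, defect W' E' z l = 0 &
    forall z, Rg z -> (\forall x \near z.2, sigma (z.1, x) = 0) ->
      W' z = W z /\ forall l, E' l z = E l z].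
  elim: s => [|[a1 b1] s [W1 [E1 [F1 V1 I1 D1 L1]]]].
    by exists W, E; split=> //; move=> z Rz s1; split.
  have [W' [E' [F' V' D' L']]] := convex_integration_step oX RgD Rgo cS SRg Vo
    sigma_smooth sigma_ge0 sigma_out a1 b1 k3 F1 V1.
  exists W', E'; split; [exact: F'|exact: V'| | |].
  - move=> z Rz s1; have [_ I1s] := I1 z Rz s1.
    pose B a : 'M[R]_(k, n) := along (W1 z) (defect W1 E1 z) a - (a == a1)%:R *:
      (delta_mx b1 b1 *m along (W1 z) (defect W1 E1 z) a1).
    have [_ _ nW' _ _] := F' z Rz.
    have e' l : defect W' E' z l = \sum_a (l == f a)%:R *: B a.
      rewrite D' // s1 scale1r /kill.
      have sub (A0 A2 A3 : 'M[R]_(k, n)) : A0 - (A0 - A2 + A3) = A2 - A3.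
        by apply/matrixP => i j; rewrite !mxE; ring.
      rewrite sub /B; under [in RHS]eq_bigr do rewrite scalerBr.
      rewrite sumrB; congr (_ - _).
      rewrite (bigD1 a1) //= eqxx scale1r big1 ?addr0 // => a /negPf aa.
      by rewrite aa scale0r scaler0.
    (* The components of the defect in the directions of the new frame [W'] are those computed with
       [W1], since the defect is now a combination of the covectors [f a] and [W'] is normalised as
       well. *)
    have al a : along (W' z) (defect W' E' z) a = B a.
      by rewrite -(along_sum_delta B a nW'); congr along; apply/funext.
    split; first by move=> _ l; rewrite e'; apply: eq_bigr => a _; rewrite al.
    move=> [a b] /=; rewrite inE al /B linearB linearZ /= row_delta_mul => /predU1P[[-> ->]|abs].
      by rewrite !eqxx !scale1r subrr.
    have e0 := I1s _ abs; rewrite /= in e0; rewrite e0 sub0r.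
    have [ea|_] := eqVneq a a1; last by rewrite scale0r oppr0.
    have [eb|_] := eqVneq b b1; last by rewrite scale0r scaler0 oppr0.
    by rewrite -ea -eb e0 !scaler0 oppr0.
  - move=> z Rz hd l; rewrite D' // (kill0 _ _ _ _ (D1 z Rz hd)) scaler0 subr0.
    exact: D1.
  - move=> z Rz hs; have [-> h1] := L' z Rz hs; have [-> h2] := L1 z Rz hs.
    by split=> // l; rewrite h1 h2.
have [W' [E' [F' V' I' D' L']]] := main (enum {: 'I_k * 'I_k}).
exists W', E'; split; [exact: F'|exact: V'| |exact: D'|exact: L'].
move=> z Rz s1 l; have [h1 h2] := I' z Rz s1.
have ne : enum {: 'I_k * 'I_k} != [::].
  rewrite -size_eq0 -cardE card_prod card_ord muln_eq0 orbb.
  by rewrite -lt0n (ltn_trans _ k3).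
rewrite (h1 ne) big1 // => a _.
have -> : along (W' z) (defect W' E' z) a = 0; last by rewrite scaler0.
apply/row_matrixP => b; rewrite row0; apply: (h2 (a, b)); exact: mem_enum.
Qed.

End FrameStage.

(** * Families of jets *)

Section JetFamilies.
Context {R : realType} {n d : nat} {M : manifold R n} {K : manifold_with_boundary R d}.
Local Notation Z := (K * R * 'rV[R]_n)%type.
Local Notation V := ('rV[R]_d * R * 'rV[R]_n)%type.
Implicit Types (G : K -> R -> M -> jet M) (i j : chart_index M) (p : M).

Definition coord0 G i (z : Z) : 'M[R]_n :=
  jet_coord0 i (G z.1.1 z.1.2 (chart_inv i z.2)) z.2.
Definition coord1 G i (v : 'rV[R]_n) (z : Z) : 'M[R]_n :=
  jet_coord1 i (G z.1.1 z.1.2 (chart_inv i z.2)) z.2 v.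

Definition jet_smooth G (t : K * R * M) : Prop := forall i, dom i t.2 ->
  fam_smooth (chart_image i) (coord0 G i) (t.1, chart i t.2) /\
  forall v, fam_smooth (chart_image i) (coord1 G i v) (t.1, chart i t.2).

Lemma chart_image_dom i p : dom i p -> chart_image i (chart i p).
Proof. by move=> dp; exists p. Qed.

Lemma near_chart_coord (t : K * R * M) i (Q : set (K * R * M)) : dom i t.2 ->
  (\forall t' \near t, Q t') ->
  \forall z \near (t.1, chart i t.2), Q (z.1, chart_inv i z.2).
Proof.
case: t => w p /= dp [[A1 A3] /= [hA1 hA3] sA].
have h := near_chart_inv dp hA3.
exists (A1, [set x | A3 (chart_inv i x)]); first by split.
by move=> z [z1 z2]; apply: sA; split.
Qed.

Lemma near_coord_chart (t : K * R * M) i (Q : set Z) : dom i t.2 ->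
  (\forall z \near (t.1, chart i t.2), Q z) ->
  \forall t' \near t, Q (t'.1, chart i t'.2).
Proof.
case: t => w p /= dp [[A1 A3] /= [hA1 hA3] sA].
have h := near_chart_fwd dp hA3.
exists (A1, [set x | A3 (chart i x)]); first by split.
by move=> z [z1 z2]; apply: sA; split.
Qed.

Lemma near_pt_dom (t : K * R * M) i : dom i t.2 -> \forall t' \near t, dom i t'.2.
Proof.
case: t => w p /= dp; have h := near_dom dp.
have c : t.2 @[t --> (w, p)] --> p by exact: cvg_snd.
exact: (c _ h).
Qed.

Lemma jet_smooth_near G G' (t : K * R * M) :
  (\forall t' \near t, 0 <= t'.1.2 <= 1 -> G t'.1.1 t'.1.2 t'.2 = G' t'.1.1 t'.1.2 t'.2) ->
  jet_smooth G t -> jet_smooth G' t.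
Proof.
move=> h hG i dt; have [h0 h1] := hG i dt.
have hn := near_chart_coord dt h.
by split=> [|v]; [apply: fam_smooth_eq h0|apply: fam_smooth_eq (h1 v)];
  apply: filterS hn => z hz [zs zx]; rewrite /coord0 /coord1 hz.
Qed.

Lemma finite_dim_param : finite_dim V.
Proof.
apply: finite_dim_pair; last exact: finite_dim_mx.
by apply: finite_dim_pair; [exact: finite_dim_mx|exact: finite_dim_R].
Qed.

Lemma smooth_at_fst (U1 U2 : normedModType R) (A : set (U1 * U2)) z : smooth_at A z fst.
Proof.
apply: (smooth_at_lin (l := fst)) (smooth_at_id _ _); first by move=> ? ? ?.
by move=> v; exact: cvg_fst.
Qed.

Lemma smooth_at_snd (U1 U2 : normedModType R) (A : set (U1 * U2)) z : smooth_at A z snd.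
Proof.
apply: (smooth_at_lin (l := snd)) (smooth_at_id _ _); first by move=> ? ? ?.
by move=> v; exact: cvg_snd.
Qed.

Lemma smooth_at_transition i j p (A : set 'rV[R]_n) : dom i p -> dom j p ->
  smooth_at A (chart j p) (transition (M := M) j i).
Proof.
move=> di dj; apply: (smooth_at_of _ (open_overlap j i)); first exact: overlap_chart.
by move=> r; exact: Cr_on_transition.
Qed.

Lemma smooth_at_transition_comp (U : normedModType R) (A : set U) z i j p (f : U -> 'rV[R]_n) :
  dom i p -> dom j p -> A z -> f z = chart j p -> smooth_at A z f ->
  smooth_at A z (fun y => transition (M := M) j i (f y)).
Proof.
move=> di dj Az fz hf.
apply: (smooth_at_compT (g := transition j i)) hf _ => //; first exact: finite_dim_mx.
by rewrite fz; exact: smooth_at_transition.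
Qed.

Lemma fam_smooth_slice m r (W : Z -> 'M[R]_(m, r)) (A : set 'rV[R]_n) (z : Z) : fam_dom A z ->
  fam_smooth A W z -> smooth_at A z.2 (fun x => W (z.1, x)).
Proof.
case: z => w x0 /= [ws Ax] hW; have [a dq] := dom_cover w.1.
pose h1 (x : 'rV[R]_n) : V := ((chart a w.1, w.2), x).
apply: smooth_at_eqA (smooth_at_comp_mx (f := h1) (g := fun v => W (param_of a v))
   (B := param_dom A a) _ _ _ _ _) => //.
- by move=> y _; rewrite /h1 /param_of /= chartK // -surjective_pairing.
- exact: finite_dim_param.
- apply: (@filterE _ _ (nbhs_filter _)) => y Ay; split=> //; split=> //=.
  by exists w.1.
- by apply: smooth_at_pair; [exact: smooth_at_cst|exact: smooth_at_id].
- exact: hW.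
Qed.

Definition shift_z i j (z : Z) : Z := (z.1, transition (M := M) j i z.2).

Lemma fam_smooth_trans m r (W : Z -> 'M[R]_(m, r)) i j (t : K * R * M) : 0 <= t.1.2 <= 1 ->
  dom i t.2 -> dom j t.2 -> fam_smooth (chart_image i) W (t.1, chart i t.2) ->
  fam_smooth (chart_image j) (fun z => W (shift_z i j z)) (t.1, chart j t.2).
Proof.
case: t => w p /= ws di dj hW a dq.
have Pz : param_dom (chart_image j) a (param_coord a (w, chart j p)).
  by apply: param_dom_coord => //; split=> //; exact: chart_image_dom.
pose g (v : V) : V := (v.1, transition j i v.2).
have gz : g (param_coord a (w, chart j p)) = param_coord a (w, chart i p).
  by rewrite /g /param_coord /= transition_chart.
apply: (smooth_at_comp_mx (f := g) (g := fun v => W (param_of a v)) (B := param_dom (chart_image i) a)).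
- exact: finite_dim_param.
- have h : \forall v \near param_coord a (w, chart j p), overlap j i v.2.
    have c : v.2 @[v --> param_coord a (w, chart j p)] --> chart j p by exact: cvg_snd.
    by apply: c; apply: near_overlap; exact: overlap_chart.
  apply: filterS h => v hv [[hv1 hv2] _]; split=> //=.
  have [p' [dj' di'] <-] := hv; rewrite transition_chart //; exact: chart_image_dom.
- exact: Pz.
- apply: smooth_at_pair; first exact: smooth_at_fst.
  by apply: (smooth_at_transition_comp di dj) => //; exact: smooth_at_snd.
- by rewrite gz; exact: hW.
Qed.

Variable k : nat.

Lemma frame_family_smooth (f : 'I_k -> 'I_n) G i (t : K * R * M)
    (W : Z -> 'M[R]_(k, n)) (E : 'I_n -> Z -> 'M[R]_(k, n)) :
  0 <= t.1.2 <= 1 -> dom i t.2 ->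
  fam_smooth (chart_image i) W (t.1, chart i t.2) ->
  (forall l, fam_smooth (chart_image i) (E l) (t.1, chart i t.2)) ->
  (\forall z \near (t.1, chart i t.2), fam_dom (chart_image i) z ->
     normalized f (W z) /\ forall l, colsub f (E l z) = 0) ->
  (\forall t' \near t, 0 <= t'.1.2 <= 1 -> dom i t'.2 ->
     G t'.1.1 t'.1.2 t'.2 = frame_jet i t'.2 (W (t'.1, chart i t'.2)) (E^~ (t'.1, chart i t'.2))) ->
  jet_smooth G t.
Proof.
move=> ts di hW hE hn hG j dj.
(* [z] fixes the affine representative and [y] is the point where it is evaluated. The derivative
   coordinates are derivatives in [y] alone, so [H] is shown smooth in both variables,
   differentiated in [y], and then restricted to the diagonal. *)
pose H (z : Z) (y : 'rV[R]_n) : 'M[R]_n :=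
  trans_proj (M := M) i j (affine_frame (transition j i z.2) (W (shift_z i j z))
     (E^~ (shift_z i j z)) (transition j i y), y).
have hn' := near_coord_chart di hn.
pose z0 : Z := (t.1, chart j t.2).
have near_all : \forall z \near z0, fam_dom (chart_image j) z ->
    coord0 G j z = H z z.2 /\ forall v, coord1 G j v z = 'D_v (H z) z.2.
  have ff := nbhs_filter t.
  have hh := near_chart_coord dj (@filterI _ _ ff _ _ (@filterI _ _ ff _ _ hn' hG) (near_pt_dom di)).
  apply: (@filterS _ _ (nbhs_filter _) _ _ _ hh) => z [[/= hn1 hG1] di1] [zs zx].
  have [dj1 ej] := chart_invK zx.
  set p := chart_inv j z.2 in hn1 hG1 di1 dj1 ej *.
  have ei : chart i p = transition j i z.2 by rewrite -ej transition_chart.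
  have [nW nE] : normalized f (W (z.1, chart i p)) /\ forall l, colsub f (E l (z.1, chart i p)) = 0.
    by apply: hn1; split=> //; exact: chart_image_dom.
  rewrite /coord0 /coord1 hG1 // -/p -[X in jet_coord0 j _ X]ej.
  rewrite /frame_jet.
  set W1 := W _ in nW *; set xi := frame_field _ _.
  have ls : local_section k p xi by apply: frame_jet_section => //; exact: normalized_free nW.
  have [c0 c1] := jet_coord_jet1 dj1 ls.
  have eH : \forall y \near chart j p, plane_coord j xi y = H z y.
    have oc : overlap j i (chart j p) by exact: overlap_chart.
    apply: filterS (near_overlap oc) => y [q [djq diq] <-].
    rewrite (frame_field_coord diq djq (xi := xi) (w := affine_frame (chart i p) W1 (E^~ (z.1, chart i p)))) //.
    apply: (@normalized_free _ _ _ f); exact: affine_normalized.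
  split.
    rewrite c0 (nbhs_singleton eH) ej //.
  by move=> v; rewrite -[X in jet_coord1 j _ X]ej c1 (near_derive v eH) ej.
have Dz : fam_dom (chart_image j) z0 by split=> //; exact: chart_image_dom.
have sm a : dom a t.1.1 ->
    smooth_at (param_dom (chart_image j) a `*` chart_image j)
      (param_coord a z0, chart j t.2) (fun u => H (param_of a u.1) u.2).
  move=> da; have Pz := @param_dom_coord _ _ _ _ _ a z0 da Dz.
  set A := _ `*` _; set u0 := (_, _).
  have Au0 : A u0 by split=> //; exact: chart_image_dom.
  have s2 : smooth_at A u0 snd by exact: smooth_at_snd.
  have s1 : smooth_at A u0 fst by exact: smooth_at_fst.
  have s12 : smooth_at A u0 (fun u => u.1.2).
    apply: (smooth_at_lin (l := snd)) s1; first by move=> ? ? ?.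
    by move=> v; exact: cvg_snd.
  have pull (F : Z -> 'M[R]_(k, n)) : fam_smooth (chart_image i) F (t.1, chart i t.2) ->
      smooth_at A u0 (fun u => F (shift_z i j (param_of a u.1))).
    move=> hF; have h := fam_smooth_trans ts di dj hF.
    apply: (smooth_at_comp_mx (B := param_dom (chart_image j) a) (f := fst)
      (g := fun v => F (shift_z i j (param_of a v)))) => //.
    - exact: finite_dim_param.
    - by apply: (@filterE _ _ (nbhs_filter u0)) => u [].
    - exact: h.
  have ez : param_of a (param_coord a z0) = z0 by rewrite (@param_coordK _ _ _ _ a z0).
  apply: smooth_at_trans_proj_comp => //.
  - rewrite /= ez /shift_z /= affine_frame0.
    have [nW _] := nbhs_singleton hn' (conj ts (chart_image_dom di)).
    rewrite transition_chart //; exact: normalized_free nW.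
  - exact: overlap_chart.
  - apply: smooth_at_addmx; first exact: pull.
    apply: smooth_at_sum => l _; apply: smooth_at_scalemx; last exact: pull.
    apply: smooth_at_entry.
    have t2 := smooth_at_transition_comp di dj Au0 (erefl : snd u0 = chart j t.2) s2.
    have t1 := smooth_at_transition_comp di dj Au0 (erefl : u0.1.2 = chart j t.2) s12.
    apply: smooth_at_addmx => //.
    apply: smooth_at_eqA (smooth_at_scalemx (smooth_at_cst _ _ (-1 : R)) t1) => u _.
    by rewrite scaleN1r.
have diag a : dom a t.1.1 -> smooth_at (param_dom (chart_image j) a)
    (param_coord a z0) (fun v : V => (v, v.2)).
  move=> da; apply: smooth_at_pair; first exact: smooth_at_id.
  exact: smooth_at_snd.
have fd : finite_dim (V * 'rV[R]_n)%type.
  by apply: finite_dim_pair; [exact: finite_dim_param|exact: finite_dim_mx].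
split.
  apply: (@fam_smooth_eq _ _ _ _ _ _ (fun z => H z z.2)).
    by apply: (@filterS _ _ (nbhs_filter _) _ _ _ near_all) => z hz Dz'; have [->] := hz Dz'.
  move=> a da; have Pz := @param_dom_coord _ _ _ _ _ a z0 da Dz.
  apply: (smooth_at_comp_mx (f := fun v : V => (v, v.2)) (g := fun u => H (param_of a u.1) u.2)
     fd _ Pz (diag a da) (sm a da)).
  by apply: (@filterE _ _ (nbhs_filter _)) => v [hv1 hv2].
move=> v; apply: (@fam_smooth_eq _ _ _ _ _ _ (fun z => 'D_v (H z) z.2)).
  by apply: (@filterS _ _ (nbhs_filter _) _ _ _ near_all) => z hz Dz'; have [_ ->] := hz Dz'.
move=> a da; have Pz := @param_dom_coord _ _ _ _ _ a z0 da Dz.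
have [sd _] := smooth_at_dx (z := (param_coord a z0, chart j t.2)) v
  (@open_chart_image _ _ _ j) Pz (chart_image_dom dj) (sm a da).
apply: (smooth_at_comp_mx (f := fun v : V => (v, v.2))
   (g := fun u => 'D_v (fun x => H (param_of a u.1) x) u.2) fd _ Pz (diag a da) sd).
by apply: (@filterE _ _ (nbhs_filter _)) => u [hv1 hv2].
Qed.

End JetFamilies.

(** * A stage for jets over one chart of the manifold and one affine chart of the Grassmannian *)

Section JetStage.
Context {R : realType} {n d : nat} {M : manifold R n} {K : manifold_with_boundary R d}.
Local Notation Z := (K * R * 'rV[R]_n)%type.
Local Notation T := (K * R * M)%type.
Variable k : nat.
Implicit Types (G : K -> R -> M -> jet M) (i j : chart_index M) (p : M) (f : 'I_k -> 'I_n) (t : T).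

Definition frame0 f G i (z : Z) : 'M[R]_(k, n) := normal_frame f (coord0 G i z).
Definition frame1 f G i (l : 'I_n) (z : Z) : 'M[R]_(k, n) :=
  normal_deriv f (coord0 G i z) (coord1 G i (delta_mx 0 l) z).

Lemma fam_smooth_frame0 f G i (z : Z) : fam_dom (chart_image i) z ->
  mxsub f f (coord0 G i z) \in unitmx -> fam_smooth (chart_image i) (coord0 G i) z ->
  fam_smooth (chart_image i) (frame0 f G i) z.
Proof.
move=> Dz u h; apply: fam_smooth_mulmx; last exact: fam_smooth_mxsub.
by apply: fam_smooth_invmx => //; exact: fam_smooth_mxsub.
Qed.

Lemma fam_smooth_frame1 f G i l (z : Z) : fam_dom (chart_image i) z ->
  mxsub f f (coord0 G i z) \in unitmx -> fam_smooth (chart_image i) (coord0 G i) z ->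
  (forall v, fam_smooth (chart_image i) (coord1 G i v) z) ->
  fam_smooth (chart_image i) (frame1 f G i l) z.
Proof.
move=> Dz u h h1; apply: fam_smooth_mulmx.
  by apply: fam_smooth_invmx => //; exact: fam_smooth_mxsub.
apply: fam_smoothB; first exact: fam_smooth_mxsub.
apply: fam_smooth_mulmx; first exact: fam_smooth_mxsub.
exact: fam_smooth_frame0.
Qed.

(** Formal homotopies in pointwise form, so that a stage can be checked separately at points where
    it acts and at points where it does not. *)
Definition good G := forall t, 0 <= t.1.2 <= 1 ->
  step2_relation k t.2 (G t.1.1 t.1.2 t.2) /\ jet_smooth G t.

(** Holonomy at a point. The only candidate for the underlying distribution is the field of planes
    [jet0], so no existence is asserted, and the condition depends only on the germ of the slice. *)
Definition hol G t : Prop :=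
  G t.1.1 t.1.2 t.2 = jet1 k (fun p => jet0 p (G t.1.1 t.1.2 p)) t.2.

Lemma hol_near G G' t :
  (\forall p \near t.2, G t.1.1 t.1.2 p = G' t.1.1 t.1.2 p) -> hol G t -> hol G' t.
Proof.
move=> h; rewrite /hol (nbhs_singleton h) => ->; apply: jet1_eq.
apply: same_jet1_near; apply: filterS h => p; rewrite /= => hp; by rewrite hp.
Qed.

Lemma jet0_frame_jet f i p (W : 'M[R]_(k, n)) (E : 'I_n -> 'M[R]_(k, n)) :
  dom i p -> normalized f W -> jet0 p (frame_jet i p W E) = plane i p W.
Proof.
move=> di nW; rewrite /frame_jet jet0_jet1.
  by rewrite /frame_field affine_frame0.
by apply: frame_jet_section => //; exact: normalized_free nW.
Qed.

(** The plane field has the frame [W], so its jet is the [frame_jet] with derivatives [dx W].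
    Normalised pairs are coordinates on jets, hence equality of jets is equality of the
    derivatives. *)
Lemma hol_defect f G i t (W : Z -> 'M[R]_(k, n)) (E : 'I_n -> Z -> 'M[R]_(k, n)) :
  0 <= t.1.2 <= 1 -> dom i t.2 ->
  fam_smooth (chart_image i) W (t.1, chart i t.2) ->
  (\forall p \near t.2, dom i p -> [/\ normalized f (W (t.1, chart i p)),
     forall l, colsub f (E l (t.1, chart i p)) = 0 &
     G t.1.1 t.1.2 p = frame_jet i p (W (t.1, chart i p)) (E^~ (t.1, chart i p))]) ->
  hol G t <-> forall l, defect W E (t.1, chart i t.2) l = 0.
Proof.
case: t => w p /= ws di hW hn.
pose g x := W (w, x).
have sg : smooth_at (chart_image i) (chart i p) g.
  by apply: (fam_smooth_slice (z := (w, chart i p))) hW; split=> //; exact: chart_image_dom.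
have [U [[oU Ux] UX cU]] := smooth_at_open (@open_chart_image _ _ _ i) (chart_image_dom di) sg.
have [nW nE eG] := nbhs_singleton hn di.
have hn2 : \forall q \near p, dom i q /\ [/\ normalized f (W (w, chart i q)),
     forall l, colsub f (E l (w, chart i q)) = 0 &
     G w.1 w.2 q = frame_jet i q (W (w, chart i q)) (E^~ (w, chart i q))].
  by apply: filterS2 (near_dom di) hn => q dq /(_ dq) h.
have [U' [U'U U'x sf]] := row_free_near oU Ux cU (normalized_free nW).
have eX : \forall q \near p, jet0 q (G w.1 w.2 q) = frame_field i g q.
  apply: filterS hn2 => q [dq [nq _ ->]]; by rewrite (jet0_frame_jet _ dq nq).
have ej := jet1_frame di U'x sf eX.
have dW l : derivable g (chart i p) (delta_mx 0 l) by exact: Cr_on_derivable (cU 1%N) Ux.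
have ndW l : colsub f (dx W l (w, chart i p)) = 0.
  have [_ e] := derive_mxsub id f (dW l).
  rewrite /dx /= -e -[RHS](@derive_cst R 'rV[R]_n _ (1%:M : 'M[R]_k) (chart i p) (delta_mx 0 l)).
  apply: near_derive.
  have h2 := near_chart_inv di hn2.
  have h3 : \forall x \near chart i p, chart_image i x.
    by apply: open_nbhs_nbhs; split; [exact: open_chart_image|exact: chart_image_dom].
  apply: filterS2 h2 h3 => x [dq [nq _ _]] Xx.
  by have [_ ex] := chart_invK Xx; rewrite ex in nq.
rewrite /hol /= ej eG; split=> [e l|e].
  have [_ _ _ c1] := frame_jet_coords di nW nE.
  have [_ _ _ c2] := frame_jet_coords di nW ndW.
  have := c1 l; rewrite e (c2 l) => h; by rewrite /defect -h subrr.
congr (frame_jet i p _ _); apply/funext => l.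
by apply/eqP; rewrite -subr_eq0; apply/eqP; exact: e.
Qed.

Section Stage.
Variables (f : 'I_k -> 'I_n) (i : chart_index M) (G : K -> R -> M -> jet M).
Hypothesis gG : good G.
Local Notation X := (chart_image i).

(** The region where the planes of [G] lie in the affine chart [f] of the Grassmannian; only there
    do normalised frames exist, so only there can a step act. *)
Definition regular : set Z := [set z | fam_dom X z /\ mxsub f f (coord0 G i z) \in unitmx].

Lemma coord0_smooth z : fam_dom X z ->
  fam_smooth X (coord0 G i) z /\ forall v, fam_smooth X (coord1 G i v) z.
Proof.
move=> [zs zx]; have [dp e] := chart_invK zx.
have [_ h] := gG (t := (z.1, chart_inv i z.2)) zs.
have := h i dp; rewrite /= e -surjective_pairing //.
Qed.

Lemma regular_open z : regular z -> \forall y \near z, fam_dom X y -> regular y.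
Proof.
move=> [Dz u]; have [c0 _] := coord0_smooth Dz.
have cd := fam_smooth_cvg Dz (fam_smooth_det (fam_smooth_mxsub f f c0)).
have d0 : 0 < `|\det (mxsub f f (coord0 G i z))| by rewrite normr_gt0 -unitfE -unitmxE.
have /cvgrPdist_lt /(_ _ d0) hn := cd.
have {}hn : \forall y \near z, fam_dom X y ->
   `|\det (mxsub f f (coord0 G i z)) - \det (mxsub f f (coord0 G i y))| <
   `|\det (mxsub f f (coord0 G i z))| := hn.
apply: (@filterS _ _ (nbhs_filter z) _ _ _ hn) => y hy Dy; split=> //.
rewrite unitmxE unitfE; apply/negP => /eqP e; have := hy Dy.
by rewrite e subr0 ltxx.
Qed.

Lemma frame_at z : regular z ->
  let p := chart_inv i z.2 in
  [/\ dom i p, chart i p = z.2, G z.1.1 z.1.2 p = frame_jet i p (frame0 f G i z) ((frame1 f G i)^~ z),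
    normalized f (frame0 f G i z) & forall l, colsub f (frame1 f G i l z) = 0].
Proof.
move=> [[zs zx] u] p; have [dp e] := chart_invK zx.
have [[J _] _] := gG (t := (z.1, p)) zs.
have u' : mxsub f f (jet_coord0 i (G z.1.1 z.1.2 p) (chart i p)) \in unitmx by rewrite e.
have nf := jet_normal_form dp J u'; have [n1 n2] := normal_coord_normalized dp J u'.
have e0 : frame0 f G i z = normal_coord0 f i p (G z.1.1 z.1.2 p).
  by rewrite /frame0 /coord0 /normal_coord0 e.
have e1 : (frame1 f G i)^~ z = normal_coord1 f i p (G z.1.1 z.1.2 p).
  by apply/funext => l; rewrite /frame1 /coord0 /coord1 /normal_coord1 e.
split; [exact: dp|exact: e|by rewrite e0 e1|by rewrite e0|].
by move=> l; have := n2 l; rewrite -e1.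
Qed.

Lemma formal_frame_G : formal_frame (X := X) f regular (frame0 f G i) (frame1 f G i).
Proof.
move=> z Rz; have [Dz u] := Rz; have [c0 c1] := coord0_smooth Dz.
have [dp ep eG nW nE] := frame_at Rz.
split=> //.
- exact: fam_smooth_frame0.
- by move=> l; exact: fam_smooth_frame1.
- have [zs zx] := Dz; have [[_ ce] _] := gG (t := (z.1, chart_inv i z.2)) zs.
  by apply: (curvature_epi_curv dp nW nE); rewrite -eG.
Qed.

Variables (V : Z -> 'M[R]_(k, n) -> Prop) (sigma : Z -> R) (S : set Z).
Hypothesis (cS : compact S) (SRg : S `<=` regular).
Hypothesis Vo : forall z, S z -> forall B, V z B ->
  \forall t \near (z, B), fam_dom X t.1 -> V t.1 t.2.
Hypothesis sigma_smooth : forall z, regular z -> fam_smooth X sigma z.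
Hypothesis sigma_ge0 : forall z, 0 <= sigma z.
Hypothesis sigma_out : forall t, 0 <= t.1.2 <= 1 -> ~ (dom i t.2 /\ S (t.1, chart i t.2)) ->
  \forall t' \near t, dom i t'.2 -> sigma (t'.1, chart i t'.2) = 0.
Hypothesis VG : forall z, regular z -> V z (frame0 f G i z).

Lemma near_slice (t : T) (Q : set T) :
  (\forall t' \near t, Q t') -> \forall p \near t.2, Q (t.1, p).
Proof.
case: t => w p /= [[A1 A3] /= [hA1 hA3] sA]; apply: filterS hA3 => p' h.
by apply: sA; split=> //=; exact: nbhs_singleton.
Qed.

Lemma near_near (U : topologicalType) (x : U) (Q : set U) :
  (\forall y \near x, Q y) -> \forall y \near x, \forall y' \near y, Q y'.
Proof. exact: nbhs_interior. Qed.

(** Carries [frame_stage] over to jets. The new jets are used on the regular set and [G] elsewhere;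
    near points that are not regular [sigma] vanishes, so both agree and the result is smooth. *)
Lemma jet_stage : (2 < k)%N -> exists G', [/\ good G',
  forall t, dom i t.2 -> regular (t.1, chart i t.2) ->
    exists B, [/\ V (t.1, chart i t.2) B, normalized f B,
      jet0 t.2 (G' t.1.1 t.1.2 t.2) = plane i t.2 B &
      coord0 G' i (t.1, chart i t.2) = row_proj B],
  forall t, (dom i t.2 -> regular (t.1, chart i t.2) ->
      \forall x \near chart i t.2, sigma (t.1, x) = 0) ->
    G' t.1.1 t.1.2 t.2 = G t.1.1 t.1.2 t.2,
  forall t, 0 <= t.1.2 <= 1 -> hol G t -> hol G' t &
  forall t, dom i t.2 -> regular (t.1, chart i t.2) -> sigma (t.1, chart i t.2) = 1 -> hol G' t].
Proof.
move=> k3.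
have sub : regular `<=` fam_dom X by move=> z [].
have near_sigma t : 0 <= t.1.2 <= 1 -> ~ (dom i t.2 /\ S (t.1, chart i t.2)) -> dom i t.2 ->
    \forall x \near chart i t.2, sigma (t.1, x) = 0.
  move=> ts nS di; have h := near_slice (sigma_out ts nS).
  have h2 := near_chart_inv di h.
  have h3 : \forall x \near chart i t.2, X x.
    by apply: open_nbhs_nbhs; split; [exact: open_chart_image|exact: chart_image_dom].
  apply: filterS2 h2 h3 => x hx Xx; have [dp ex] := chart_invK Xx.
  by have := hx dp; rewrite /= ex.
have sout z : regular z -> ~ S z -> \forall x \near z.2, sigma (z.1, x) = 0.
  move=> Rz nS; have [dp ep _ _ _] := frame_at Rz; have [[zs zx] _] := Rz.
  have := @near_sigma (z.1, chart_inv i z.2) zs; rewrite /= ep -surjective_pairing.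
  by apply=> //; case.
have [W' [E' [F' V' D1 D0 L']]] := frame_stage (@open_chart_image _ _ _ i) sub regular_open cS SRg
  Vo sigma_smooth sigma_ge0 sout k3 formal_frame_G VG.
pose G' q s p := if `[< dom i p /\ regular (q, s, chart i p) >]
  then frame_jet i p (W' (q, s, chart i p)) (E'^~ (q, s, chart i p)) else G q s p.
have G'in t : dom i t.2 -> regular (t.1, chart i t.2) ->
    G' t.1.1 t.1.2 t.2 = frame_jet i t.2 (W' (t.1, chart i t.2)) (E'^~ (t.1, chart i t.2)).
  by case: t => [[q s] p] /= dt rt; rewrite /G' asboolT.
have G'out t : ~ (dom i t.2 /\ regular (t.1, chart i t.2)) ->
    G' t.1.1 t.1.2 t.2 = G t.1.1 t.1.2 t.2.
  by case: t => [[q s] p] /= dt; rewrite /G' asboolF.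
have Gin t : dom i t.2 -> regular (t.1, chart i t.2) ->
    [/\ G t.1.1 t.1.2 t.2 = frame_jet i t.2 (frame0 f G i (t.1, chart i t.2)) ((frame1 f G i)^~ (t.1, chart i t.2)),
      normalized f (frame0 f G i (t.1, chart i t.2)) & forall l, colsub f (frame1 f G i l (t.1, chart i t.2)) = 0].
  by move=> dt rt; have [_ _ h1 h2 h3] := frame_at rt; split=> //; move: h1; rewrite /= chartK.
have Geq t : (dom i t.2 -> regular (t.1, chart i t.2) ->
    \forall x \near chart i t.2, sigma (t.1, x) = 0) -> G' t.1.1 t.1.2 t.2 = G t.1.1 t.1.2 t.2.
  move=> h; have [[dt rt]|nt] := pselect (dom i t.2 /\ regular (t.1, chart i t.2)); last exact: G'out.
  have [eW eE] := L' _ rt (h dt rt).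
  have [eG _ _] := Gin t dt rt; rewrite (G'in _ dt rt) eG eW; congr (frame_jet _ _ _ _).
  by apply/funext => l; exact: eE.
have near_reg t : dom i t.2 -> regular (t.1, chart i t.2) ->
    \forall t' \near t, 0 <= t'.1.2 <= 1 -> dom i t'.2 /\ regular (t'.1, chart i t'.2).
  move=> dt rt; have h := near_coord_chart dt (regular_open rt).
  apply: (@filterS2 _ _ (nbhs_filter t) _ _ _ _ h (near_pt_dom dt)) => t' h1 d' s'; split=> //.
  by apply: h1; split=> //; exact: chart_image_dom.
have near_eq t : 0 <= t.1.2 <= 1 -> ~ (dom i t.2 /\ regular (t.1, chart i t.2)) ->
    \forall t' \near t, G t'.1.1 t'.1.2 t'.2 = G' t'.1.1 t'.1.2 t'.2.
  move=> ts nt; have nS : ~ (dom i t.2 /\ S (t.1, chart i t.2)).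
    by case=> h1 h2; apply: nt; split=> //; exact: SRg.
  apply: (@filterS _ _ (nbhs_filter t) _ _ _ (near_near (sigma_out ts nS))) => t' h.
  apply/esym; apply: Geq => dt' rt'.
  have h2 := near_chart_inv dt' (near_slice h).
  have h3 : \forall x \near chart i t'.2, X x.
    by apply: open_nbhs_nbhs; split; [exact: open_chart_image|exact: chart_image_dom].
  apply: filterS2 h2 h3 => x hx Xx; have [dp ex] := chart_invK Xx.
  by have := hx dp; rewrite /= ex.
have holP t : dom i t.2 -> regular (t.1, chart i t.2) ->
    hol G' t <-> forall l, defect W' E' (t.1, chart i t.2) l = 0.
  move=> dt rt; have [[ts _] _] := rt; have [sW _ _ _ _] := F' _ rt.
  apply: (hol_defect (f := f)) => //.
  apply: filterS (near_slice (near_reg t dt rt)) => p h dp.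
  have [_ rp] := h ts; have [_ _ nW nE _] := F' _ rp.
  by split=> //; exact: (G'in (t.1, p)).
exists G'; split.
- move=> t ts; have [[dt rt]|nt] := pselect (dom i t.2 /\ regular (t.1, chart i t.2)); last first.
    have [g1 g2] := gG ts; split; first by rewrite G'out.
    apply: jet_smooth_near g2.
    by apply: (@filterS _ _ (nbhs_filter t) _ _ _ (near_eq t ts nt)) => t' h _.
  have [sW sE nW nE ce] := F' _ rt.
  split.
    rewrite G'in //; split; first by apply: frame_jet_J1 => //; exact: normalized_free nW.
    exact: curv_curvature_epi nW nE ce.
  apply: (frame_family_smooth (f := f) (W := W') (E := E') ts dt sW sE).
    apply: (@filterS _ _ (nbhs_filter _) _ _ _ (regular_open rt)) => z hz Dz.
    by have [_ _ n1 n2 _] := F' _ (hz Dz).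
  apply: (@filterS _ _ (nbhs_filter t) _ _ _ (near_reg t dt rt)) => t' h s' d'.
  by have [_ r'] := h s'; exact: G'in.
- move=> t dt rt; have [_ _ nW nE _] := F' _ rt.
  exists (W' (t.1, chart i t.2)); split=> //; first exact: V'.
    by rewrite G'in // (jet0_frame_jet _ dt nW).
  have [c0 _ _ _] := frame_jet_coords dt nW nE.
  by rewrite /coord0 /= chartK // G'in.
- exact: Geq.
- move=> t ts; have [[dt rt]|nt] := pselect (dom i t.2 /\ regular (t.1, chart i t.2)); last first.
    by apply: hol_near; exact: (near_slice (near_eq t ts nt)).
  rewrite holP //; have [sW _ _ _ _] := formal_frame_G rt.
  have hP : hol G t <-> forall l, defect (frame0 f G i) (frame1 f G i) (t.1, chart i t.2) l = 0.
    apply: (hol_defect (f := f)) => //.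
    apply: filterS (near_slice (near_reg t dt rt)) => p h dp.
    have [_ rp] := h ts; have [h1 h2 h3] := Gin (t.1, p) dp rp.
    by split.
  by move=> /hP h0; exact: D0.
- by move=> t dt rt s1; rewrite holP // => l; exact: D1.
Qed.

End Stage.
End JetStage.

(** * Closeness of planes in terms of frames *)

Section FramesClose.
Context {R : realType}.

Lemma cvg_entry (T : Type) (F : set_system T) {FF : Filter F} m r (A : T -> 'M[R]_(m, r)) (A0 : 'M[R]_(m, r)) i j :
  A t @[t --> F] --> A0 -> A t i j @[t --> F] --> A0 i j.
Proof. by move=> h; exact: (cvg_comp _ _ h (@coord_continuous R m r i j A0)). Qed.

Lemma cvg_mulmx (T : Type) (F : set_system T) {FF : Filter F} m r s
    (A : T -> 'M[R]_(m, r)) (B : T -> 'M[R]_(r, s)) (A0 : 'M[R]_(m, r)) (B0 : 'M[R]_(r, s)) :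
  A t @[t --> F] --> A0 -> B t @[t --> F] --> B0 -> (A t *m B t) @[t --> F] --> A0 *m B0.
Proof.
move=> hA hB; apply: cvg_mx_entries => i j; rewrite mxE.
have -> : (fun t => (A t *m B t) i j) = (fun t => \sum_l A t i l * B t l j).
  by apply/funext => t; rewrite mxE.
by apply: cvg_sumr => l; apply: cvgM; exact: cvg_entry.
Qed.

Lemma cvg_trmx (T : Type) (F : set_system T) {FF : Filter F} m r (A : T -> 'M[R]_(m, r)) (A0 : 'M[R]_(m, r)) :
  A t @[t --> F] --> A0 -> (A t)^T @[t --> F] --> A0^T.
Proof.
move=> hA; apply: cvg_mx_entries => i j; rewrite mxE.
have -> : (fun t => (A t)^T i j) = (fun t => A t j i) by apply/funext => t; rewrite mxE.
exact: cvg_entry.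
Qed.

Definition qform n (Gm : 'M[R]_n) (v : 'rV[R]_n) : R := (v *m Gm *m v^T) 0 0.

Lemma cvg_qform (T : Type) (F : set_system T) {FF : Filter F} n
    (A : T -> 'M[R]_n) (v : T -> 'rV[R]_n) (A0 : 'M[R]_n) (v0 : 'rV[R]_n) :
  A t @[t --> F] --> A0 -> v t @[t --> F] --> v0 ->
  qform (A t) (v t) @[t --> F] --> qform A0 v0.
Proof.
move=> hA hv; apply: cvg_entry; apply: cvg_mulmx; last exact: cvg_trmx.
exact: cvg_mulmx.
Qed.

(** One half of [planes_close], squared and written in frame coefficients. Homogeneity in [c]
    reduces it to the unit sphere, which makes it an open condition. *)
Definition frames_close n k (e : R) (Gm : 'M[R]_n) (W W0 : 'M[R]_(k, n)) : Prop :=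
  forall c : 'rV[R]_k, c != 0 -> exists d : 'rV[R]_k,
    qform Gm (c *m W - d *m W0) < e ^+ 2 * qform Gm (c *m W).

Lemma qformZ n (Gm : 'M[R]_n) a v : qform Gm (a *: v) = a ^+ 2 * qform Gm v.
Proof. by rewrite /qform linearZ /= -!scalemxAl -scalemxAr !mxE mulrA expr2. Qed.

Lemma usphere_normalize k (c : 'rV[R]_k) : c != 0 ->
  exists a : R, a != 0 /\ usphere (a *: c).
Proof.
move=> c0; pose N := \sum_j (c 0 j) ^+ 2.
have N0 : 0 < N.
  rewrite lt_neqAle sumr_ge0 ?andbT; last by move=> ? _; exact: sqr_ge0.
  apply: contra_neq c0 => /eqP; rewrite eq_sym psumr_eq0; last by move=> ? _; exact: sqr_ge0.
  move=> /allP hy; apply/rowP => i; rewrite [RHS]mxE; apply/eqP.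
  by rewrite -sqrf_eq0; exact: (hy i (mem_index_enum _)).
exists (Num.sqrt N)^-1; split; first by rewrite invr_eq0 gt_eqF // sqrtr_gt0.
rewrite /usphere /=; under eq_bigr do rewrite !mxE exprMn.
by rewrite -mulr_sumr exprVn sqr_sqrtr ?ltW // mulVf // gt_eqF.
Qed.

Lemma frames_close_near (T : Type) (F : set_system T) {FF : Filter F} n k
    (e : T -> R) (Gm : T -> 'M[R]_n) (W W0 : T -> 'M[R]_(k, n))
    (e' : R) (Gm' : 'M[R]_n) (W' W0' : 'M[R]_(k, n)) :
  e t @[t --> F] --> e' -> Gm t @[t --> F] --> Gm' -> W t @[t --> F] --> W' ->
  W0 t @[t --> F] --> W0' -> frames_close e' Gm' W' W0' ->
  \forall t \near F, frames_close (e t) (Gm t) (W t) (W0 t).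
Proof.
move=> he hG hW hW0 hc.
have /compact_near_coveringP nc := @usphere_compact R k.
pose P t (c : 'rV[R]_k) := exists d : 'rV[R]_k,
    qform (Gm t) (c *m W t - d *m W0 t) < e t ^+ 2 * qform (Gm t) (c *m W t).
(* The [d] that serves [c] still serves nearby coefficients and nearby frames, because the
   inequality is strict. *)
have key c : usphere c -> \forall c' \near c & t \near F, P t c'.
  move=> uc; have c0 : c != 0.
    apply/eqP => c0; have e0 : \sum_j (c 0 j) ^+ 2 = 1 := uc.
    by move: e0; rewrite c0 big1 => [/eqP|i _]; rewrite ?mxE ?expr0n // eq_sym oner_eq0.
  have [d hd] := hc c c0.
  have FP : Filter (filter_prod (nbhs c) F) by exact: filter_prod_filter.
  have c1 : x.1 @[x --> filter_prod (nbhs c) F] --> c by exact: cvg_fst.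
  have pull (U : topologicalType) (h : T -> U) (u : U) : h t @[t --> F] --> u ->
      h x.2 @[x --> filter_prod (nbhs c) F] --> u.
    by move=> hh; apply: (cvg_comp _ _ (@cvg_snd _ _ (nbhs c) F _)); exact: hh.
  have cW := @cvg_mulmx _ _ FP _ _ _ _ _ _ _ c1 (pull _ _ _ hW).
  have cW0 := @cvg_mulmx _ _ FP _ _ _ _ _ _ _ (@cvg_cst _ d _ _ FP) (pull _ _ _ hW0).
  have cG := pull _ _ _ hG; have ce := pull _ _ _ he.
  have cd := cvgB (FF := FP) cW cW0.
  have q1 := @cvg_qform _ _ FP _ _ _ _ _ cG cd.
  have q2 := cvgM (FF := FP) (cvgM (FF := FP) ce ce) (@cvg_qform _ _ FP _ _ _ _ _ cG cW).
  have := cvgB (FF := FP) q2 q1.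
  move=> /cvgrPdist_lt hlim.
  have pos : 0 < e' * e' * qform Gm' (c *m W') - qform Gm' (c *m W' - d *m W0').
    by rewrite subr_gt0 -expr2.
  have := hlim _ pos; apply: filterS => -[c' t] /= h; exists d.
  rewrite -subr_gt0 expr2; move: h; rewrite ltr_distlC subrr => /andP[]//.
have nn := nc T F P FF key.
apply: filterS nn => t ht c c0.
have [a [a0 ua]] := usphere_normalize c0; have [d hd] := ht _ ua.
exists (a^-1 *: d); have a2 : 0 < a ^+ 2 by rewrite exprn_even_gt0.
rewrite -(ltr_pM2l a2) mulrCA -(qformZ _ a (c *m W t - _)) -(qformZ _ a (c *m W t)).
by rewrite scalerBr !scalemxAl scalerA mulfV // scale1r.
Qed.

Lemma sqrt_lt_scale (e a b : R) : 0 < e -> 0 <= a -> 0 <= b ->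
  (Num.sqrt a < e * Num.sqrt b) = (a < e ^+ 2 * b).
Proof.
move=> e0 a0 b0; rewrite -(@ltr_pXn2r _ 2) ?nnegrE ?sqrtr_ge0 //; last first.
  by rewrite mulr_ge0 ?sqrtr_ge0 // ltW.
by rewrite exprMn !sqr_sqrtr.
Qed.

Context {n : nat} {M : manifold R n}.

Lemma tangent_sub p (v w : tvec M) : tangent p v -> tangent p w -> tangent p (v - w).
Proof.
by move=> tv tw; have := tangent_lin (-1) tw tv; rewrite scaleN1r addrC.
Qed.

Lemma half_closeP k (g : M -> tvec M -> tvec M -> R) i p (e : R) (Gm : 'M[R]_n) (W W0 : 'M[R]_(k, n)) :
  dom i p -> 0 < e -> row_free W ->
  (forall u, tangent p u -> g p u u = qform Gm (u i)) ->
  (forall u, tangent p u -> 0 <= g p u u) ->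
  (forall v, plane i p W v -> v <> 0 -> exists2 w, plane i p W0 w &
      Num.sqrt (g p (v - w) (v - w)) < e * Num.sqrt (g p v v)) <-> frames_close e Gm W W0.
Proof.
move=> di e0 fW gE g0; split=> [h c c0|h v [tv vW] v0].
  pose v := tvec_of i p (c *m W).
  have tv : tangent p v by exact: tvec_of_tangent.
  have vi : v i = c *m W by exact: tvec_ofE.
  have [|ev|w [tw /submxP[d wW]]] := h v.
  - by split=> //; rewrite vi submxMl.
  - move: c0; apply/negP; rewrite negbK; apply/eqP; apply: (row_free_inj fW).
    by rewrite -vi ev mul0mx.
  have tvw := tangent_sub tv tw.
  rewrite (sqrt_lt_scale e0 (g0 _ tvw) (g0 _ tv)) (gE _ tvw) (gE _ tv) => hw.
  by exists d; rewrite -vi -wW.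
have /submxP[c vc] := vW.
have c0 : c != 0.
  apply/eqP => c0; apply: v0; apply: (tangent_eq tv (tangent0 p) di).
  by rewrite vc c0 mul0mx.
have [d hd] := h c c0.
pose w := tvec_of i p (d *m W0).
have tw : tangent p w by exact: tvec_of_tangent.
have wi : w i = d *m W0 by exact: tvec_ofE.
exists w; first by split=> //; rewrite wi submxMl.
have tvw := tangent_sub tv tw.
rewrite (sqrt_lt_scale e0 (g0 _ tvw) (g0 _ tv)) (gE _ tvw) (gE _ tv).
have -> : (v - w) i = v i - w i by [].
by rewrite wi vc.
Qed.

Lemma planes_closeP k (g : M -> tvec M -> tvec M -> R) i p (e : R) (Gm : 'M[R]_n) (W W0 : 'M[R]_(k, n)) :
  dom i p -> 0 < e -> row_free W -> row_free W0 ->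
  (forall u, tangent p u -> g p u u = qform Gm (u i)) ->
  (forall u, tangent p u -> 0 <= g p u u) ->
  planes_close g p e (plane i p W) (plane i p W0) <->
  frames_close e Gm W W0 /\ frames_close e Gm W0 W.
Proof.
move=> di e0 fW fW0 gE g0.
have h1 := half_closeP W0 di e0 fW gE g0; have h2 := half_closeP W di e0 fW0 gE g0.
by split=> -[/h1 a /h2 b].
Qed.

End FramesClose.

(** * The stage attached to a bump function *)

Definition manifold_smooth (R : realType) (n : nat) (H : set 'rV[R]_n)
    (N : smooth_manifold_on H) (b : N -> R) : Prop :=
  forall p i, dom i p -> smooth_at (chart i @` dom i) (chart i p) (fun x => b (chart_inv i x)).

(** Continuity of [h] is available only relative to [D], hence the argument by cluster points inside
    [D]. *)
Lemma compact_superlevel (R : realType) (T : topologicalType) (D : set T) (h : T -> R) (c : R) :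
  compact D -> (forall z, D z -> h y @[y --> within D (nbhs z)] --> h z) ->
  compact (D `&` [set z | c <= h z]).
Proof.
move=> cD ch F PF FD.
have FD' : F D by apply: filterS FD => z [].
have [z [Dz clz]] := cD F PF FD'.
exists z; split=> //; split=> //=; rewrite leNgt; apply/negP => hzc.
have /cvgrPdist_lt /(_ (c - h z)) := ch z Dz; rewrite subr_gt0 => /(_ hzc) hn.
have {}hn : \forall y \near z, D y -> `|h z - h y| < c - h z := hn.
have [y [[Dy cy] hy]] := clz _ _ FD hn.
have := hy Dy; rewrite ltr_distlC => /andP[_]; rewrite addrC subrK.
by rewrite ltNge cy.
Qed.

Section FullStage.
Context {R : realType} {n d : nat} {M : manifold R n} {K : manifold_with_boundary R d}.
Local Notation Z := (K * R * 'rV[R]_n)%type.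
Local Notation T := (K * R * M)%type.
Variable k : nat.
Implicit Types (G : K -> R -> M -> jet M) (i j : chart_index M) (p : M) (t : T)
  (f : {ffun 'I_k -> 'I_n}).

Lemma fam_smooth_base (b : M -> R) i (z : Z) : manifold_smooth b -> fam_dom (chart_image i) z ->
  fam_smooth (chart_image i) (fun z => b (chart_inv i z.2)) z.
Proof.
move=> hb Dz a da; have Pz := param_dom_coord da Dz.
have [dp e] := chart_invK Dz.2.
have sb := hb _ _ dp; rewrite e in sb.
apply: (smooth_at_comp (f := snd) (g := fun x => b (chart_inv i x)) (B := chart_image i)) => //.
- exact: finite_dim_mx.
- by apply: (@filterE _ _ (nbhs_filter _)) => v [].
- exact: smooth_at_snd.
Qed.

Lemma fam_smooth_param (b : K -> R) X (z : Z) : manifold_smooth b -> fam_dom X z ->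
  fam_smooth X (fun z => b z.1.1) z.
Proof.
move=> hb Dz a da; have Pz := param_dom_coord da Dz.
apply: (smooth_at_comp (f := fun v : 'rV[R]_d * R * 'rV[R]_n => v.1.1)
  (g := fun x => b (chart_inv a x)) (B := chart a @` dom a)) => //.
- exact: finite_dim_mx.
- by apply: (@filterE _ _ (nbhs_filter _)) => v [[]].
- apply: (smooth_at_lin (l := fst)) (smooth_at_fst _ _); first by move=> ? ? ?.
  by move=> v; exact: cvg_fst.
- exact: hb.
Qed.

Lemma fam_smooth_time X (z : Z) : fam_smooth X (fun z => z.1.2) z.
Proof.
move=> a da; apply: (smooth_at_lin (l := snd)) (smooth_at_fst _ _); first by move=> ? ? ?.
by move=> v; exact: cvg_snd.
Qed.

Variables (g : M -> tvec M -> tvec M -> R) (eps : M -> R) (F0 : K -> R -> M -> jet M).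
Hypothesis (rg : riemannian_metric g) (ceps : continuous eps) (eps_gt0 : forall p, 0 < eps p).
Hypothesis gF : good k F0.

Lemma metric_chart i : exists Gm : 'rV[R]_n -> 'M[R]_n, smooth_on (chart_image i) Gm /\
  forall p, dom i p -> (forall u, tangent p u -> g p u u = qform (Gm (chart i p)) (u i)) /\
    (forall u, tangent p u -> 0 <= g p u u).
Proof.
have [h1 h2] := rg; have [Gm [sG hG]] := h1 i; exists Gm; split=> // p dp.
have [_ e] := hG p dp; split=> [u tu|u tu]; first exact: e.
have [u0|u0] := pselect (u = 0); last by rewrite ltW // h2.
by rewrite e // u0 -[(0 : tvec M) i]/(0 : 'rV[R]_n) !mul0mx mxE.
Qed.

Definition close_to G t : Prop :=
  planes_close g t.2 (eps t.2) (jet0 t.2 (G t.1.1 t.1.2 t.2)) (jet0 t.2 (F0 t.1.1 t.1.2 t.2)).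

(** The square is nonnegative, so the sum over all [f] is positive as soon as one minor is
    invertible. *)
Definition detsq f (P : 'M[R]_n) : R := \det (mxsub f f P) ^+ 2.

(* The open condition that survives the steps of one stage: closeness to F0, and
   principal minors close to those of G, so that the covering of the support by
   regular sets found for G remains usable. *)
Definition near_pred i G (c : R) (z : Z) (B : 'M[R]_(k, n)) : Prop :=
  [/\ row_free B,
   planes_close g (chart_inv i z.2) (eps (chart_inv i z.2)) (plane i (chart_inv i z.2) B)
     (jet0 (chart_inv i z.2) (F0 z.1.1 z.1.2 (chart_inv i z.2))) &
   forall f, `|detsq f (row_proj B) - detsq f (coord0 G i z)| < c].

Lemma gram_row_free (B : 'M[R]_(k, n)) : \det (B *m B^T) != 0 -> row_free B.
Proof.
move=> h; apply/row_freeP; exists (B^T *m invmx (B *m B^T)).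
by rewrite mulmxA mulmxV // unitmxE unitfE.
Qed.

Lemma fam_smooth_detsq f G i (z : Z) : fam_smooth (chart_image i) (coord0 G i) z ->
  fam_smooth (chart_image i) (fun z => detsq f (coord0 G i z)) z.
Proof.
by move=> h; apply: fam_smoothM; apply: fam_smooth_det; exact: fam_smooth_mxsub.
Qed.

Lemma near_pred_open i G c (z : Z) B : good k G -> fam_dom (chart_image i) z ->
  near_pred i G c z B ->
  \forall t \near (z, B), fam_dom (chart_image i) t.1 -> near_pred i G c t.1 t.2.
Proof.
move=> gG Dz [fB cB dB]; have [zs zx] := Dz; have [dp ep] := chart_invK zx.
pose FF := within [set t : Z * 'M[R]_(k, n) | fam_dom (chart_image i) t.1] (nbhs (z, B)).
have FFF : Filter FF by exact: within_filter.
have c2 : t.2 @[t --> FF] --> B by apply: cvg_within_filter; exact: cvg_snd.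
have c1 : t.1 @[t --> FF] --> z by apply: cvg_within_filter; exact: cvg_fst.
have pull (W : normedModType R) (h : Z -> W) : fam_smooth (chart_image i) h z ->
    h t.1 @[t --> FF] --> h z.
  move=> /(fam_smooth_cvg Dz) ch A /ch hA.
  have {}hA : \forall y \near z, fam_dom (chart_image i) y -> A (h y) := hA.
  have c1' : t.1 @[t --> (z, B)] --> z by exact: cvg_fst.
  exact: (c1' _ hA).
have pullB (W : normedModType R) (h : 'M[R]_(k, n) -> W) : smooth_at setT B h ->
    h t.2 @[t --> FF] --> h B.
  move=> hs A hA; have ch := smooth_at_cvg (I : setT B) hs hA.
  have {}ch : \forall y \near B, setT y -> A (h y) := ch.
  have h3 : \forall y \near B, A (h y).
    by apply: (@filterS _ _ (nbhs_filter B) _ _ _ ch) => y; exact.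
  exact: (c2 _ h3).
have sid : smooth_at setT B id by exact: smooth_at_id.
have srp := smooth_at_row_proj (I : setT B) fB sid.
have nF : \forall t \near FF, row_free t.2.
  have sg : smooth_at setT B (fun A : 'M[R]_(k, n) => \det (A *m A^T)).
    by apply: smooth_at_det; apply: smooth_at_mulmx => //; exact: smooth_at_tr.
  have /cvgrPdist_lt cg := pullB _ _ sg.
  have := gram_unitmx fB; rewrite unitmxE unitfE -normr_gt0 => /cg.
  apply: filterS => t ht; apply: gram_row_free; apply/negP => /eqP e.
  by move: ht; rewrite e subr0 ltxx.
have nD : \forall t \near FF, forall f, `|detsq f (row_proj t.2) - detsq f (coord0 G i t.1)| < c.
  apply: filter_forall => f.
  have [c0 _] := coord0_smooth gG Dz.
  have h1 := pull _ _ (fam_smooth_detsq f c0).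
  have h2 : detsq f (row_proj t.2) @[t --> FF] --> detsq f (row_proj B).
    apply: (pullB _ (fun A => detsq f (row_proj A))).
    by apply: smooth_atM; apply: smooth_at_det; exact: smooth_at_mxsub.
  have h3 := @cvg_norm _ _ _ _ FFF _ _ (@cvgB _ _ _ _ FFF _ _ _ _ h2 h1).
  have pos : 0 < c - `|detsq f (row_proj B) - detsq f (coord0 G i z)| by rewrite subr_gt0.
  have /cvgrPdist_lt /(_ _ pos) := h3; apply: filterS => t.
  by rewrite distrC => /(le_lt_trans (ler_norm _)); rewrite ltrBlDr subrK.
have [[JF _] _] := gF (t := (z.1, chart_inv i z.2)) zs.
have [P1 P2 P3 _] := jet0_plane dp JF; rewrite /= ep in P1 P2 P3.
(* An affine chart of the Grassmannian for the plane of [F0] at [z], so that closeness is expressed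
   by frames depending continuously on the point. *)
have [f' u] := rank_proj_frame P3 P1 P2.
have r0 : regular f' i F0 z by [].
have [c0F c1F] := coord0_smooth gF Dz.
have cW0 := pull _ _ (fam_smooth_frame0 Dz u c0F).
have [Gm [sG hG]] := metric_chart i.
have cG : Gm t.1.2 @[t --> FF] --> Gm z.2.
  have /(smooth_at_cvg zx) ch : smooth_at (chart_image i) z.2 Gm by exact: sG.
  move=> A /ch hA.
  have {}hA : \forall y \near z.2, chart_image i y -> A (Gm y) := hA.
  have ct : t.1.2 @[t --> (z, B)] --> z.2.
    case: (z) => z1 z2; apply: (cvg_comp _ _ (@cvg_fst _ _ (nbhs (z1, z2)) (nbhs B) _)); exact: cvg_snd.
  have : \forall t \near (z, B), chart_image i t.1.2 -> A (Gm t.1.2) := ct _ hA.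
  by apply: filterS => t ht [_ tx]; exact: ht.
have ce : eps (chart_inv i t.1.2) @[t --> FF] --> eps (chart_inv i z.2).
  move=> A hA.
  have h1 : \forall q \near chart_inv i z.2, A (eps q) by exact: (ceps hA).
  have h2 := near_chart_inv2 zx h1.
  have ct : t.1.2 @[t --> FF] --> z.2.
    apply: (cvg_comp _ _ c1); case: (z) => z1 z2; exact: cvg_snd.
  exact: (ct _ h2).
have eqv (y : Z) (A : 'M[R]_(k, n)) : fam_dom (chart_image i) y -> regular f' i F0 y -> row_free A ->
    planes_close g (chart_inv i y.2) (eps (chart_inv i y.2)) (plane i (chart_inv i y.2) A)
     (jet0 (chart_inv i y.2) (F0 y.1.1 y.1.2 (chart_inv i y.2))) <->
    frames_close (eps (chart_inv i y.2)) (Gm y.2) A (frame0 f' F0 i y) /\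
    frames_close (eps (chart_inv i y.2)) (Gm y.2) (frame0 f' F0 i y) A.
  move=> Dy ry fA; have [dq eq eF nW nE] := frame_at gF ry.
  rewrite eF (jet0_frame_jet _ dq nW).
  have [gE g0] := hG _ dq; rewrite eq in gE.
  by apply: planes_closeP => //; exact: normalized_free nW.
have [k1 k2] := (eqv z B Dz r0 fB).1 cB.
have n1 := @frames_close_near R _ FF FFF _ _ _ _ _ _ _ _ _ _ ce cG c2 cW0 k1.
have n2 := @frames_close_near R _ FF FFF _ _ _ _ _ _ _ _ _ _ ce cG cW0 c2 k2.
have nr : \forall t \near FF, regular f' i F0 t.1.
  have h := regular_open gF r0.
  have c1' : t.1 @[t --> (z, B)] --> z by exact: cvg_fst.
  have : \forall t \near (z, B), fam_dom (chart_image i) t.1 -> regular f' i F0 t.1 := c1' _ h.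
  exact.
suff : \forall t \near FF, near_pred i G c t.1 t.2 by [].
have nDm : \forall t \near FF, fam_dom (chart_image i) t.1.
  have : \forall t \near (z, B), fam_dom (chart_image i) t.1 -> fam_dom (chart_image i) t.1.
    by apply: (@filterE _ _ (nbhs_filter _)).
  exact.
have h12 := @filterI _ _ FFF _ _ (@filterI _ _ FFF _ _ n1 n2) (@filterI _ _ FFF _ _ nr nDm).
apply: (@filterS2 _ _ FFF _ _ _ _ (@filterI _ _ FFF _ _ nF nD) h12) => t [h1 h2] [[h3 h4] [h5 h6]].
by split=> //; apply/eqv.
Qed.

End FullStage.

Section FullStage.
Context {R : realType} {n d : nat} {M : manifold R n} {K : manifold_with_boundary R d}.
Local Notation Z := (K * R * 'rV[R]_n)%type.
Local Notation T := (K * R * M)%type.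
Variable k : nat.
Implicit Types (G : K -> R -> M -> jet M) (i j : chart_index M) (p : M) (t : T)
  (f : {ffun 'I_k -> 'I_n}).
Variables (g : M -> tvec M -> tvec M -> R) (eps : M -> R) (F0 : K -> R -> M -> jet M).
Hypothesis (rg : riemannian_metric g) (ceps : continuous eps) (eps_gt0 : forall p, 0 < eps p).
Hypothesis gF : good k F0.

Section Bump.
Variables (i : chart_index M) (C : set M) (b : M -> R) (bK : K -> R).
Hypothesis (cK : compact [set: K]) (cC : compact C) (Ci : C `<=` dom i).
Hypothesis (sb : manifold_smooth b) (sbK : manifold_smooth bK).
Hypothesis (b_ge0 : forall p, 0 <= b p) (bK_ge0 : forall q, 0 <= bK q).
Hypothesis b_out : forall p, ~ C p -> b p = 0.
Local Notation X := (chart_image i).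

Definition support_box : set Z := [set z | 0 <= z.1.2 <= 1 /\ X z.2 /\ C (chart_inv i z.2)].

Lemma support_box_compact : compact support_box.
Proof.
pose phi (t : T) : Z := (t.1, chart i t.2).
have cA := compact_setX (compact_setX cK (@segment_compact R 0 1)) cC.
have -> : support_box = phi @` (([set: K] `*` `[0, 1]) `*` C).
  apply/seteqP; split=> [z [zs [zx zC]]|_ [[[q s] p] [[_ /= hs] Cp] <-]].
    exists (z.1, chart_inv i z.2); first by split=> //; split=> //=; rewrite in_itv.
    have [_ e] := chart_invK zx; by rewrite /phi /= e -surjective_pairing.
  have dp := Ci Cp.
  rewrite /support_box /phi /= chartK //; split; first by move: hs; rewrite in_itv.
  by split=> //; exact: chart_image_dom.
apply: continuous_compact cA; apply: continuous_in_subspaceT => t /set_mem[_ /Ci dt].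
move=> A hA; have h := near_coord_chart dt hA.
exact: h.
Qed.

Lemma closed_C : closed C.
Proof. by apply: compact_closed => //; exact: manifold_hausdorff. Qed.

(* The factor z.1.2 = s makes the homotopy start at G. *)
Definition cutoff f G (c : R) (z : Z) : R :=
  if 0 <= z.1.2 <= 1 then z.1.2 * bK z.1.1 * b (chart_inv i z.2) *
    smooth_step (detsq f (coord0 G i z) / c - 1) else 0.

Lemma cutoff_ge0 f G c z : 0 <= cutoff f G c z.
Proof.
rewrite /cutoff; case: ifP => // /andP[s0 _].
have /andP[h _] := smooth_step_bounds (detsq f (coord0 G i z) / c - 1).
by rewrite mulr_ge0 // mulr_ge0 // mulr_ge0.
Qed.

Lemma fam_smooth_cutoff f G c z : good k G -> fam_dom X z -> fam_smooth X (cutoff f G c) z.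
Proof.
move=> gG Dz; have [c0 _] := coord0_smooth gG Dz.
have h : fam_smooth X (fun z : Z => z.1.2 * bK z.1.1 * b (chart_inv i z.2) *
    smooth_step (detsq f (coord0 G i z) / c - 1)) z.
  apply: fam_smoothM; first apply: fam_smoothM; first apply: fam_smoothM.
  - exact: fam_smooth_time.
  - exact: fam_smooth_param.
  - exact: fam_smooth_base.
  apply: (fam_smooth_fun1 Dz (@Cr_on_smooth_step R)).
  apply: fam_smoothD; last exact: fam_smooth_cst.
  by apply: fam_smoothM; [exact: fam_smooth_detsq|exact: fam_smooth_cst].
by apply: fam_smooth_eqA h => y [ys _]; rewrite /cutoff ys.
Qed.

Definition det_large f G c : set Z := support_box `&` [set z | c <= detsq f (coord0 G i z)].

Lemma det_large_compact f G c : good k G -> compact (det_large f G c).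
Proof.
move=> gG; apply: compact_superlevel support_box_compact _ => z [zs [zx zC]].
have Dz : fam_dom X z by [].
have [c0 _] := coord0_smooth gG Dz.
move=> A /(fam_smooth_cvg Dz (fam_smooth_detsq f c0)) h.
have {}h : \forall y \near z, fam_dom X y -> A (detsq f (coord0 G i y)) := h.
suff : \forall y \near z, support_box y -> A (detsq f (coord0 G i y)) by [].
apply: (@filterS _ _ (nbhs_filter z) _ _ _ h) => y hy [ys [yx _]]; exact: hy.
Qed.

Lemma det_large_regular f G c : 0 < c -> det_large f G c `<=` regular f i G.
Proof.
move=> c0 z [[zs [zx _]] cz]; split=> //; rewrite unitmxE unitfE.
by rewrite -sqrf_eq0 gt_eqF // (lt_le_trans c0).
Qed.

(** Either the point is off the closed set [C], or its minor is below [c], where [smooth_step]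
    vanishes; both persist nearby. Times outside [[0, 1]] need no care, as the cutoff is [0] there
    by definition. *)
Lemma cutoff_out f G c t : 0 < c -> good k G -> 0 <= t.1.2 <= 1 ->
  ~ (dom i t.2 /\ det_large f G c (t.1, chart i t.2)) ->
  \forall t' \near t, dom i t'.2 -> cutoff f G c (t'.1, chart i t'.2) = 0.
Proof.
move=> c0 gG ts nS.
have [Ct|nC] := pselect (C t.2); last first.
  have h : \forall p \near t.2, ~ C p.
    by apply: open_nbhs_nbhs; split=> //; exact: closed_openC closed_C.
  have ct : t'.2 @[t' --> t] --> t.2 by case: (t) => t1 t2; exact: cvg_snd.
  apply: (@filterS _ _ (nbhs_filter t) _ _ _ (ct _ h)) => t' nCt dt'.
  by rewrite /cutoff /= chartK // b_out // mulr0 mul0r if_same.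
have dt := Ci Ct.
have Dz : fam_dom X (t.1, chart i t.2) by split=> //; exact: chart_image_dom.
have lt : detsq f (coord0 G i (t.1, chart i t.2)) < c.
  rewrite ltNge; apply/negP => le; apply: nS; split=> //; split=> //.
  by split=> //; split; [exact: chart_image_dom|rewrite /= chartK].
have [c0' _] := coord0_smooth gG Dz.
have /cvgrPdist_lt /(_ (c - detsq f (coord0 G i (t.1, chart i t.2)))) := fam_smooth_cvg Dz (fam_smooth_detsq f c0').
rewrite subr_gt0 => /(_ lt) hn.
pose z0 : Z := (t.1, chart i t.2).
have {}hn : \forall y \near z0, fam_dom X y -> `|detsq f (coord0 G i z0) - detsq f (coord0 G i y)| < c - detsq f (coord0 G i z0) := hn.
have h := near_coord_chart dt hn.
apply: (@filterS _ _ (nbhs_filter t) _ _ _ h) => t' ht' dt'.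
rewrite /cutoff /=; case: ifP => // ts'.
have := ht' (conj ts' (chart_image_dom dt')).
rewrite distrC => /(le_lt_trans (ler_norm _)); rewrite ltrBlDr subrK => lt'.
by rewrite smooth_step0 ?mulr0 // subr_le0 ler_pdivrMr // mul1r ltW.
Qed.

(** Every plane lies in some affine chart of the Grassmannian, so the sum over [f] is positive, and
    bounded below on the compact support. The factor [3] leaves room: minors may drift by less than
    [c] during the stage and remain above [2 c], where the factor [smooth_step] of the cutoff is
    [1]. *)
Lemma det_lower_bound G : good k G -> exists2 c : R, 0 < c &
  forall z, support_box z -> exists f, 3%:R * c <= detsq f (coord0 G i z).
Proof.
move=> gG.
have [m m0 Hm] : exists2 e : R, 0 < e & forall m, `|m| < e -> forall z (u : R), support_box z -> [set (0 : R)] u ->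
    m < \sum_(f : {ffun 'I_k -> 'I_n}) detsq f (coord0 G i z).
  apply: (@tube _ _ _ K X (R : topologicalType) [set (0 : R)] support_box
    (fun m w => m < \sum_(f : {ffun 'I_k -> 'I_n}) detsq f (coord0 G i w.1))).
  - exact: support_box_compact.
  - exact: compact_set1.
  - by move=> z [zs [zx _]].
  move=> z u [zs [zx _]] _; have Dz : fam_dom X z by [].
  have [c0 _] := coord0_smooth gG Dz.
  have [dp ep] := chart_invK zx.
  have [[J _] _] := gG (z.1, chart_inv i z.2) zs.
  have [P1 P2 P3 _] := jet0_plane dp J; rewrite /= ep in P1 P2 P3.
  have [f' u'] := rank_proj_frame P3 P1 P2.
  have G0 : 0 < \sum_(f : {ffun 'I_k -> 'I_n}) detsq f (coord0 G i z).
    rewrite (bigD1 (finfun f')) //= ltr_wpDr //.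
      by apply: sumr_ge0 => f _; exact: sqr_ge0.
    have -> : detsq (finfun f') (coord0 G i z) = \det (mxsub f' f' (coord0 G i z)) ^+ 2.
      by rewrite /detsq; congr (\det _ ^+ 2); apply/matrixP => a c; rewrite !mxE !ffunE.
    by rewrite exprn_even_gt0 //= -unitfE -unitmxE.
  have cs : tube_cont X (fun t : Z * (R : topologicalType) * R => \sum_(f : {ffun 'I_k -> 'I_n}) detsq f (coord0 G i t.1.1) + - t.2) z u.
    apply: tube_contD; last by apply: tube_contN; exact: tube_cont_k.
    apply: tube_cont_sum => f.
    exact: (@tube_cont_fam R n d K X _ _ (fun z => detsq f (coord0 G i z)) z u Dz (fam_smooth_detsq f c0)).
  have := tube_gt0 Dz cs; rewrite /= oppr0 addr0 => /(_ G0).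
  by apply: filterS => t h /h; rewrite subr_gt0.
(* The successor makes [N] positive without a count of the maps [f]. *)
pose N : R := #|{ffun 'I_k -> 'I_n}|.+1%:R.
have N0 : 0 < N by rewrite ltr0n.
have c0 : 0 < m / 2 / (3%:R * N) by rewrite !divr_gt0 // mulr_gt0.
exists (m / 2 / (3%:R * N)) => // z bz.
have m2 : `|m / 2| < m by rewrite ger0_norm ?divr_ge0 ?ltW // ltr_pdivrMr // ltr_pMr // ltr1n.
have := Hm _ m2 z 0 bz erefl.
apply: contraPP => /forallNP h; apply/negP; rewrite -leNgt.
apply: (@le_trans _ _ (\sum_(f : {ffun 'I_k -> 'I_n}) m / 2 / N)).
  apply: ler_sum => f _; have /negP := h f; rewrite -ltNge => /ltW hf.
  apply: (le_trans hf); rewrite le_eqVlt; apply/orP; left; apply/eqP; field.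
  by rewrite gt_eqF.
have A0 : 0 <= m / 2 by rewrite divr_ge0 // ltW.
rewrite sumr_const -[X in X <= _]mulr_natr mulrAC ler_pdivrMr // ler_wpM2l // ler_nat.
exact: leqnSn.
Qed.

Local Notation close := (close_to g eps F0).

(** [jet_stage] is run once for each [f]. By [det_lower_bound] every point over [C] has an [f] at
    whose turn the minor does not reduce the cutoff, and holonomy once reached is kept by the later
    turns. *)
Lemma full_stage G : (2 < k)%N -> good k G -> (forall t, 0 <= t.1.2 <= 1 -> close G t) ->
  exists G', [/\ good k G', forall t, 0 <= t.1.2 <= 1 -> close G' t,
    forall t, t.1.2 = 0 \/ bK t.1.1 = 0 \/ (\forall p \near t.2, b p = 0) ->
      G' t.1.1 t.1.2 t.2 = G t.1.1 t.1.2 t.2,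
    forall t, 0 <= t.1.2 <= 1 -> hol k G t -> hol k G' t &
    forall t, t.1.2 = 1 -> bK t.1.1 = 1 -> b t.2 = 1 -> hol k G' t].
Proof.
move=> k3 gG clG; have [c c0 Hc] := det_lower_bound gG.
(* The drift of the minors is measured from the initial [G], not from the previous turn, so it does
   not accumulate. *)
have main (s : seq {ffun 'I_k -> 'I_n}) : exists G', [/\ good k G' /\ (forall t, 0 <= t.1.2 <= 1 -> close G' t),
    forall z f, fam_dom X z -> `|detsq f (coord0 G' i z) - detsq f (coord0 G i z)| < c,
    forall t, t.1.2 = 0 \/ bK t.1.1 = 0 \/ (\forall p \near t.2, b p = 0) ->
      G' t.1.1 t.1.2 t.2 = G t.1.1 t.1.2 t.2,
    forall t, 0 <= t.1.2 <= 1 -> hol k G t -> hol k G' t &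
    forall t f, t.1.2 = 1 -> bK t.1.1 = 1 -> b t.2 = 1 -> f \in s ->
      3%:R * c <= detsq f (coord0 G i (t.1, chart i t.2)) -> hol k G' t].
  elim: s => [|f s [G1 [[gG1 cl1] dc1 eq1 hp1 h1]]].
    exists G; split=> //.
    by move=> z f _; rewrite subrr normr0.
  have Vo : forall z, det_large f G1 c z -> forall B : 'M[R]_(k, n), near_pred g eps F0 i G c z B ->
      \forall t \near (z, B), fam_dom X t.1 -> near_pred g eps F0 i G c t.1 t.2.
    move=> z [[zs [zx _]] _] B; exact: near_pred_open.
  have VG : forall z, regular f i G1 z -> near_pred g eps F0 i G c z (frame0 f G1 i z).
    move=> z Rz; have [[zs zx] u] := Rz; have [dp ep eG nW nE] := frame_at gG1 Rz.
    have [[J _] _] := gG1 (z.1, chart_inv i z.2) zs.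
    have [P1 P2 P3 _] := jet0_plane dp J; rewrite /= ep in P1 P2 P3.
    split; first exact: normalized_free nW.
      rewrite -(jet0_frame_jet ((frame1 f G1 i)^~ z) dp nW) -eG.
      exact: (cl1 (z.1, chart_inv i z.2) zs).
    move=> f'; rewrite /frame0 row_proj_normal_frame //.
    by apply: dc1.
  have ssm z : regular f i G1 z -> fam_smooth X (cutoff f G1 c) z.
    by move=> [Dz _]; exact: fam_smooth_cutoff.
  have sout t : 0 <= t.1.2 <= 1 -> ~ (dom i t.2 /\ det_large f G1 c (t.1, chart i t.2)) ->
    \forall t' \near t, dom i t'.2 -> cutoff f G1 c (t'.1, chart i t'.2) = 0 by exact: cutoff_out.
  have [G' [gG' inG' outG' hpG' hG']] := jet_stage gG1 (@det_large_compact f G1 c gG1)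
    (@det_large_regular f G1 c c0) Vo ssm (cutoff_ge0 f G1 c) sout VG k3.
  have outn t : ~ (dom i t.2 /\ regular f i G1 (t.1, chart i t.2)) ->
      G' t.1.1 t.1.2 t.2 = G1 t.1.1 t.1.2 t.2.
    by move=> h; apply: outG' => a1 a2; exfalso; apply: h.
  exists G'; split.
  - split=> // t ts.
    have [[dt rt]|nt] := pselect (dom i t.2 /\ regular f i G1 (t.1, chart i t.2)).
      have [B [[fB pB _] _ e _]] := inG' t dt rt.
      by rewrite /close_to e; move: pB; rewrite /= chartK.
    by rewrite /close_to outn //; exact: cl1.
  - move=> z f' Dz; have [dp ep] := chart_invK Dz.2.
    have ez : (z.1, chart i (chart_inv i z.2)) = z by rewrite ep -surjective_pairing.
    have [rz|nz] := pselect (regular f i G1 z).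
      have := inG' (z.1, chart_inv i z.2) dp; rewrite /= ez => /(_ rz)[B [[_ _ dB] _ _ e]].
      by rewrite e.
    have e : coord0 G' i z = coord0 G1 i z.
      rewrite /coord0; have := outn (z.1, chart_inv i z.2); rewrite /= ez => -> //.
      by case.
    by rewrite e; exact: dc1.
  - move=> t ht; rewrite outG'; first exact: eq1.
    move=> dt rt; case: ht => [s0|[q0|b0]].
    + apply: (@filterE _ _ (nbhs_filter _)) => x.
      by rewrite /cutoff /= s0 !mul0r if_same.
    + apply: (@filterE _ _ (nbhs_filter _)) => x.
      by rewrite /cutoff /= q0 mulr0 !mul0r if_same.
    + apply: filterS (near_chart_inv dt b0) => x bx.
      by rewrite /cutoff /= bx mulr0 mul0r if_same.
  - by move=> t ts /(hp1 t ts); exact: hpG'.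
  - move=> t f' t1 q1 p1; have ts : 0 <= t.1.2 <= 1 by rewrite t1 ler01 lexx.
    have Ct : C t.2.
      by apply: contrapT => nC; have := b_out nC; rewrite p1 => /eqP; rewrite oner_eq0.
    have dt := Ci Ct; have Dz : fam_dom X (t.1, chart i t.2) by split=> //; exact: chart_image_dom.
    rewrite inE => /predU1P[-> hf|fs hf]; last by apply: hpG' => //; exact: h1 fs hf.
    have d2 : 2%:R * c <= detsq f (coord0 G1 i (t.1, chart i t.2)).
      have := dc1 _ f Dz; rewrite distrC => /(le_lt_trans (ler_norm _)) => hh; lra.
    have rt : regular f i G1 (t.1, chart i t.2).
      split=> //; rewrite unitmxE unitfE -sqrf_eq0 gt_eqF //.
      by apply: lt_le_trans d2; rewrite mulr_gt0.
    apply: hG' => //; rewrite /cutoff /= ts t1 q1 chartK // p1 !mul1r smooth_step1 //.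
    rewrite lerBrDr ler_pdivlMr //; move: d2; rewrite (_ : 2%:R = 1 + 1) //.
have [G' [[gG' clG'] _ eG' hp h]] := main (enum {: {ffun 'I_k -> 'I_n}}).
exists G'; split=> // t t1 q1 p1; have ts : 0 <= t.1.2 <= 1 by rewrite t1 ler01 lexx.
have Ct : C t.2.
  by apply: contrapT => nC; have := b_out nC; rewrite p1 => /eqP; rewrite oner_eq0.
have dt := Ci Ct.
have [|f hf] := Hc (t.1, chart i t.2).
  by split=> //; split; [exact: chart_image_dom|rewrite /= chartK].
by apply: (h t f) => //; rewrite mem_enum.
Qed.

End Bump.
End FullStage.

(** * Bump functions on manifolds *)

Section Bumps.
Context {R : realType}.

Lemma halfspace_closed n : closed (@halfspace R n).
Proof.
have -> : @halfspace R n = \bigcap_(j in [set j : 'I_n | val j = 0%N]) [set x : 'rV[R]_n | 0 <= x ord0 j].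
  by apply/seteqP; split=> [x hx j /= j0|x hx j j0]; exact: hx.
apply: closed_bigI => j _.
rewrite -[X in closed X]/((fun x : 'rV[R]_n => x ord0 j) @^-1` [set y | 0 <= y]).
apply: preimage_closed; last exact: closed_ge.
by move=> x _; exact: coord_continuous.
Qed.

(** The square of the Euclidean distance is smooth, unlike the norm of the matrix space. *)
Definition sqdist n (x0 x : 'rV[R]_n) : R := \sum_j (x 0 j - x0 0 j) ^+ 2.

Lemma sqdist_continuous n (x0 : 'rV[R]_n) : continuous (sqdist x0).
Proof.
move=> y; apply: (@cvg_sumr R _ (nbhs y) (nbhs_filter y) R _ _
  (fun j (y : 'rV[R]_n) => (y 0 j - x0 0 j) ^+ 2) (fun j => (y 0 j - x0 0 j) ^+ 2)) => j.
have h := @coord_continuous R 1 n 0 j y.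
have h2 := @cvgB _ _ _ _ (nbhs_filter y) _ _ _ _ h (@cvg_cst _ (x0 0 j) _ _ (nbhs_filter y)).
exact: (@cvgM _ _ (nbhs y) (nbhs_filter y) _ _ _ _ h2 h2).
Qed.

Lemma sqdist_ball_closed n (x0 : 'rV[R]_n) r : closed [set x | sqdist x0 x <= r].
Proof.
rewrite -[X in closed X]/(sqdist x0 @^-1` [set y | y <= r]).
by apply: preimage_closed; [move=> x _; exact: sqdist_continuous|exact: closed_le].
Qed.

Lemma sqdist_entry n (x0 x : 'rV[R]_n) (r : R) j : 0 <= r -> sqdist x0 x <= r ^+ 2 ->
  `|x 0 j - x0 0 j| <= r.
Proof.
move=> r0 h; have h1 : (x 0 j - x0 0 j) ^+ 2 <= r ^+ 2.
  by apply: le_trans h; rewrite /sqdist (bigD1 j) //= lerDl sumr_ge0 // => ? _; exact: sqr_ge0.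
by rewrite -(ler_pXn2r (n := 2)) ?nnegrE // real_normK ?num_real.
Qed.

Lemma sqdist_ball_compact n (x0 : 'rV[R]_n) (r : R) : 0 <= r -> compact [set x | sqdist x0 x <= r ^+ 2].
Proof.
move=> r0.
pose B := [set v : 'rV[R]_n | forall i, (`[x0 0 i - r, x0 0 i + r]%classic : set R) (v ord0 i)].
have cB : compact B.
  by apply: (@rV_compact R n (fun i => (`[x0 0 i - r, x0 0 i + r]%classic : set R))) => i; exact: segment_compact.
apply: (subclosed_compact _ cB); first exact: sqdist_ball_closed.
move=> x /= hx i /=.
by rewrite in_itv /= -ler_distlC distrC; exact: sqdist_entry.
Qed.

Lemma sqdist_near n (x0 : 'rV[R]_n) (Q : set 'rV[R]_n) : nbhs x0 Q ->
  exists2 r : R, 0 < r & forall x, sqdist x0 x <= r ^+ 2 -> Q x.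
Proof.
move=> /nbhs_ballP[e /= e0 he]; exists (e / 2); first by rewrite divr_gt0.
move=> x hx; apply: he; split=> // i j; rewrite ord1 /ball /= distrC.
apply: (@le_lt_trans _ _ (e / 2)); first by apply: sqdist_entry => //; rewrite divr_ge0 // ltW.
by rewrite ltr_pdivrMr // ltr_pMr // ltr1n.
Qed.

Lemma Cr_on_sqdist n (x0 : 'rV[R]_n) r : Cr_on r setT (sqdist x0).
Proof.
have oT : open [set: 'rV[R]_n] by exact: openT.
apply: Cr_on_sum => // j _.
have h : Cr_on r setT (fun x : 'rV[R]_n => x 0 j + - x0 0 j).
  apply: Cr_onD => //; last exact: Cr_on_cst.
  by apply: Cr_on_entry => //; exact: Cr_on_id.
exact: Cr_onM.
Qed.

Variables (n : nat) (H : set 'rV[R]_n) (N : smooth_manifold_on H).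

Lemma manifold_smooth_comp (b : N -> R) (h : R -> R) : (forall r, Cr_on r setT h) ->
  manifold_smooth b -> manifold_smooth (fun p => h (b p)).
Proof.
move=> hh hb p i dp; apply: (@smooth_at_fun1 R _ (chart i @` dom i) (chart i p) (fun x => b (chart_inv i x)) h) => //.
exact: hb.
Qed.

(** Stated for any closed model set [H], so that it serves both [M] and the parameter manifold with
    boundary; closedness of [H] makes small balls of the chart compact. *)
Lemma bump (p : N) (U : set N) : closed H -> open U -> U p ->
  exists (th : N -> R) (C : set N) (i : chart_index N),
    [/\ manifold_smooth th, forall q, 0 <= th q, \forall q \near p, th q = 1,
      compact C /\ (C `<=` dom i /\ C `<=` U) & forall q, ~ C q -> th q = 0].
Proof.
move=> cH oU Up; have [i dp] := dom_cover p.
have [A1 oA1 eO1] := chart_image_open i.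
set x0 := chart i p.
have im0 : (chart i @` dom i) x0 by exists p.
have O1x : A1 x0 by move: im0; rewrite eO1 => -[].
have nU : \forall q \near p, U q by apply: open_nbhs_nbhs.
have nQ : nbhs x0 (A1 `&` [set x | (chart i @` dom i) x -> U (chart_inv i x)]).
  by apply: filterI; [exact: open_nbhs_nbhs|exact: near_chart dp nU].
have [r r0 hr] := sqdist_near nQ.
have r2 : 0 < r ^+ 2 by rewrite exprn_gt0.
(* Equal to [1] for squared distance at most [r ^+ 2 / 2], and to [0] from [r ^+ 2] on. *)
pose phi x := smooth_step (2%:R - 2%:R * sqdist x0 x / r ^+ 2).
pose B := [set x | sqdist x0 x <= r ^+ 2] `&` H.
have Bim : B `<=` chart i @` dom i.
  by move=> x [/hr[Ox _] Hx]; rewrite eO1.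
have cB : compact B.
  have cS := @sqdist_ball_compact _ x0 r (ltW r0).
  apply: (subclosed_compact _ cS); last by move=> x [].
  by apply: closedI => //; exact: sqdist_ball_closed.
pose C := chart_inv i @` B.
have cC : compact C.
  apply: continuous_compact cB; apply: continuous_subspaceW (@chart_inv_continuous _ _ _ N i).
  exact: Bim.
have CdU : C `<=` dom i /\ C `<=` U.
  split=> [_ [x Bx <-]|_ [x Bx <-]]; first by have [] := chart_invK (Bim x Bx).
  by have [/hr[_ h] _] := Bx; apply: h; exact: Bim.
pose th q := if `[< dom i q >] then phi (chart i q) else 0.
have out q : ~ C q -> th q = 0.
  move=> nC; rewrite /th; case: asboolP => // dq; rewrite /phi smooth_step0 //.
  rewrite subr_le0 -mulrA ler_peMr // ler_pdivlMr // mul1r leNgt; apply/negP => lt.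
  apply: nC; exists (chart i q); last exact: chartK.
  split; first exact: ltW.
  have : (chart i @` dom i) (chart i q) by exists q.
  by rewrite eO1 => -[].
have Cphi r' : Cr_on r' setT phi.
  have oT : open [set: 'rV[R]_n] by exact: openT.
  have [I [bb [cc fc]]] := @finite_dim_R R.
  have -> : phi = (fun x => smooth_step (2%:R + - (2%:R / r ^+ 2) * sqdist x0 x)).
    by apply/funext => x; rewrite /phi; congr smooth_step; ring.
  apply: (@Cr_on_comp R _ _ I bb cc r' setT setT smooth_step
    (fun x => 2%:R + - (2%:R / r ^+ 2) * sqdist x0 x) fc oT (@openT _)) => //.
    apply: Cr_onD => //; first exact: Cr_on_cst.
    apply: Cr_onM => //; first exact: Cr_on_cst.
    exact: Cr_on_sqdist.
  exact: Cr_on_smooth_step.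
exists th, C, i; split=> //.
- move=> q j dq.
  have [diq|ndiq] := pselect (dom i q).
    pose D := chart j @` (dom j `&` dom i).
    have Dq : D (chart j q) by exists q.
    have near_di : \forall x \near chart j q, (chart j @` dom j) x -> dom i (chart_inv j x).
      by apply: near_chart => //; apply: open_nbhs_nbhs; split=> //; exact: dom_open.
    have s1 : smooth_at D (chart j q) (fun x => phi (chart i (chart_inv j x))).
      have st : smooth_at D (chart j q) (fun x => chart i (chart_inv j x)) by exact: (transition_smooth Dq).
      apply: (smooth_at_comp (f := fun x => chart i (chart_inv j x)) (g := phi) (B := setT)) st _ => //.
      - exact: finite_dim_mx.
      - exact: (@filterE _ _ (nbhs_filter _)).
      - exact: (smooth_at_of _ (@openT _) I Cphi).
    apply: (smooth_at_eq (f := fun x => phi (chart i (chart_inv j x)))).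
      apply: filterS near_di => x hx Ax; rewrite /th asboolT //; exact: hx.
    apply: smooth_at_sub s1; apply: filterS near_di => x hx Ax.
    by have [dx ex] := chart_invK Ax; exists (chart_inv j x) => //; split=> //; exact: hx.
  have nC : ~ C q by move=> Cq; apply: ndiq; exact: CdU.1.
  have cl : closed C by apply: compact_closed => //; exact: manifold_hausdorff.
  have nn : \forall q' \near q, ~ C q' by apply: open_nbhs_nbhs; split=> //; exact: closed_openC.
  apply: (smooth_at_eq (f := fun=> 0)); last exact: smooth_at_cst.
  by apply: filterS (near_chart dq nn) => x hx Ax; rewrite out //; exact: hx.
- by move=> q; rewrite /th; case: asboolP => // _; case/andP: (smooth_step_bounds (2%:R - 2%:R * sqdist x0 (chart i q) / r ^+ 2)).
- have nd : \forall q \near p, dom i q by apply: open_nbhs_nbhs; split=> //; exact: dom_open.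
  have ns : \forall x \near x0, sqdist x0 x < r ^+ 2 / 2.
    have c := @sqdist_continuous n x0 x0.
    have e0 : sqdist x0 x0 = 0 by rewrite /sqdist big1 // => j _; rewrite subrr expr0n.
    have h : \forall y \near sqdist x0 x0, y < r ^+ 2 / 2.
      by rewrite e0; apply: open_nbhs_nbhs; split; [exact: open_lt|rewrite /= divr_gt0].
    exact: (c _ h).
  have nc : \forall q \near p, sqdist x0 (chart i q) < r ^+ 2 / 2 by exact: (chart_cont dp ns).
  apply: filterS2 nd nc => q dq hq; rewrite /th asboolT // /phi smooth_step1 //.
  have : 2%:R * sqdist x0 (chart i q) / r ^+ 2 <= 1.
    by rewrite ler_pdivrMr // mul1r; lra.
  lra.
Qed.

(* [compact_cover] would require N to be pointed. *)
Lemma finite_subcover (A : set N) (O : N -> set N) : compact A ->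
  (forall p, A p -> open_nbhs p (O p)) ->
  exists s : seq N, (forall p, p \in s -> A p) /\ forall q, A q -> exists2 p, p \in s & O p q.
Proof.
move=> cA hO; have /compact_near_coveringP nc := cA.
pose F : set_system (seq N) := [set P | exists2 s0 : seq N, (forall p, p \in s0 -> A p) &
  forall s : seq N, {subset s0 <= s} -> P s].
have FF : Filter F.
  split; first by exists [::].
    move=> P Q [s1 A1 h1] [s2 A2 h2]; exists (s1 ++ s2).
      by move=> p; rewrite mem_cat => /orP[/A1|/A2].
    move=> s hs; split; [apply: h1|apply: h2] => p ps; apply: hs; rewrite mem_cat ps ?orbT //.
  by move=> P Q PQ [s0 A0 h0]; exists s0 => // s hs; apply: PQ; exact: h0.
have [|s0 A0 h0] := nc _ F (fun s q => exists2 p, p \in s & O p q) FF.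
  move=> p Ap; have [oO Op] := hO p Ap.
  exists (O p, [set s : seq N | p \in s]); first split=> /=.
  - exact: open_nbhs_nbhs.
  - exists [:: p]; first by move=> q; rewrite inE => /eqP ->.
    by move=> s hs; apply: hs; rewrite inE.
  - by move=> [q s] /= [h1 h2]; exists p.
by exists s0; split=> // q Aq; exact: (h0 s0 (fun _ => id) q Aq).
Qed.

Lemma cutoff_near (K' Q : set N) : closed H -> compact [set: N] -> closed K' -> open Q -> K' `<=` Q ->
  exists bK : N -> R, [/\ manifold_smooth bK, forall q, 0 <= bK q, forall q, ~ Q q -> bK q = 1 &
    exists Q', [/\ open Q', K' `<=` Q' & forall q, Q' q -> bK q = 0]].
Proof.
move=> cH cN cK' oQ KQ.
have cK : compact K' by apply: subclosed_compact cK' cN _.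
have data p : exists th : N -> R, K' p -> [/\ manifold_smooth th, forall q, 0 <= th q,
    \forall q \near p, th q = 1 & forall q, ~ Q q -> th q = 0].
  have [Kp|nK] := pselect (K' p); last by exists (fun=> 0).
  have [th [C [i [h1 h2 h3 [_ [_ CQ]] h5]]]] := bump cH oQ (KQ p Kp).
  by exists th => _; split=> // q nQ; apply: h5 => Cq; apply: nQ; exact: CQ.
have [th hth] := choice data.
(* Of [th] only nonnegativity is known; [smooth_step] forces the values into [[0, 1]], so that the
   factors [1 - st] are nonnegative. *)
pose st p q := smooth_step (th p q).
have [|s [sK sc]] := finite_subcover (A := K') (O := fun p => [set q | th p q = 1]°) cK.
  move=> p Kp; split; first exact: open_interior.
  by have [_ _ h _] := hth p Kp.
exists (fun q => \prod_(p <- s | p \in s) (1 - st p q)); split.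
- move=> q i dq.
  apply: (@smooth_at_prod R _ _ _ N s (fun p => p \in s) (fun p x => 1 - st p (chart_inv i x))) => p ps.
  have [h _ _ _] := hth p (sK p ps).
  apply: smooth_atB; first exact: smooth_at_cst.
  by apply: (manifold_smooth_comp (b := th p)) => //; exact: Cr_on_smooth_step.
- move=> q; apply: prodr_ge0 => p _; rewrite subr_ge0.
  by case/andP: (smooth_step_bounds (th p q)).
- move=> q nQ; apply: big1 => p ps; have [_ _ _ h] := hth p (sK p ps).
  by rewrite /st h // smooth_step0 // subr0.
- exists (\bigcup_(p in [set p | p \in s]) [set q | th p q = 1]°); split.
  + by apply: bigcup_open => p _; exact: open_interior.
  + by move=> q Kq; have [p ps h] := sc q Kq; exists p.
  + move=> q [p /= ps h]; have e : th p q = 1 by exact: (interior_subset h).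
    by rewrite (big_rem p) //= ps /st e smooth_step1 // subrr mul0r.
Qed.

(** Indices number the members of a countable base: each member contained in some [O p] selects one
    such [p], and the remaining indices may give [None]. *)
Lemma countable_subcover (O : N -> set N) : (forall p, open_nbhs p (O p)) ->
  exists e : nat -> option N, forall q, exists l p, e l = Some p /\ O p q.
Proof.
move=> hO; have [B cB [Bo Bb]] := @manifold_second_countable _ _ _ N.
have [f inj] := (countable_injP _ cB).
have data (l : nat) : exists o : option N, forall b p, B b -> f b = l -> b `<=` O p ->
    exists p', o = Some p' /\ b `<=` O p'.
  have [[b [p [Bb' fb bO]]]|h] := pselect (exists b p, [/\ B b, f b = l & b `<=` O p]).
    exists (Some p) => b' p' Bb1 fb1 _; exists p; split=> //.
    by have -> : b' = b; first by apply: inj; rewrite ?inE // fb.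
  by exists None => b p Bb' fb bO; exfalso; apply: h; exists b, p.
have [e he] := choice data; exists e => q.
have [oO Oq] := hO q.
have [b /= [Bb' bq] bO] := Bb q _ (open_nbhs_nbhs (conj oO Oq)).
have [p' [ep bp]] := he (f b) b q Bb' erefl bO.
by exists (f b), p'; split=> //; exact: bp.
Qed.

End Bumps.

(** * The homotopy *)

Section Homotopy.
Context {R : realType} {n d : nat} {M : manifold R n} {K : manifold_with_boundary R d}.
Local Notation Z := (K * R * 'rV[R]_n)%type.
Local Notation T := (K * R * M)%type.
Variable k : nat.
Implicit Types (G : K -> R -> M -> jet M) (i j : chart_index M) (p : M) (q : K) (t : T).

Lemma formal_family_good (F : K -> M -> jet M) : formal_family (step2_relation k) F ->
  good k (fun q _ p => F q p).
Proof.
move=> [rF sF] [[q s] p] /= ss; split; first exact: rF.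
move=> i dp.
have comp (f : K -> 'rV[R]_n -> 'M[R]_n) :
    (forall a, smooth_on ((chart a @` dom a) `*` chart_image i) (fun z => f (chart_inv a z.1) z.2)) ->
    fam_smooth (chart_image i) (fun z : Z => f z.1.1 z.2) (q, s, chart i p).
  move=> hf a dq; have h := hf a (chart a q, chart i p).
  have {}h := h (conj (ex_intro2 _ _ q dq erefl) (chart_image_dom dp)).
  have Pz : param_dom (chart_image i) a (param_coord a (q, s, chart i p)).
    by apply: param_dom_coord => //; split=> //; exact: chart_image_dom.
  apply: (smooth_at_comp_mx (f := fun v : 'rV[R]_d * R * 'rV[R]_n => (v.1.1, v.2))
     (g := fun z => f (chart_inv a z.1) z.2) (B := (chart a @` dom a) `*` chart_image i)) => //.
  - by apply: finite_dim_pair; exact: finite_dim_mx.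
  - by apply: (@filterE _ _ (nbhs_filter _)) => v [[]].
  - apply: smooth_at_pair; last exact: smooth_at_snd.
    apply: (smooth_at_lin (l := fst)) (smooth_at_fst _ _); first by move=> ? ? ?.
    by move=> v; exact: cvg_fst.
split=> [|v].
  apply: (comp (fun q x => jet_coord0 i (F q (chart_inv i x)) x)) => a.
  by have [h _] := sF a i.
apply: (comp (fun q x => jet_coord1 i (F q (chart_inv i x)) x v)) => a.
by have [_ h] := sF a i; exact: h.
Qed.

Lemma good_formal_homotopy G : good k G -> formal_homotopy (step2_relation k) G.
Proof.
move=> gG; split=> [q s p ss|a i]; first by have [] := gG (q, s, p) ss.
have pt (v : 'rV[R]_d * R * 'rV[R]_n) : param_dom (chart_image i) a v ->
    exists t, [/\ 0 <= t.1.2 <= 1, dom i t.2, dom a t.1.1 &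
      param_coord a (t.1, chart i t.2) = v].
  case: v => [[y s] x] [[/= ya ss] xi]; have [da ea] := chart_invK ya.
  have [di ei] := chart_invK xi; exists (chart_inv a y, s, chart_inv i x).
  by rewrite /param_coord /= ea ei.
split=> [v Av|w v Av].
  have [t [ts dt da <-]] := pt v Av; have [_ h] := gG t ts.
  by have [h0 _] := h i dt; exact: h0.
have [t [ts dt da <-]] := pt v Av; have [_ h] := gG t ts.
by have [_ h0] := h i dt; exact: h0.
Qed.

Lemma holonomic_hol G (t : T) (U : set M) : open U -> U t.2 ->
  holonomic_on k U (G t.1.1 t.1.2) -> hol k G t.
Proof.
move=> oU Ut [xi dxi e]; rewrite /hol (e _ Ut); apply: jet1_eq; apply: same_jet1_near.
have nU : \forall p \near t.2, U p by apply: open_nbhs_nbhs.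
apply: filterS nU => p Up; rewrite e // (jet0_jet1 (k := k)) //.
by exists U.
Qed.

Lemma hol_holonomic G q s : good k G -> 0 <= s <= 1 -> (forall p, hol k G (q, s, p)) ->
  holonomic_on k [set: M] (G q s).
Proof.
move=> gG ss hG; exists (fun p => jet0 p (G q s p)); last by move=> p _; exact: (hG p).
split=> [p _|i].
  have [[[xi ls ->] _] _] := gG (q, s, p) ss.
  by rewrite jet0_jet1 //; exact: local_section_grassmann ls.
move=> _ [p [dp _] <-].
have Dz : fam_dom (chart_image i) (q, s, chart i p) by split=> //; exact: chart_image_dom.
have [c0 _] := coord0_smooth gG Dz.
have h := fam_smooth_slice Dz c0.
have {}h : smooth_at (chart_image i) (chart i p) (fun x => coord0 G i (q, s, x)) := h.
apply: (smooth_at_eqA (f := fun x => coord0 G i (q, s, x))).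
  move=> _ [p' [dp' _] <-].
  have [[J _] _] := gG (q, s, p') ss.
  have [P1 P2 P3 P4] := jet0_plane dp' J.
  rewrite /coord0 /= chartK // /plane_coord chartK // P4 (plane_image _ dp').
  by rewrite orth_projE.
by apply: smooth_at_sub h; apply: (@filterE _ _ (nbhs_filter _)) => x [p' [dp' _] <-]; exact: chart_image_dom.
Qed.

Variables (g : M -> tvec M -> tvec M -> R) (eps : M -> R) (F : K -> M -> jet M).
Hypothesis (rg : riemannian_metric g) (ceps : continuous eps) (eps_gt0 : forall p, 0 < eps p).
Hypothesis (fF : formal_family (step2_relation k) F) (cK : compact [set: K]) (k3 : (2 < k)%N).
Variables (M' U : set M) (K' Q : set K).
Hypothesis (cM' : closed M') (oU : open U) (MU : M' `<=` U) (hU : forall q, holonomic_on k U (F q)).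
Hypothesis (cK' : closed K') (oQ : open Q) (KQ : K' `<=` Q)
  (hQ : forall q, Q q -> holonomic_on k [set: M] (F q)).

Local Notation F0 := (fun q (_ : R) p => F q p).
Local Notation close := (close_to g eps F0).

Lemma planes_close_refl t : 0 <= t.1.2 <= 1 -> close F0 t.
Proof.
move=> ts; have gF := formal_family_good fF.
have [[J _] _] := gF t ts.
have sub w : jet0 t.2 (F t.1.1 t.2) w -> tangent t.2 w.
  have [i dt] := dom_cover t.2; have [_ _ _ ->] := jet0_plane dt J; by case.
have [_ gpos] := rg.
have h v : jet0 t.2 (F t.1.1 t.2) v -> v <> 0 -> exists2 w, jet0 t.2 (F t.1.1 t.2) w &
    Num.sqrt (g t.2 (v - w) (v - w)) < eps t.2 * Num.sqrt (g t.2 v v).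
  move=> hv v0; exists v => //; rewrite subrr.
  have -> : g t.2 0 0 = 0.
    have [i dt] := dom_cover t.2; have [Gm [_ hG]] := metric_chart rg i.
    have [hg _] := hG _ dt; rewrite (hg _ (tangent0 t.2)).
    by rewrite -[(0 : tvec M) i]/(0 : 'rV[R]_n) /qform !mul0mx mxE.
  rewrite sqrtr0 mulr_gt0 // sqrtr_gt0; apply: gpos => //; exact: sub.
by split.
Qed.

(** Bumps centred in [M'] live inside [U], where the family is holonomic already, and their stages
    will do nothing. The others avoid [M'], so their stages change nothing near [M']. *)
Lemma bump_data p : exists (D : (M -> R) * set M * chart_index M),
  [/\ manifold_smooth D.1.1, forall p', 0 <= D.1.1 p', \forall p' \near p, D.1.1 p' = 1,
    compact D.1.2 /\ (D.1.2 `<=` dom D.2 /\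
      ((M' p -> D.1.2 `<=` U) /\ (~ M' p -> forall p', M' p' -> ~ D.1.2 p'))) &
    forall p', ~ D.1.2 p' -> D.1.1 p' = 0].
Proof.
have cT : closed [set: 'rV[R]_n] by exact: closedT.
have [Mp|nMp] := pselect (M' p).
  have [th [C [i [h1 h2 h3 [h4 [h5 h6]] h7]]]] := bump cT oU (MU Mp).
  by exists (th, C, i); split=> //; split=> //; split=> //; split.
have [th [C [i [h1 h2 h3 [h4 [h5 h6]] h7]]]] := bump cT (closed_openC cM') nMp.
exists (th, C, i); split=> //; split=> //; split=> //; split=> // _ p' Mp' Cp'.
exact: (h6 p' Cp').
Qed.

Lemma homotopy_exists : exists G, [/\ good k G, forall t, 0 <= t.1.2 <= 1 -> close G t,
    forall q p, G q 0 p = F q p,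
    forall q p, hol k G (q, 1, p) &
    (forall p, M' p -> \forall p' \near p, forall q s, G q s p' = F q p') /\
    (exists Q', [/\ open Q', K' `<=` Q' & forall q s p, Q' q -> G q s p = F q p])].
Proof.
have gF := formal_family_good fF.
have [bK [sbK bK0 bK1 [Q' [oQ' KQ' bKQ']]]] := cutoff_near (@halfspace_closed R d) cK cK' oQ KQ.
have [D hD] := choice bump_data.
pose th p := (D p).1.1; pose C p := (D p).1.2; pose ci p := (D p).2.
have [|e he] := @countable_subcover R n setT M (fun p => [set p' | th p p' = 1]°).
  by move=> p; split; [exact: open_interior|have [_ _ h _ _] := hD p].
pose tl (l : nat) p := if e l is Some p0 then th p0 p else 0.
have stl l : manifold_smooth (tl l).
  rewrite /tl; case: (e l) => [p0|]; first by have [] := hD p0.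
  by move=> p i dp; exact: smooth_at_cst.
(* The rho l are locally finite, since rho m = 0 for m > l where tl l = 1; and
   rho l = 1 at p for the first l with tl l p >= 1/2. *)
pose rho (l : nat) p := smooth_step (2%:R * tl l p) * \prod_(m <- iota 0 l | true) (1 - smooth_step (2%:R * tl m p - 1)).
have sb01 x := @smooth_step_bounds R x.
have srho l : manifold_smooth (rho l).
  have sc (a c : R) m : manifold_smooth (fun p => smooth_step (a * tl m p + c)).
    apply: (manifold_smooth_comp (h := @smooth_step R) (b := fun p => a * tl m p + c)).
      exact: Cr_on_smooth_step.
    move=> p i dp; apply: smooth_atD; last exact: smooth_at_cst.
    by apply: smooth_atM; [exact: smooth_at_cst|exact: stl].
  move=> p i dp; apply: smooth_atM.
    by have := sc 2%:R 0 l p i dp; apply: smooth_at_eqA => y _; rewrite addr0.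
  apply: smooth_at_prod => m _; apply: smooth_atB; first exact: smooth_at_cst.
  exact: (sc 2%:R (-1) m p i dp).
have rho_ge0 l p : 0 <= rho l p.
  rewrite /rho mulr_ge0 //; first by have /andP[] := sb01 (2%:R * tl l p).
  apply: prodr_ge0 => m _; rewrite subr_ge0.
  by have /andP[] := sb01 (2%:R * tl m p - 1).
have rho_late l m p : (l < m)%N -> tl l p = 1 -> rho m p = 0.
  move=> lm tp; rewrite /rho (big_rem l) /=; last by rewrite mem_iota.
  have -> : smooth_step (2%:R * tl l p - 1) = 1 by rewrite tp smooth_step1 //; lra.
  by rewrite subrr mul0r mulr0.
have rho_out l p0 p : e l = Some p0 -> ~ C p0 p -> rho l p = 0.
  move=> el nC; have [_ _ _ _ h] := hD p0.
  by rewrite /rho /tl el /th h // mulr0 smooth_step0 // mul0r.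
pose inv G := good k G /\ forall t, 0 <= t.1.2 <= 1 -> close G t.
(* The clauses that need it assume [inv G], so that every [G] has a successor and [choice] yields a
   total function; it is iterated only from [F0], where [inv] holds. *)
pose stage l G G' := [/\ inv G -> inv G',
   forall t, t.1.2 = 0 \/ bK t.1.1 = 0 \/ (\forall p \near t.2, rho l p = 0) ->
      G' t.1.1 t.1.2 t.2 = G t.1.1 t.1.2 t.2,
   inv G -> forall t, 0 <= t.1.2 <= 1 -> hol k G t -> hol k G' t,
   (forall p, M' p -> \forall p' \near p, forall q s, G' q s p' = G q s p') &
   inv G -> forall t p0, e l = Some p0 -> ~ M' p0 -> t.1.2 = 1 -> bK t.1.1 = 1 -> rho l t.2 = 1 -> hol k G' t].
have stage_ex (lG : nat * (K -> R -> M -> jet M)) : exists G', stage lG.1 lG.2 G'.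
  case: lG => l G /=.
  have trivial : (forall p0, e l = Some p0 -> M' p0) -> exists G', stage l G G'.
    move=> h; exists G; split=> //.
      by move=> p _; apply: (@filterE _ _ (nbhs_filter _)).
    by move=> _ t p0 el nM; have := h p0 el.
  case el : (e l) => [p0|]; last by apply: trivial => p0; rewrite el.
  have [Mp|nMp] := pselect (M' p0); first by apply: trivial => p1; rewrite el => -[<-].
  have [[gG cG]|nI] := pselect (inv G); last first.
    exists G; split=> //.
    by move=> p _; apply: (@filterE _ _ (nbhs_filter _)).
  have [_ _ _ [h1 [h2 [_ h3]]] h4] := hD p0.
  have [G' [gG' cG' eG' hp hG']] := full_stage rg ceps eps_gt0 gF cK h1 h2 (srho l) sbK
    (rho_ge0 l) bK0 (fun p => rho_out l p0 p el) k3 gG cG.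
  exists G'; split=> //.
    move=> p Mp.
    have cl : closed (C p0) by apply: compact_closed => //; exact: manifold_hausdorff.
    have nC : \forall p' \near p, ~ C p0 p'.
      by apply: open_nbhs_nbhs; split; [exact: closed_openC|exact: (h3 nMp p Mp)].
    apply: filterS (near_near nC) => p' hp' q s; apply: (eG' (q, s, p')); right; right.
    by apply: filterS hp' => p'' nC''; exact: rho_out el nC''.
  by move=> _ t p1 _ _; exact: hG'.
have [nxt hnxt] := choice stage_ex.
pose Gs := fix Gs l := if l is l'.+1 then nxt (l', Gs l') else F0.
have hs l : stage l (Gs l) (Gs l.+1) by exact: (hnxt (l, Gs l)).
have inv0 : inv (Gs 0%N) by split=> // t ts; exact: planes_close_refl.
have invs l : inv (Gs l).
  elim: l => [|l IH]; first exact: inv0.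
  by have [h _ _ _ _] := hs l; exact: h.
have frozen l t : t.1.2 = 0 \/ bK t.1.1 = 0 -> Gs l t.1.1 t.1.2 t.2 = F t.1.1 t.2.
  move=> ht; elim: l => // l IH; have [_ h _ _ _] := hs l; rewrite h //.
  by case: ht => ?; [left|right; left].
have hol_mono l m t : (l <= m)%N -> 0 <= t.1.2 <= 1 -> hol k (Gs l) t -> hol k (Gs m) t.
  move=> /subnKC <- ts; elim: (m - l)%N => [|r IH] h; first by rewrite addn0.
  by rewrite addnS; have [_ _ hh _ _] := hs (l + r)%N; exact: (hh (invs _) t ts (IH h)).
have near_const p : exists l, \forall p' \near p, forall m q s, (l <= m)%N -> Gs m q s p' = Gs l q s p'.
  have [l [p0 [el Op]]] := he p.
  exists l.+1; have h : \forall p' \near p, th p0 p' = 1 by exact: Op.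
  apply: filterS (near_near h) => p' hp' m q s.
  move=> /subnKC <-; elim: (m - l.+1)%N => [|r IH]; first by rewrite addn0.
  rewrite addnS -IH; have [_ hh _ _ _] := hs (l.+1 + r)%N; apply: (hh (q, s, p')).
  right; right; apply: filterS hp' => p'' tp; apply: (rho_late l); first by rewrite addSn ltnS leq_addr.
  by rewrite /tl el.
have [N hN] := choice near_const.
(* The index [N p] may jump with [p], but [near_G] shows that near each point [G] is a single term
   of the sequence, so smoothness and holonomy pass to the limit. *)
pose G q s p := Gs (N p) q s p.
have near_G p : \forall p' \near p, forall m q s, (N p <= m)%N -> Gs m q s p' = G q s p'.
  apply: filterS (near_near (hN p)) => p' hp' m q s lem.
  have h1 := nbhs_singleton hp'; have h2 := nbhs_singleton (hN p').
  have a1 := h1 (maxn m (N p')) q s (leq_trans lem (leq_maxl _ _)).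
  have a2 := h2 (maxn m (N p')) q s (leq_maxr _ _).
  by rewrite /G -a2 a1 (h1 m q s lem).
have near_GT t m : (N t.2 <= m)%N -> \forall t' \near t, Gs m t'.1.1 t'.1.2 t'.2 = G t'.1.1 t'.1.2 t'.2.
  move=> lem; have ct : t'.2 @[t' --> t] --> t.2 by case: (t) => t1 t2; exact: cvg_snd.
  have h : \forall t' \near t, forall m q s, (N t.2 <= m)%N -> Gs m q s t'.2 = G q s t'.2 := ct _ (near_G t.2).
  by apply: (@filterS _ _ (nbhs_filter t) _ _ _ h) => t' ht'; exact: ht'.
have holG t m : (N t.2 <= m)%N -> hol k (Gs m) t -> hol k G t.
  move=> lem; apply: hol_near; apply: filterS (near_G t.2) => p' hp'; exact: hp'.
have ss1 : 0 <= (1 : R) <= 1 by rewrite ler01 lexx.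
exists G; split.
- move=> t ts; have [gN _] := invs (N t.2); have [h1 h2] := gN t ts; split; first exact: h1.
  apply: jet_smooth_near h2.
  by apply: (@filterS _ _ (nbhs_filter t) _ _ _ (near_GT t (N t.2) (leqnn _))) => t' ht' _.
- by move=> t ts; have [_ h] := invs (N t.2); exact: h.
- by move=> q p; apply: (frozen _ (q, 0, p)); left.
- move=> q p.
  have fin l : hol k (Gs l) (q, 1, p) -> hol k G (q, 1, p).
    move=> h; apply: (holG _ (maxn l (N p))); first exact: leq_maxr.
    by apply: hol_mono h => //; exact: leq_maxl.
  (* Over [Q] and over [U] the family is holonomic from the start and stays so; elsewhere [bK] is
     [1] and some stage has to act. *)
  have [Qq|nQ] := pselect (Q q).
    by apply: (fin 0%N); apply: (holonomic_hol (@openT _)) => //; exact: hQ.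
  have [Up|nU] := pselect (U p).
    by apply: (fin 0%N); apply: (holonomic_hol oU) => //; exact: hU.
  have ex : exists l, 1 <= 2%:R * tl l p.
    have [l [p0 [el Op]]] := he p; exists l; rewrite /tl el.
    have -> : th p0 p = 1 by exact: (interior_subset Op).
    by rewrite mulr1 ler1n.
  case: (ex_minnP ex) => l hl lmin.
  have rl : rho l p = 1.
    rewrite /rho smooth_step1 // mul1r big_seq_cond big1 // => m.
    rewrite mem_iota /= add0n andbT => ml; rewrite smooth_step0 ?subr0 // subr_le0.
    rewrite leNgt; apply/negP => /ltW /lmin; by rewrite leqNgt ml.
  move: hl; rewrite /tl; case el : (e l) => [p0|]; last by rewrite mulr0 ler10.
  (* A bump centred in [M'] that is nonzero at [p] would put [p] into [U]; hence this stage is one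
     that acts. *)
  move=> hl; have nMp : ~ M' p0.
    move=> Mp; have [_ _ _ [_ [_ [h _]]] h4] := hD p0.
    apply: nU; apply: (h Mp); apply: contrapT => nC; move: hl.
    by rewrite /th h4 // mulr0 ler10.
  apply: (fin l.+1); have [_ _ _ _ h] := hs l.
  by apply: (h (invs l) _ p0) => //; exact: bK1.
- split; last first.
    exists Q'; split=> // q s p Qq; apply: (frozen _ (q, s, p)); right; exact: bKQ'.
  move=> p Mp.
  have h l : \forall p' \near p, forall q s, Gs l q s p' = F q p'.
    elim: l => [|l IH]; first by apply: (@filterE _ _ (nbhs_filter _)).
    have [_ _ _ hh _] := hs l; apply: filterS2 (hh p Mp) IH => p' a1 a2 q s.
    by rewrite a1 a2.
  apply: filterS2 (near_G p) (h (N p)) => p' a1 a2 q s.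
  by rewrite -(a1 _ q s (leqnn _)) a2.
Qed.

End Homotopy.

(** * Ranks at most two *)

Lemma curv_anti (R : realType) n k (W : 'M[R]_(k, n)) E a b : curv W E b a = - curv W E a b.
Proof. by rewrite /curv opprB. Qed.

(** With at most two frame vectors all curvatures are multiples of a single vector [w], so plane and
    curvature together span at most [k + 1] dimensions. *)
Lemma curv_epi_rank (R : realType) n k (W : 'M[R]_(k, n)) E : (k <= 2)%N -> curv_epi W E ->
  (n <= k.+1)%N.
Proof.
move=> k2 ce.
have lt01 (a b : 'I_k) : (a < b)%N -> val a = 0%N /\ val b = 1%N.
  move=> ab; have b1 : (b <= 1)%N by rewrite -ltnS (leq_trans (ltn_ord b)).
  have b0 : (0 < b)%N by rewrite (leq_ltn_trans _ ab).
  have eb : val b = 1%N by apply/eqP; rewrite eqn_leq b1.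
  by split=> //; apply/eqP; rewrite -leqn0 -ltnS -[1%N]eb.
have [w hw] : exists w : 'rV[R]_n, forall y : 'cV[R]_n, w *m y = 0 -> forall a b, curv W E a b *m y = 0.
  have diag a y : curv W E a a *m y = 0 by rewrite /curv subrr mul0mx.
  have [[a [b ab]]|nab] := pselect (exists a b : 'I_k, (a < b)%N); last first.
    exists 0 => y _ a b; have -> : a = b; last exact: diag.
    apply/val_inj; case: (ltngtP a b) => // h; exfalso; apply: nab; first by exists a, b.
    by exists b, a.
  have [a0 b1] := lt01 a b ab.
  exists (curv W E a b) => y hy a' b'.
  case: (ltngtP a' b') => h.
  - have [a0' b1'] := lt01 _ _ h.
    by have -> : a' = a; [apply/val_inj; rewrite a0|have -> : b' = b; [apply/val_inj; rewrite b1|]].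
  - have [a0' b1'] := lt01 _ _ h.
    have -> : b' = a by apply/val_inj; rewrite a0.
    have -> : a' = b by apply/val_inj; rewrite b1.
    by rewrite curv_anti mulNmx hy oppr0.
  - by have -> : a' = b' by apply/val_inj.
have rf : row_full (col_mx W w).
  apply: annihilator_row_full => y; rewrite mul_col_mx => /(congr1 (fun A => (usubmx A, dsubmx A))).
  by rewrite col_mxKu col_mxKd !linear0 => -[Wy /hw cy]; exact: ce.
have := rank_leq_row (col_mx W w); rewrite (eqP rf); by rewrite addn1.
Qed.

Lemma step2_rank (R : realType) n (M : manifold R n) k (p : M) F :
  (4 <= n)%N -> step2_relation k p F -> (2 < k)%N.
Proof.
move=> n4 [J ce]; rewrite ltnNge; apply/negP => k2.
have [i dp] := dom_cover p.
have [P1 P2 P3 _] := jet0_plane dp J.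
have [f u] := rank_proj_frame P3 P1 P2.
have [nW nE] := normal_coord_normalized dp J u.
move: ce; rewrite (jet_normal_form dp J u) => /(curvature_epi_curv dp nW nE) /(curv_epi_rank k2) nk.
by have := leq_trans n4 (leq_trans nk (leq_ltn_trans k2 (ltnSn _))).
Qed.

Theorem theorem1p5 (R : realType) (n : nat) (M : manifold R n) (k : nat)
  (dim_ge4 : (4 <= n)%N) (rank_lt : (k < n)%N) :
  complete_C0_close_h_principle (M := M) k (step2_relation k).
Proof.
move=> d K F M' K' g eps cK fF cM' cK' [U [oU MU hU]] [Q [oQ KQ hQ]] rg ceps eps0.
have [rF _] := fF.
(* For [k <= 2] the relation is empty, so a family of formal solutions forces [K] or [M] to be
   empty, and the constant homotopy works. *)
have [k3|k2] := boolP (2 < k)%N; last first.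
  have empty (q : K) (p : M) : False.
    by move/negP: k2; apply; exact: step2_rank dim_ge4 (rF q p).
  exists (fun q _ p => F q p); split.
  - split=> [q s p _|a i]; first exact: rF.
    by split=> [|v] v' [[[q _ _] _] [p _ _]]; case: (empty q p).
  - by [].
  - move=> q; exists (fun=> set0); last by move=> p; case: (empty q p).
    by split=> [p|i x [p _ _]]; case: (empty q p).
  - split; first by exists U; split.
    by exists Q; split.
  - by move=> q s p; case: (empty q p).
have [G [gG cG G0 G1 [GM [Q' [oQ' KQ' GQ]]]]] :=
  homotopy_exists rg ceps eps0 fF cK k3 cM' oU MU hU cK' oQ KQ hQ.
exists G; split.
- exact: good_formal_homotopy.
- exact: G0.
- by move=> q; apply: hol_holonomic => //; rewrite ler01 lexx.
- split; last by exists Q'; split=> // q s p _; exact: GQ.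
  (* [GM] gives a neighbourhood of each point of [M']; the interior collects them into one open
     set. *)
  exists [set p | forall q s, G q s p = F q p]°; split; first exact: open_interior.
    by move=> p /GM.
  by move=> q s p _ /interior_subset h; exact: h.
- by move=> q s p ss; exact: (cG (q, s, p) ss).
Qed.
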